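(* Fix a real number $\alpha$ that occurs as an eigenvalue of the modified Laplacian matrix of some finite rooted tree. There exist constants $\nu_{\mathrm{rec},\alpha}$ and $\tau^2_{\mathrm{rec},\alpha}$ such that the multiplicity $L_{\alpha}(\mathcal{R}_n)$ of $\alpha$ as a Laplacian eigenvalue of the random recursive tree $\mathcal{R}_n$ with $n$ vertices satisfies, as $n\to\infty$, \[\frac{L_{\alpha}(\mathcal{R}_n)-\nu_{\mathrm{rec},\alpha}\,n}{\sqrt{n}}\xrightarrow{d}\mathcal{N}(0,\tau^2_{\mathrm{rec},\alpha}).\] Likewise, there exist constants $\nu_{\mathrm{bin},\alpha}$ and $\tau^2_{\mathrm{bin},\alpha}$ such that the multiplicity $L_{\alpha}(\mathcal{B}_n)$ of $\alpha$ as a Laplacian eigenvalue of the random binary increasing tree $\mathcal{B}_n$ with $n$ vertices satisfies, as $n\to\infty$, \[\frac{L_{\alpha}(\mathcal{B}_n)-\nu_{\mathrm{bin},\alpha}\,n}{\sqrt{n}}\xrightarrow{d}\mathcal{N}(0,\tau^2_{\mathrm{bin},\alpha}).\]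
   Context: The Laplacian matrix of a graph has the vertex degrees as diagonal entries; an off-diagonal entry is $-1$ if the two vertices are adjacent and $0$ otherwise. Laplacian eigenvalues of a tree are the eigenvalues of the Laplacian matrix of the underlying undirected graph, and $L_\alpha(T)$ is the multiplicity of $\alpha$ as a Laplacian eigenvalue of $T$ ($0$ if it is not one). The modified Laplacian matrix of a rooted tree is obtained from its Laplacian matrix by adding $1$ to the diagonal entry corresponding to the root. A recursive tree with $n$ vertices is a rooted (unordered) tree with vertex labels $1,\dots,n$, each used once, whose labels increase along every path starting at the root. There are $(n-1)!$ of them, and the random recursive tree $\mathcal{R}_n$ is uniformly distributed among them. A binary increasing tree with $n$ vertices is a rooted tree in which every vertex has at most one left child and at most one right child, with vertex labels $1,\dots,n$, each used once, increasing along every path starting at the root. There are $n!$ of them, and the random binary increasing tree $\mathcal{B}_n$ is uniformly distributed among them. $\mathcal{N}(\mu,\sigma^2)$ denotes the normal distribution with mean $\mu$ and variance $\sigma^2\ge 0$ (a point mass at $\mu$ if $\sigma^2=0$), and $\xrightarrow{d}$ denotes convergence in distribution. *)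

(* Defs.v *)
From HB Require Import structures.
From mathcomp Require Import all_boot all_order all_algebra.
From mathcomp Require Import all_classical all_reals all_analysis.

Set Implicit Arguments.
Unset Strict Implicit.
Unset Printing Implicit Defensive.

Import Order.TTheory GRing.Theory Num.Theory.
Import numFieldNormedType.Exports.
Local Open Scope classical_set_scope.
Local Open Scope ring_scope.

(* A rooted tree on the vertices 0, ..., n-1 is encoded by its parent map: the
   root is the vertex without a parent.  A vertex is identified with its label,
   and labels run from 0 to n-1 instead of 1 to n. *)
Definition parent_map (n : nat) := {ffun 'I_n -> option 'I_n}.

Definition child n (t : parent_map n) : rel 'I_n :=
  fun u v => t v == Some u.

Definition is_root n (t : parent_map n) (r : 'I_n) : bool := t r == None.

(* Parents being unique, reachability of every vertex from a parentless one
   forces uniqueness of the root and excludes cycles; it also forces 0 < n. *)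
Definition is_rooted_tree n (t : parent_map n) : bool :=
  [exists r, is_root t r && [forall v, connect (child t) r v]].

(* Labels increase along every edge leading away from the root, equivalently
   along every path starting at the root. *)
Definition is_increasing n (t : parent_map n) : bool :=
  [forall u, forall v, child t u v ==> (u < v)%N].

Definition rooted_tree (n : nat) := {t : parent_map n | is_rooted_tree t}.

Definition recursive_tree (n : nat) :=
  {t : parent_map n | is_rooted_tree t && is_increasing t}.

(* In a binary tree, each vertex other than the root stores its parent together
   with the side (left or right) on which it is attached. *)
Definition sided_parent_map (n : nat) := {ffun 'I_n -> option ('I_n * bool)}.

Definition forget_sides n (b : sided_parent_map n) : parent_map n :=
  [ffun v => omap fst (b v)].

Definition one_child_per_side n (b : sided_parent_map n) : bool :=
  [forall u, forall side, #|[pred v | b v == Some (u, side)]| <= 1]%N.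

Definition binary_increasing_tree (n : nat) :=
  {b : sided_parent_map n |
    [&& is_rooted_tree (forget_sides b), one_child_per_side b
      & is_increasing (forget_sides b)]}.

Definition adjacent n (t : parent_map n) : rel 'I_n :=
  fun u v => child t u v || child t v u.

Definition laplacian (R : realType) n (e : rel 'I_n) : 'M[R]_n :=
  \matrix_(i, j) if i == j then #|[pred k | e i k]|%:R
                 else if e i j then -1 else 0.

Definition tree_laplacian (R : realType) n (t : parent_map n) : 'M[R]_n :=
  laplacian R (adjacent t).

Definition modified_laplacian (R : realType) n (t : parent_map n) : 'M[R]_n :=
  tree_laplacian R t + \matrix_(i, j) ((i == j) && is_root t i)%:R.

Definition laplacian_multiplicity (R : realType) (alpha : R) n
    (t : parent_map n) : nat :=
  mup alpha (char_poly (tree_laplacian R t)).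

Definition finite_uniform_prob (R : realType) (T : finType) (E : pred T) : R :=
  #|E|%:R / #|T|%:R.

(* Parametrised by the variance v, unlike [normal_prob], which takes the
   standard deviation and has a junk value when it is zero. *)
Definition normal_law (R : realType) (m v : R) :
    probability (measurableTypeR R) R :=
  if v == 0 then
    (@dirac _ (measurableTypeR R) m R : probability (measurableTypeR R) R)
  else
    (normal_prob m (Num.sqrt v) : probability (measurableTypeR R) R).

Definition law_cdf (R : realType) (mu : probability (measurableTypeR R) R)
    (x : R) : R :=
  fine (mu `]-oo, x]%classic).

(* Convergence in distribution of random variables X n, each defined on the
   finite set T n with the uniform distribution, to the law mu: the distribution
   functions converge at every continuity point of the limiting one. *)
Definition cvg_in_distribution (R : realType) (T : nat -> finType)
    (X : forall n, T n -> R) (mu : probability (measurableTypeR R) R) : Prop :=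
  forall x : R, {for x, continuous (law_cdf mu)} ->
    finite_uniform_prob R (fun t : T n => X n t <= x) @[n --> \oo] --> law_cdf mu x.

Definition normalized_multiplicity (R : realType) (alpha nu : R) n
    (t : parent_map n) : R :=
  ((laplacian_multiplicity alpha t)%:R - nu * n%:R) / Num.sqrt n%:R.

(* Main.v *)
Require Import Defs.
From HB Require Import structures.
From mathcomp Require Import all_boot all_order all_algebra.
From mathcomp Require Import all_classical all_reals all_analysis.
From mathcomp Require Import measurable_realfun ring lra zify.

(* Write the multiplicity as n - rank (L - alpha), L being symmetric.  Deleting a
   bounded number of edges from a tree changes a rank by a bounded amount, so this
   nullity is a functional F of binary trees with F(t) = F(left) + F(right) + O(1).
   For binary increasing trees the binary tree is the tree itself; for a recursive
   tree on the labels 0, ..., n it is its left-child right-sibling encoding, whose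
   two halves are the subtree rooted at the vertex 1 and the rest.  In both models
   the shape grows by a uniform insertion, and given the size of the left part,
   which is uniform, the two parts are independent and distributed as smaller
   copies.

   With Y = F - nu (n + 1) this gives quicksort recurrences: for the right nu the
   mean of Y is O(1) and its second moment is s2 (n + 1) + O(sqrt n).  Replacing
   the two halves one after the other by a simple random walk with steps of
   variance s2, and expanding a test function with Lipschitz second derivative to
   third order, the error e_n satisfies the same recurrence with toll O(n), whence
   e_n = O(n log n); this is negligible against n^(3/2), the scale of a third
   derivative.  Finally the walk is compared with the Gaussian law by Lindeberg's
   method, the Gaussian semigroup coming from completing the square. *)

Set Implicit Arguments.
Unset Strict Implicit.
Unset Printing Implicit Defensive.

Import Order.TTheory GRing.Theory Num.Theory.
Import numFieldNormedType.Exports.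
Local Open Scope ring_scope.

(** * Random binary trees *)

(** The rank is stable under low-rank changes and blind to the numbering of the vertices, so it is a
    function of the unlabelled shape. The root of a recursive tree may have many branches; cutting
    off only the branch at the vertex 1 keeps the toll bounded. Sizes enter as [n + 1], the number
    of leaves of a binary tree with [n] nodes: this adds up exactly over the two halves, so that
    centring by [nu * (n + 1)] leaves the toll unchanged and a walk of [n + 1] steps splits in the
    same way. The obstacle is that the first two moments of [Y] match those of the walk only up to
    O(1) and O(sqrt n). The comparison is therefore stated for test functions whose second-order
    Taylor polynomial at 0 vanishes, a distance of Zolotarev type of order 3. Replacing one half
    re-expands the test function at the current position [x], where its first two derivatives are
    O(x^2) and O(|x|). As [x] has size sqrt n, each mismatch costs O(n), the order of the error
    caused by the toll of [F]. *)

Inductive btree := Leaf | Node of btree & btree.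

Fixpoint nodes (t : btree) : nat :=
  if t is Node l r then (nodes l + nodes r).+1 else 0.

(** One tree per leaf, that leaf being replaced by a node: the insertion step of a random binary
    search tree. *)
Fixpoint grow (t : btree) : seq btree :=
  if t is Node l r then
    [seq Node l' r | l' <- grow l] ++ [seq Node l r' | r' <- grow r]
  else [:: Node Leaf Leaf].

Lemma size_grow t : size (grow t) = (nodes t).+1.
Proof.
by elim: t => //= l IHl r IHr; rewrite size_cat !size_map IHl IHr addSn addnS.
Qed.

Lemma nodes_grow t : all (fun t' => nodes t' == (nodes t).+1) (grow t).
Proof.
elim: t => //= l IHl r IHr; rewrite all_cat !all_map; apply/andP; split.
  by apply: sub_all IHl => t' /= /eqP ->; rewrite addSn.
by apply: sub_all IHr => t' /= /eqP ->; rewrite addnS.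
Qed.

Section ShapeExpectation.
Variable R : realFieldType.
Implicit Types (phi psi : btree -> R) (n : nat).

(** Expectation after [n] uniform insertions. The last insertion is averaged into the test function,
    so the recursion runs backwards along the Markov chain. *)
Fixpoint shape_mean n phi : R :=
  if n is n'.+1 then
    n'.+1%:R^-1 * shape_mean n' (fun t => \sum_(t' <- grow t) phi t')
  else phi Leaf.

Local Notation E := shape_mean.

Lemma ler_sum_all (s : seq btree) (a : pred btree) phi psi :
  all a s -> (forall t, a t -> phi t <= psi t) ->
  \sum_(t <- s) phi t <= \sum_(t <- s) psi t.
Proof.
move=> + le_phi; elim: s => [|t s IH] /=; first by rewrite !big_nil.
by case/andP=> at_ as_; rewrite !big_cons lerD ?le_phi ?IH.
Qed.

Lemma le_shape_mean n phi psi :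
  (forall t, nodes t = n -> phi t <= psi t) -> E n phi <= E n psi.
Proof.
elim: n phi psi => [|n IH] phi psi le_phi /=; first exact: le_phi.
rewrite ler_pM2l ?invr_gt0 ?ltr0n//; apply: IH => t nt.
apply: ler_sum_all (nodes_grow t) _ => t' /eqP nt'.
by apply: le_phi; rewrite nt' nt.
Qed.

Lemma eq_shape_mean n phi psi :
  (forall t, nodes t = n -> phi t = psi t) -> E n phi = E n psi.
Proof.
move=> eq_phi; apply/eqP; rewrite eq_le.
by rewrite !le_shape_mean// => t nt; rewrite eq_phi.
Qed.

Lemma shape_meanD n phi psi : E n (fun t => phi t + psi t) = E n phi + E n psi.
Proof.
elim: n phi psi => //= n IH phi psi; rewrite -mulrDr -IH.
by congr (_ * _); apply: eq_shape_mean => t _; rewrite big_split.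
Qed.

Lemma shape_meanZ n a phi : E n (fun t => a * phi t) = a * E n phi.
Proof.
elim: n phi => //= n IH phi; rewrite mulrCA -IH.
by congr (_ * _); apply: eq_shape_mean => t _; rewrite mulr_sumr.
Qed.

Lemma shape_meanB n phi psi : E n (fun t => phi t - psi t) = E n phi - E n psi.
Proof.
rewrite -mulN1r -shape_meanZ -shape_meanD.
by apply: eq_shape_mean => t _; rewrite mulN1r.
Qed.

Lemma shape_mean_cst n a : E n (fun=> a) = a.
Proof.
elim: n a => //= n IH a.
rewrite (eq_shape_mean (psi := fun=> n.+1%:R * a)).
  by rewrite shape_meanZ IH mulKf// pnatr_eq0.
by move=> t nt; rewrite big_const_seq count_predT size_grow nt iter_addr_0 mulr_natl.
Qed.

Lemma le_norm_shape_mean n phi psi :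
  (forall t, nodes t = n -> `|phi t| <= psi t) -> `|E n phi| <= E n psi.
Proof.
move=> le_phi; rewrite ler_norml -mulN1r -shape_meanZ.
apply/andP; split; apply: le_shape_mean => t /le_phi; rewrite ler_norml ?mulN1r;
  by case/andP.
Qed.

(** A Pólya urn: an insertion goes to the left part with weight [k + 1] and to the right part with
    weight [n - k + 1]. The sizes [(k, n + 1 - k)] are then reached from [k - 1] with weight [k] and
    from [k] with weight [n + 1 - k], in total [n + 1] for every [k], so the left size stays
    uniform. *)
Lemma shape_mean_split n phi :
  n.+1%:R * E n.+1 phi =
  \sum_(k < n.+1) E k (fun l => E (n - k)%N (fun r => phi (Node l r))).
Proof.
elim: n phi => [|n IH] phi.
  by rewrite big_ord1 /= invr1 !mul1r big_seq1.
have n1 : n.+1%:R != 0 :> R by rewrite pnatr_eq0.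
have n2 : n.+2%:R != 0 :> R by rewrite pnatr_eq0.
set G := fun i j => E i (fun l => E j (fun r => phi (Node l r))).
have growS k psi : E k (fun t => \sum_(t' <- grow t) psi t') =
    k.+1%:R * E k.+1 psi by rewrite /= mulVKf// pnatr_eq0.
rewrite -growS; apply: (mulfI n1); rewrite IH.
under eq_bigr => k _.
  rewrite (_ : E _ _ = k.+1%:R * G k.+1 (n - k)%N +
      (n - k).+1%:R * G k (n - k).+1); first over.
  rewrite /G -growS -shape_meanZ -shape_meanD; apply: eq_shape_mean => l _.
  rewrite -growS -[X in X + _](_ : E (n - k)%N (fun r =>
     \sum_(l' <- grow l) phi (Node l' r)) = _).
    rewrite -shape_meanD; apply: eq_shape_mean => r _ /=.
    by rewrite big_cat /= !big_map.
  elim: (grow l) => [|l' s IHs].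
    rewrite big_nil -[RHS](shape_mean_cst (n - k)).
    by apply: eq_shape_mean => r _; rewrite big_nil.
  rewrite big_cons -IHs -shape_meanD.
  by apply: eq_shape_mean => r _; rewrite big_cons.
rewrite big_split /= mulr_sumr.
have -> : \sum_(k < n.+1) k.+1%:R * G k.+1 (n - k)%N =
    \sum_(k < n.+2) k%:R * G k (n.+1 - k)%N.
  rewrite [RHS]big_ord_recl /= mul0r add0r.
  by apply: eq_bigr => k _; rewrite /bump /= add1n subSS.
have -> : \sum_(k < n.+1) (n - k).+1%:R * G k (n - k).+1 =
    \sum_(k < n.+2) (n.+1 - k)%:R * G k (n.+1 - k)%N.
  rewrite [RHS]big_ord_recr /= subnn mul0r addr0.
  by apply: eq_bigr => k _; rewrite subSn// -ltnS.
rewrite -big_split /=; apply: eq_bigr => k _.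
by rewrite -mulrDl -natrD subnKC// -ltnS.
Qed.

End ShapeExpectation.

(** * The quicksort recurrence *)

Section QuicksortRecurrence.
Variable R : realType.
Implicit Types (a w e : nat -> R) (B : R) (n : nat).

(** [w + e] decreases and [w - e] increases, so every value of the former dominates every value of
    the latter; [nu] is the supremum of [w - e]. *)
Lemma telescoping_limit w e :
  (forall n, 0 <= e n) -> (forall n, `|w n.+1 - w n| <= e n - e n.+1) ->
  exists nu, forall n, `|w n - nu| <= e n.
Proof.
move=> e0 dw.
have up n k : w (n + k)%N + e (n + k)%N <= w n + e n.
  elim: k => [|k IH]; first by rewrite addn0.
  apply: le_trans IH; have := dw (n + k)%N; rewrite ler_norml addnS.
  by case/andP=> _; lra.
have dn n k : w n - e n <= w (n + k)%N - e (n + k)%N.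
  elim: k => [|k IH]; first by rewrite addn0.
  apply: (le_trans IH); have := dw (n + k)%N; rewrite ler_norml addnS.
  by case/andP=> + _; lra.
have le_dn_up m n : w m - e m <= w n + e n.
  have := dn m n; have := up n m; rewrite [(n + m)%N]addnC.
  by have := e0 (m + n)%N; lra.
pose A : set R := [set x | exists n, x = w n - e n]%classic.
have supA : has_sup A.
  split; first by exists (w 0%N - e 0%N), 0%N.
  by exists (w 0%N + e 0%N) => _ [m ->].
exists (sup A) => n; rewrite ler_norml.
have : w n - e n <= sup A by apply: ub_le_sup; [case: supA | exists n].
have : sup A <= w n + e n.
  by apply: ge_sup; [case: supA | move=> _ [m ->]].
by lra.
Qed.

Definition toll a n : R := n.+1%:R * a n.+1 - 2 * \sum_(k < n.+1) a k.

(** Normalised to be the constant [c] when [a n = c * (n + 1)], the solutions without toll; its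
    increments involve only the toll. *)
Definition running_mean a n : R :=
  2 * (\sum_(k < n.+1) a k) / (n.+1%:R * n.+2%:R).

Let natS n : n.+1%:R = n%:R + 1 :> R. Proof. by rewrite -natr1. Qed.

Lemma running_meanS a n :
  running_mean a n.+1 - running_mean a n =
  2 * toll a n / (n.+1%:R * n.+2%:R * n.+3%:R).
Proof.
have n1 : n.+1%:R != 0 :> R by rewrite pnatr_eq0.
rewrite /running_mean /toll [in X in X - _]big_ord_recr /=.
have := pnatr_eq0 R n.+1; have := pnatr_eq0 R n.+2; have := pnatr_eq0 R n.
by rewrite /= !natS => h1 h2 h3; field; rewrite -!natS !pnatr_eq0.
Qed.

Lemma running_meanE a n :
  a n.+1 = n.+2%:R * running_mean a n + toll a n / n.+1%:R.
Proof.
by rewrite /running_mean /toll !natS; field; rewrite -!natS !pnatr_eq0.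
Qed.

(** A linear toll moves the running mean by at most [2 B / ((n + 2) (n + 3))], which telescopes. The
    limit is approached at rate [1 / n], and multiplying back by [n + 2] leaves a bounded error. *)
Lemma quicksort_linear a B : (forall n, `|toll a n| <= B * n.+1%:R) ->
  exists nu D, forall n, `|a n - nu * n.+1%:R| <= D.
Proof.
move=> tollB.
have B0 : 0 <= B by have := tollB 0%N; rewrite mulr1; apply: le_trans.
have n0 n : 0 < n.+1%:R :> R by rewrite ltr0n.
have [||nu hnu] := @telescoping_limit (running_mean a) (fun n => 2 * B / n.+2%:R).
- by move=> n; rewrite divr_ge0// mulr_ge0.
- move=> n; rewrite running_meanS normrM normfV [X in _ / X]ger0_norm; last first.
    by rewrite !mulr_ge0 ?ler0n.
  rewrite ler_pdivrMr ?mulr_gt0// normrM ger0_norm//.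
  have := tollB n; move: (toll a n) (n0 n) (n0 n.+1) (n0 n.+2) => c.
  rewrite (natS n.+2) (natS n.+1) (natS n); move: (n%:R : R) => x h1 h2 h3 hc.
  rewrite [leRHS](_ : _ = 2 * (B * (x + 1))); last by field; lra.
  by lra.
exists nu, (`|a 0%N - nu| + 3 * B) => -[|n].
  by rewrite mulr1 lerDl mulr_ge0.
apply: (@le_trans _ _ (3 * B)); last by rewrite lerDr.
rewrite running_meanE addrAC [nu * _]mulrC -mulrBr.
apply: (le_trans (ler_normD _ _)).
have -> : 3 * B = n.+2%:R * (2 * B / n.+2%:R) + B.
  by rewrite mulrCA mulfV ?mulr1 ?pnatr_eq0//; lra.
apply: lerD; first by rewrite normrM ger0_norm ?ler0n// ler_wpM2l ?ler0n.
by rewrite normrM normfV [X in _ / X]ger0_norm ?ler0n// ler_pdivrMr.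
Qed.

Let sqrt_tele n : (Num.sqrt n.+1%:R : R) / (n.+2%:R * n.+3%:R) <=
  2 * ((Num.sqrt n.+2%:R)^-1 - (Num.sqrt n.+3%:R)^-1).
Proof.
have rl : (Num.sqrt n.+1%:R : R) <= Num.sqrt n.+2%:R.
  by rewrite ler_sqrt ?ltr0n// ler_nat.
have st : (Num.sqrt n.+2%:R : R) <= Num.sqrt n.+3%:R.
  by rewrite ler_sqrt ?ltr0n// ler_nat.
have s0 : 0 < (Num.sqrt n.+2%:R : R) by rewrite sqrtr_gt0 ltr0n.
have t0 : 0 < (Num.sqrt n.+3%:R : R) by rewrite sqrtr_gt0 ltr0n.
have s2 : (Num.sqrt n.+2%:R : R) ^+ 2 = n.+2%:R by rewrite sqr_sqrtr ?ler0n.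
have t2 : (Num.sqrt n.+3%:R : R) ^+ 2 = n.+2%:R + 1.
  by rewrite sqr_sqrtr ?ler0n// natS.
move: (Num.sqrt n.+1%:R) (Num.sqrt n.+2%:R) (Num.sqrt n.+3%:R) s2 t2 s0 t0 rl st.
move=> r s t s2 t2 s0 t0 rl st; rewrite (natS n.+2) -t2 -s2.
have ts : (t - s) * (t + s) = 1 by rewrite -subr_sqr t2 s2; lra.
have -> : s^-1 - t^-1 = (t - s) / (s * t) by field; lra.
rewrite [leRHS]mulrA ler_pdivlMr ?mulr_gt0// mulrAC ler_pdivrMr ?mulr_gt0 ?exprn_gt0//.
rewrite (_ : 2 * (t - s) * (s ^+ 2 * t ^+ 2) = (2 * t * (t - s)) * (s * t) * s);
  last by ring.
have h : 1 <= 2 * t * (t - s) by have := sqr_ge0 (t - s); nra.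
have st0 : 0 < s * t by rewrite mulr_gt0.
have : r * (s * t) <= s * (s * t) by rewrite ler_wpM2r// ltW.
have : 1 * (s * t * s) <= (2 * t * (t - s)) * (s * t * s).
  by rewrite ler_wpM2r// !mulr_ge0 ?ltW.
by lra.
Qed.

Let running_mean_step a B n : 0 <= B ->
  `|toll a n| <= B * (n.+1%:R * Num.sqrt n.+1%:R) ->
  `|running_mean a n.+1 - running_mean a n| <=
  4 * B / Num.sqrt n.+2%:R - 4 * B / Num.sqrt n.+3%:R.
Proof.
move=> B0 tollB; rewrite running_meanS -mulrBr.
apply: (@le_trans _ _ (2 * B * (Num.sqrt n.+1%:R / (n.+2%:R * n.+3%:R)))).
  rewrite normrM normfV normrM ger0_norm// [X in _ / X]ger0_norm ?mulr_ge0//.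
  rewrite ler_pdivrMr ?mulr_gt0 ?ltr0n//.
  have h2 : n.+2%:R != 0 :> R by rewrite pnatr_eq0.
  have h3 : n.+3%:R != 0 :> R by rewrite pnatr_eq0.
  rewrite [leRHS](_ : _ = 2 * (B * (n.+1%:R * Num.sqrt n.+1%:R))).
    by rewrite ler_pM2l.
  move: (Num.sqrt _) h2 h3; move: (n.+1%:R : R) (n.+2%:R : R) (n.+3%:R : R).
  by move=> x y z s h2 h3; field; rewrite h2 h3.
rewrite (_ : 4 * B = 2 * B * 2); last by ring.
by rewrite -!mulrA !ler_wpM2l.
Qed.

(** An a priori form: only the tolls up to [n] are controlled, as happens in the middle of an
    induction on the size. The [5] is [4 * B] for the running mean plus [B] for the last toll. *)
Lemma quicksort_bound a B n : 0 <= B ->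
  (forall k, (k <= n)%N -> `|toll a k| <= B * (k.+1%:R * Num.sqrt k.+1%:R)) ->
  `|a n.+1| <= (`|a 0%N| + 5 * B) * n.+2%:R.
Proof.
move=> B0 tollB.
have mean_le k : (k <= n)%N ->
    `|running_mean a k| <= `|a 0%N| + 4 * B - 4 * B / Num.sqrt k.+2%:R.
  elim: k => [_|k IH kn].
    have -> : running_mean a 0 = a 0%N.
      by rewrite /running_mean big_ord1; field.
    rewrite -addrA lerDl subr_ge0 ler_piMr ?mulr_ge0//.
    by rewrite invf_le1 ?sqrtr_gt0// -[leLHS]sqrtr1 ler_sqrt// ler1n.
  have := IH (ltnW kn); have := running_mean_step B0 (tollB _ (ltnW kn)).
  have := ler_normD (running_mean a k.+1 - running_mean a k) (running_mean a k).
  by rewrite subrK; lra.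
rewrite running_meanE; move: (mean_le n (leqnn n)) (tollB _ (leqnn n)).
move: (running_mean a n) (toll a n) => m c mB cB.
apply: (le_trans (ler_normD _ _)).
rewrite normrM ger0_norm// [n.+2%:R * _]mulrC normrM normfV [X in _ / X]ger0_norm//.
have -> : (`|a 0%N| + 5 * B) * n.+2%:R =
  (`|a 0%N| + 4 * B) * n.+2%:R + B * n.+2%:R by ring.
apply: lerD.
  rewrite ler_wpM2r// (le_trans mB)// gerBl.
  by rewrite !mulr_ge0 ?invr_ge0 ?sqrtr_ge0.
rewrite ler_pdivrMr ?ltr0n// (le_trans cB)// -mulrA ler_wpM2l//.
rewrite mulrC ler_wpM2r//.
rewrite -[leRHS](@ger0_norm _ n.+2%:R) ?ler0n// -sqrtr_sqr ler_sqrt ?exprn_gt0 ?ltr0n//.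
by rewrite -natrX ler_nat expnS expn1 (leq_trans (leqnSn _))// leq_pmulr.
Qed.

(** A toll of order n^(3/2) still gives summable increments of the running mean, of order n^(-3/2),
    with tails of order n^(-1/2). *)
Lemma quicksort_linear_sqrt a B : 0 <= B ->
  (forall n, `|toll a n| <= B * (n.+1%:R * Num.sqrt n.+1%:R)) ->
  exists nu D, forall n, `|a n - nu * n.+1%:R| <= D * Num.sqrt n.+1%:R.
Proof.
move=> B0 tollB.
have [||nu hnu] :=
  @telescoping_limit (running_mean a) (fun n => 4 * B / Num.sqrt n.+2%:R).
- by move=> n; rewrite !mulr_ge0 ?invr_ge0 ?sqrtr_ge0.
- by move=> n; apply: running_mean_step.
exists nu, (`|a 0%N - nu| + 5 * B) => -[|n].
  by rewrite sqrtr1 !mulr1 lerDl mulr_ge0.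
apply: (@le_trans _ _ (5 * B * Num.sqrt n.+2%:R)); last first.
  by rewrite ler_wpM2r ?sqrtr_ge0// lerDr.
rewrite running_meanE addrAC [nu * _]mulrC -mulrBr.
apply: (le_trans (ler_normD _ _)).
have s0 : 0 < Num.sqrt (n.+2%:R : R) by rewrite sqrtr_gt0 ltr0n.
have -> : 5 * B * Num.sqrt n.+2%:R =
    n.+2%:R * (4 * B / Num.sqrt n.+2%:R) + B * Num.sqrt n.+2%:R.
  have := @sqr_sqrtr R n.+2%:R (ler0n _ _); move: (Num.sqrt _) s0 => s s0 <-.
  by field; rewrite gt_eqF.
apply: lerD; first by rewrite normrM ger0_norm ?ler0n// ler_wpM2l ?ler0n.
rewrite normrM normfV [X in _ / X]ger0_norm ?ler0n// ler_pdivrMr ?ltr0n//.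
apply: (le_trans (tollB n)); rewrite -mulrA ler_wpM2l// mulrC ler_wpM2r//.
by rewrite ler_sqrt ?ltr0n// ler_nat.
Qed.

End QuicksortRecurrence.

(** * First and second moments of an additive functional *)

Section Moments.
Variable R : realType.
Local Notation E := (@shape_mean R).
Implicit Types (phi F Y : btree -> R) (C D : R).

Lemma toll_shape_mean phi n :
  toll (fun n => E n phi) n =
  \sum_(k < n.+1) E k (fun l => E (n - k) (fun r => phi (Node l r) - phi l - phi r)).
Proof.
rewrite /toll shape_mean_split.
have -> : 2 * \sum_(k < n.+1) E k phi =
    \sum_(k < n.+1) (E k phi + E (n - k)%N phi).
  rewrite big_split /= [X in _ = _ + X](reindex_inj rev_ord_inj) /=.
  rewrite mulr_natl mulr2n; congr (_ + _); apply: eq_bigr => k _.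
  by rewrite subSS subKn// -ltnS.
rewrite -sumrB; apply: eq_bigr => k _.
rewrite opprD addrA.
rewrite -[E (n - k)%N phi](shape_mean_cst k) -!shape_meanB.
apply: eq_shape_mean => l _.
by rewrite -[phi l in LHS](shape_mean_cst (n - k)) -!shape_meanB.
Qed.

Lemma le_norm_shape_mean2 i j (a b : btree -> btree -> R) :
  (forall l r, nodes l = i -> nodes r = j -> `|a l r| <= b l r) ->
  `|E i (fun l => E j (a l))| <= E i (fun l => E j (b l)).
Proof.
move=> ab; apply: le_norm_shape_mean => l li.
by apply: le_norm_shape_mean => r rj; apply: ab.
Qed.

Lemma additive_mean F C :
  (forall l r, `|F (Node l r) - F l - F r| <= C) ->
  exists nu D, forall n, `|E n F - nu * n.+1%:R| <= D.
Proof.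
move=> FC; apply: (@quicksort_linear _ _ C) => n.
rewrite toll_shape_mean; apply: (le_trans (ler_norm_sum _ _ _)).
apply: (@le_trans _ _ (\sum_(k < n.+1) C)).
  apply: ler_sum => k _; rewrite -[C in leRHS](shape_mean_cst k).
  apply: le_norm_shape_mean => l _; rewrite -[C in leRHS](shape_mean_cst (n - k)).
  by apply: le_norm_shape_mean.
by rewrite sumr_const card_ord mulr_natr.
Qed.

Section SecondMoment.
Variables (Y : btree -> R) (C D : R).
Hypothesis YC : forall l r, `|Y (Node l r) - Y l - Y r| <= C.
Hypothesis YD : forall n, `|E n Y| <= D.

Local Notation v n := (E n (fun t => Y t ^+ 2)).

Let C0 : 0 <= C. Proof. by apply: le_trans (YC Leaf Leaf). Qed.
Let D0 : 0 <= D. Proof. by apply: le_trans (YD 0). Qed.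

Let v_ge0 n : 0 <= v n.
Proof.
by rewrite -[0](shape_mean_cst n); apply: le_shape_mean => t _; rewrite sqr_ge0.
Qed.

(** The two parts being independent, the cross term is [2 * E i Y * E j Y], at most [2 * D ^+ 2].
    The toll gets multiplied by [w = Y l + Y r], which is handled by [2 |w| <= lam + w^2 / lam],
    with [lam] left free to be tuned to the size. *)
Lemma second_moment_split i j (lam : R) : 0 < lam ->
  `|E i (fun l => E j (fun r => Y (Node l r) ^+ 2 - Y l ^+ 2 - Y r ^+ 2))| <=
  2 * D ^+ 2 + C ^+ 2 + C * (lam + 2 * (v i + v j) / lam).
Proof.
move=> lam0.
pose W l r := C ^+ 2 + C * (lam + 2 * (Y l ^+ 2 + Y r ^+ 2) / lam).
have -> : E i (fun l => E j (fun r => Y (Node l r) ^+ 2 - Y l ^+ 2 - Y r ^+ 2)) =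
    2 * E i Y * E j Y + E i (fun l => E j (fun r =>
      Y (Node l r) ^+ 2 - (Y l + Y r) ^+ 2)).
  rewrite -mulrA mulrCA -shape_meanZ mulrC -shape_meanZ -shape_meanD.
  apply: eq_shape_mean => l _.
  rewrite mulrC -!shape_meanZ -shape_meanD; apply: eq_shape_mean => r _.
  by ring.
apply: (le_trans (ler_normD _ _)); rewrite -addrA; apply: lerD.
  rewrite !normrM ger0_norm// -mulrA ler_pM2l//.
  by rewrite ler_pM// ?normr_ge0.
have -> : C ^+ 2 + C * (lam + 2 * (v i + v j) / lam) =
    E i (fun l => E j (W l)).
  transitivity (E i (fun l => C ^+ 2 + C * (lam + 2 * (Y l ^+ 2 + v j) / lam))).
    pose q t := C ^+ 2 + C * (lam + 2 * v j / lam) + C * 2 / lam * (Y t ^+ 2).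
    rewrite -[RHS](@eq_shape_mean _ i q); last first.
      by move=> l _; rewrite /q; ring.
    by rewrite /q shape_meanD shape_mean_cst shape_meanZ; ring.
  apply: eq_shape_mean => l _.
  pose q t := C ^+ 2 + C * (lam + 2 * Y l ^+ 2 / lam) + C * 2 / lam * (Y t ^+ 2).
  rewrite -[RHS](@eq_shape_mean _ j q); last first.
    by move=> r _; rewrite /q /W; ring.
  by rewrite /q shape_meanD shape_mean_cst shape_meanZ; ring.
apply: le_norm_shape_mean2 => l r _ _; rewrite /W.
have := YC l r; set g := Y (Node l r) - Y l - Y r => gC.
rewrite (_ : _ - _ = g ^+ 2 + g * (2 * (Y l + Y r))); last by rewrite /g; ring.
apply: (le_trans (ler_normD _ _)); apply: lerD.
  by rewrite normrX lerXn2r// nnegrE.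
rewrite normrM ler_pM//.
have -> : lam + 2 * (Y l ^+ 2 + Y r ^+ 2) / lam =
    (lam ^+ 2 + 2 * (Y l ^+ 2 + Y r ^+ 2)) / lam by field; rewrite gt_eqF.
rewrite ler_pdivlMr// normrM ger0_norm//.
have [h|h] := ger0P (Y l + Y r).
  have := sqr_ge0 (lam - (Y l + Y r)); have := sqr_ge0 (Y l - Y r); nra.
have := sqr_ge0 (lam + (Y l + Y r)); have := sqr_ge0 (Y l - Y r); nra.
Qed.

(* The unknown growth constant enters the recurrence only through its square
   root, which is what makes the induction close. *)
Lemma second_moment_bound : exists2 K, 0 <= K & forall n, v n <= K * n.+1%:R.
Proof.
(* Chosen so that [v 0 + 5 * B <= kap ^+ 2] for the [B] below, which is linear in [kap]. *)
pose kap := 1 + v 0 + 10 * D ^+ 2 + 5 * C ^+ 2 + 45 * C.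
have D2 := sqr_ge0 D; have C2 := sqr_ge0 C; have v0 := v_ge0 0.
have kap1 : 1 <= kap by rewrite /kap; have := C0; lra.
have kap0 : 0 < kap by lra.
exists (kap ^+ 2); first by rewrite sqr_ge0.
suff H n k : (k <= n)%N -> v k <= kap ^+ 2 * k.+1%:R by move=> n; apply: (H n).
elim: n k => [|n IH] k.
  by rewrite leqn0 => /eqP ->; rewrite mulr1; rewrite /kap in kap1 *; have := C0; nra.
rewrite leq_eqVlt => /predU1P[->{k}|]; last by rewrite ltnS; apply: IH.
pose B := 2 * D ^+ 2 + C ^+ 2 + 9 * C * kap.
have B0 : 0 <= B by rewrite /B; have := mulr_ge0 C0 (ltW kap0); lra.
have tollB k : (k <= n)%N ->
    `|toll (fun n => v n) k| <= B * (k.+1%:R * Num.sqrt k.+1%:R).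
  move=> kn; rewrite toll_shape_mean; apply: (le_trans (ler_norm_sum _ _ _)).
  rewrite mulrCA.
  apply: (@le_trans _ _ (\sum_(i < k.+1) B * Num.sqrt k.+1%:R)); last first.
    by rewrite sumr_const card_ord mulr_natl.
  apply: ler_sum => i _.
  have s1 : 1 <= Num.sqrt (k.+1%:R : R) by rewrite -[leLHS]sqrtr1 ler_sqrt ?ler1n.
  have ss : Num.sqrt (k.+1%:R : R) ^+ 2 = k.+1%:R by rewrite sqr_sqrtr.
  have ik : (i <= k)%N by rewrite -ltnS.
  have vi := IH _ (leq_trans ik kn).
  have vki := IH _ (leq_trans (leq_subr i k) kn).
  move: s1 ss; set s := Num.sqrt k.+1%:R => s1 ss.
  have s0 : 0 < s by lra.
  apply: (le_trans (@second_moment_split _ _ (kap * s) _)); first by rewrite mulr_gt0.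
  have vv : v i + v (k - i)%N <= 2 * (kap * s) ^+ 2.
    apply: (le_trans (lerD vi vki)); rewrite -mulrDr exprMn mulrCA ler_wpM2l//.
      by rewrite sqr_ge0.
    rewrite ss -natrD -natrM ler_nat.
    by rewrite addSn addnS subnKC// mul2n -addnn addSn addnS ltnS ltnS leq_addr.
  have -> : B * s = (2 * D ^+ 2 + C ^+ 2) * s + C * (9 * (kap * s)).
    by rewrite /B; ring.
  apply: lerD; first by rewrite ler_peMr//; lra.
  rewrite ler_wpM2l//.
  have ks : 0 < kap * s by rewrite mulr_gt0.
  have : 2 * (v i + v (k - i)%N) / (kap * s) <= 4 * (kap * s).
    by rewrite ler_pdivrMr//; move: vv; rewrite expr2; lra.
  by lra.
have := quicksort_bound B0 tollB.
rewrite !ger0_norm// => /le_trans; apply.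
rewrite ler_wpM2r// /B; rewrite /kap in kap1 kap0 *.
have := C0; nra.
Qed.

Lemma second_moment_linear :
  exists s2 D', 0 <= s2 /\
    forall n, `|v n - s2 * n.+1%:R| <= D' * Num.sqrt n.+1%:R.
Proof.
have [K K0 vK] := second_moment_bound.
pose B := 2 * D ^+ 2 + C ^+ 2 + C * (1 + 4 * K).
have B0 : 0 <= B.
  have := mulr_ge0 C0 K0; have := sqr_ge0 D; have := sqr_ge0 C; have := C0.
  by rewrite /B; lra.
have [|s2 [D' vD']] := @quicksort_linear_sqrt _ (fun n => v n) B B0.
  move=> n; rewrite toll_shape_mean; apply: (le_trans (ler_norm_sum _ _ _)).
  rewrite mulrCA.
  apply: (@le_trans _ _ (\sum_(i < n.+1) B * Num.sqrt n.+1%:R)); last first.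
    by rewrite sumr_const card_ord mulr_natl.
  apply: ler_sum => i _.
  have s1 : 1 <= Num.sqrt (n.+1%:R : R) by rewrite -[leLHS]sqrtr1 ler_sqrt ?ler1n.
  have ss : Num.sqrt (n.+1%:R : R) ^+ 2 = n.+1%:R by rewrite sqr_sqrtr.
  have ik : (i <= n)%N by rewrite -ltnS.
  move: s1 ss; set s := Num.sqrt n.+1%:R => s1 ss.
  have s0 : 0 < s by lra.
  apply: (le_trans (@second_moment_split _ _ s s0)).
  have vv : v i + v (n - i)%N <= 2 * K * s ^+ 2.
    apply: (le_trans (lerD (vK i) (vK _))); rewrite -mulrDr -mulrA mulrCA ler_wpM2l//.
    rewrite ss -natrD -natrM ler_nat.
    by rewrite addSn addnS subnKC// mul2n -addnn addSn addnS ltnS ltnS leq_addr.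
  have -> : B * s = (2 * D ^+ 2 + C ^+ 2) * s + C * ((1 + 4 * K) * s).
    by rewrite /B; ring.
  apply: lerD.
    by rewrite ler_peMr//; have := sqr_ge0 D; have := sqr_ge0 C; lra.
  rewrite ler_wpM2l//.
  have : 2 * (v i + v (n - i)%N) / s <= 4 * K * s.
    by rewrite ler_pdivrMr//; move: vv; rewrite expr2; lra.
  by lra.
(* A negative slope would eventually make the second moment negative. *)
exists s2, D'; split=> //; rewrite leNgt; apply/negP => s2lt0.
have [n nD] : exists n : nat, D' < - s2 * Num.sqrt n.+1%:R.
  pose x := `|D'| / - s2; have x0 : 0 <= x by rewrite divr_ge0// oppr_ge0 ltW.
  exists (Num.bound (x ^+ 2)).
  have h : x < Num.sqrt (Num.bound (x ^+ 2)).+1%:R.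
    rewrite -[ltLHS]ger0_norm// -sqrtr_sqr ltr_sqrt ?ltr0n//.
    apply: (lt_le_trans (archi_boundP (sqr_ge0 x))).
    by rewrite ler_nat.
  move: h; rewrite /x ltr_pdivrMr ?oppr_gt0// mulrC; apply: le_lt_trans.
  exact: ler_norm.
have := vD' n; have := v_ge0 n.
have s0 : 0 < Num.sqrt (n.+1%:R : R) by rewrite sqrtr_gt0.
have ss : Num.sqrt (n.+1%:R : R) ^+ 2 = n.+1%:R by rewrite sqr_sqrtr.
rewrite -{1}ss ler_norml => v0 /andP[_].
move: nD s0; set s := Num.sqrt _ => nD s0.
have : D' * s < - s2 * s * s by rewrite ltr_pM2r.
by lra.
Qed.

End SecondMoment.
End Moments.

(** * Random walk comparison *)

Section Walk.
Variable R : realType.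
Implicit Types (b x c : R) (psi : R -> R) (n : nat).

Fixpoint walk b n psi x : R :=
  if n is n'.+1 then (walk b n' psi (x + b) + walk b n' psi (x - b)) / 2
  else psi x.

Lemma walk_add b m n psi x : walk b (m + n) psi x = walk b m (walk b n psi) x.
Proof. by elim: m x => //= m IH x; rewrite !IH. Qed.

Lemma eq_walk b n psi psi' x : psi =1 psi' -> walk b n psi x = walk b n psi' x.
Proof. by move=> eq; elim: n x => //= n IH x; rewrite !IH. Qed.

Lemma walkZ b n c psi x : walk b n (fun y => c * psi y) x = c * walk b n psi x.
Proof. by elim: n x => //= n IH x; rewrite !IH; ring. Qed.

Lemma walkB b n psi psi' x :
  walk b n (fun y => psi y - psi' y) x = walk b n psi x - walk b n psi' x.
Proof. by elim: n x => //= n IH x; rewrite !IH; ring. Qed.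

Lemma le_norm_walk b n psi psi' x :
  (forall y, `|psi y| <= psi' y) -> `|walk b n psi x| <= walk b n psi' x.
Proof.
move=> le; elim: n x => //= n IH x.
rewrite normrM [X in _ * X]ger0_norm ?invr_ge0// ler_pM2r ?invr_gt0//.
by rewrite (le_trans (ler_normD _ _))// lerD.
Qed.

Lemma walk_quadratic b n a0 a1 a2 x :
  walk b n (fun y => a0 + a1 * y + a2 * y ^+ 2) x =
  a0 + a1 * x + a2 * (x ^+ 2 + n%:R * b ^+ 2).
Proof.
elim: n x => [|n IH] x /=; first by rewrite mul0r addr0.
by rewrite !IH -(natr1 n); field.
Qed.

Lemma walk_shift b n psi x y :
  walk b n (fun z => psi (x + z)) y = walk b n psi (x + y).
Proof. by elim: n y => //= n IH y; rewrite !IH !addrA. Qed.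

Lemma walk_scale b n psi c x :
  walk b n (fun z => psi (z * c)) x = walk (b * c) n psi (x * c).
Proof. by elim: n x => //= n IH x; rewrite !IH [(x + b) * c]mulrDl [(x - b) *
  c]mulrBl. Qed.

Lemma walk_shape_mean b m n (f : R -> btree -> R) x :
  walk b m (fun z => shape_mean n (f z)) x =
  shape_mean n (fun t => walk b m (f^~ t) x).
Proof.
elim: m x => //= m IH x; rewrite !IH -shape_meanD mulrC -shape_meanZ.
by apply: eq_shape_mean => t _; rewrite mulrC.
Qed.

(** The functions with 1-Lipschitz second derivative, [psi1] and [psi2] being the derivatives.
    Stated by Taylor remainders, the class is visibly stable under recentring, rescaling and
    Gaussian averaging; the factors 1/6 and 1/2 of Taylor's formula are relaxed to 1. *)
Definition taylor3 psi (psi1 psi2 : R -> R) :=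
  [/\ forall x h,
        `|psi (x + h) - psi x - psi1 x * h - psi2 x * h ^+ 2 / 2| <= `|h| ^+ 3,
      forall x h, `|psi1 (x + h) - psi1 x - psi2 x * h| <= h ^+ 2 &
      forall x h, `|psi2 (x + h) - psi2 x| <= `|h|].

Lemma taylor3_recenter psi psi1 psi2 x : taylor3 psi psi1 psi2 ->
  taylor3 (fun y => psi (x + y) - psi x - psi1 x * y - psi2 x * y ^+ 2 / 2)
          (fun y => psi1 (x + y) - psi1 x - psi2 x * y)
          (fun y => psi2 (x + y) - psi2 x).
Proof.
case=> t0 t1 t2; split=> y h.
- have := t0 (x + y) h; rewrite (addrA x); apply: le_trans.
  by rewrite le_eqVlt; apply/orP; left; apply/eqP; congr `| _ |; field.
- have := t1 (x + y) h; rewrite (addrA x); apply: le_trans.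
  by rewrite le_eqVlt; apply/orP; left; apply/eqP; congr `| _ |; ring.
- have := t2 (x + y) h; rewrite (addrA x); apply: le_trans.
  by rewrite le_eqVlt; apply/orP; left; apply/eqP; congr `| _ |; ring.
Qed.

Definition flat_at0 psi (psi1 psi2 : R -> R) :=
  [/\ psi 0 = 0, psi1 0 = 0 & psi2 0 = 0].

Lemma flat_at0_recenter psi (psi1 psi2 : R -> R) x :
  flat_at0 (fun y => psi (x + y) - psi x - psi1 x * y - psi2 x * y ^+ 2 / 2)
          (fun y => psi1 (x + y) - psi1 x - psi2 x * y)
          (fun y => psi2 (x + y) - psi2 x).
Proof. by split; rewrite addr0; ring. Qed.

Lemma flat_growth psi psi1 psi2 : taylor3 psi psi1 psi2 ->
  flat_at0 psi psi1 psi2 ->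
  [/\ forall x, `|psi x| <= `|x| ^+ 3, forall x, `|psi1 x| <= x ^+ 2 &
      forall x, `|psi2 x| <= `|x|].
Proof.
move=> [t0 t1 t2] [p0 p1 p2]; split=> x.
- by have := t0 0 x; rewrite add0r p0 p1 p2 !mul0r !subr0.
- by have := t1 0 x; rewrite add0r p1 p2 !mul0r !subr0.
- by have := t2 0 x; rewrite add0r p2 !subr0.
Qed.

End Walk.

Section HarmonicSum.
Variable R : realType.

Definition harm (n : nat) : R := \sum_(i < n) i.+1%:R^-1.

Lemma harmS n : harm n.+1 = harm n + n.+1%:R^-1.
Proof. by rewrite /harm big_ord_recr. Qed.

(** When the bound [M * (k + 1) * H_(k+1)] is put into the quicksort recurrence, the defect 1/2 is
    what pays for a linear toll. *)
Lemma sum_harm n :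
  \sum_(k < n) k.+1%:R * harm k.+1 = n%:R * n.+1%:R / 2 * (harm n.+1 - 2^-1).
Proof.
elim: n => [|n IH]; first by rewrite big_ord0 !mul0r.
rewrite big_ord_recr /= IH [in RHS]harmS -!natr1.
have n0 : 0 <= n%:R :> R by [].
by field; lra.
Qed.

End HarmonicSum.

(** * Comparison of an additive functional with a random walk *)

Section Comparison.
Variable R : realType.
Local Notation E := (@shape_mean R).
Variables (Y : btree -> R) (C D K s2 B : R).
Hypothesis YC : forall l r, `|Y (Node l r) - Y l - Y r| <= C.
Hypothesis YD : forall n, `|E n Y| <= D.
Hypothesis s20 : 0 <= s2.
Local Notation v n := (E n (fun t => Y t ^+ 2)).
Local Notation d n := (v n - s2 * n.+1%:R).
Hypothesis K0 : 0 <= K.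
Hypothesis vK : forall n, v n <= K * n.+1%:R.
Hypothesis dB : forall n, `|d n| <= B * Num.sqrt n.+1%:R.
Local Notation sg := (Num.sqrt s2).

Let C0 : 0 <= C. Proof. by apply: le_trans (YC Leaf Leaf). Qed.
Let D0 : 0 <= D. Proof. by apply: le_trans (YD 0). Qed.

Let d2 n : d n ^+ 2 <= B ^+ 2 * n.+1%:R.
Proof.
rewrite -[leLHS]real_normK ?num_real// -[n.+1%:R in leRHS](@sqr_sqrtr R)//.
rewrite -exprMn lerXn2r ?nnegrE//.
exact: le_trans (dB n).
Qed.

Definition close_at n e := forall psi psi1 psi2, taylor3 psi psi1 psi2 ->
  flat_at0 psi psi1 psi2 ->
  `|E n (fun t => psi (Y t)) - walk sg n.+1 psi 0| <= e.

(** Subtracting the Taylor polynomial at [x] leaves a flat function. The polynomial is averaged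
    exactly on the walk, and on the trees through the two moments of [Y], whose deviations are the
    two extra terms. *)
Lemma close_at_recenter n e : close_at n e ->
  forall psi psi1 psi2 x, taylor3 psi psi1 psi2 ->
  `|E n (fun t => psi (x + Y t)) - walk sg n.+1 psi x| <=
  e + `|psi1 x| * D + `|psi2 x| / 2 * `|d n|.
Proof.
move=> ce psi psi1 psi2 x tay.
have := ce _ _ _ (taylor3_recenter x tay) (flat_at0_recenter psi psi1 psi2 x).
rewrite (_ : E n _ = E n (fun t => psi (x + Y t)) - (psi x + psi1 x * E n Y
   + psi2 x / 2 * v n)); last first.
  rewrite -!shape_meanZ -[psi x in RHS](shape_mean_cst n) -!shape_meanD -shape_meanB.
  by apply: eq_shape_mean => t _; ring.
rewrite (_ : walk _ _ _ _ = walk sg n.+1 psi x - (psi x + psi2 x / 2 *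
   (n.+1%:R * s2))); last first.
  rewrite (@eq_walk _ _ _ _ (fun y => psi (x + y) -
     (psi x + psi1 x * y + psi2 x / 2 * y ^+ 2))); last by move=> y; ring.
  by rewrite walkB walk_shift addr0 walk_quadratic sqr_sqrtr//; ring.
move: (YD n) => md close.
rewrite [X in `|X|](_ : _ = (E n (fun t => psi (x + Y t)) -
    (psi x + psi1 x * E n Y + psi2 x / 2 * v n) -
    (walk sg n.+1 psi x - (psi x + psi2 x / 2 * (n.+1%:R * s2))))
    + psi1 x * E n Y + psi2 x / 2 * d n); last by ring.
apply: (le_trans (ler_normD _ _)); apply: lerD.
  apply: (le_trans (ler_normD _ _)); apply: lerD => //.
  by rewrite normrM ler_wpM2l.
by rewrite !normrM [`|2^-1|]ger0_norm ?invr_ge0.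
Qed.

(** The summands in [C] come from the toll, those in [D + 1] from the first-order mismatch and the
    squares of [psi2], and [B ^+ 2] from the squared second-order mismatch. *)
Definition step_error : R :=
  2 * (C + C ^+ 2) * K + C ^+ 2 + C ^+ 3 + (D + 1) * K + B ^+ 2 + (D + 1) * s2.

Lemma step_error_ge0 : 0 <= step_error.
Proof.
rewrite /step_error; have := mulr_ge0 C0 K0; have := mulr_ge0 (sqr_ge0 C) K0.
have := exprn_ge0 3 C0; have := sqr_ge0 C; have := sqr_ge0 B.
have := mulr_ge0 D0 K0; have := mulr_ge0 D0 s20; have := K0; have := s20.
lra.
Qed.

(** Three errors add up: dropping the toll by a Taylor expansion at [Y l + Y r], replacing [Y r] by
    the walk with [Y l] fixed, and replacing [Y l] with the walk fixed. Each is linear in the size,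
    because [psi1] grows at most quadratically and the second moments are linear. *)
Lemma close_step i j ei ej psi psi1 psi2 :
  close_at i ei -> close_at j ej -> taylor3 psi psi1 psi2 ->
  flat_at0 psi psi1 psi2 ->
  `|E i (fun l => E j (fun r => psi (Y (Node l r))))
    - walk sg (i + j).+2 psi 0| <= ei + ej + step_error * (i + j).+2%:R.
Proof.
move=> ci cj tay flat; have [g0 g1 g2] := flat_growth tay flat.
have C2 := sqr_ge0 C; have C3 := exprn_ge0 3 C0.
have toll_err : `|E i (fun l => E j (fun r =>
    psi (Y (Node l r)) - psi (Y l + Y r)))| <=
    2 * (C + C ^+ 2) * (v i + v j) + (C ^+ 2 + C ^+ 3).
  apply: (@le_trans _ _ (E i (fun l => E j (fun r =>
     2 * (C + C ^+ 2) * (Y l ^+ 2 + Y r ^+ 2) + (C ^+ 2 + C ^+ 3))))).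
    apply: le_norm_shape_mean2 => l r _ _; have := YC l r.
    set g := Y (Node l r) - Y l - Y r => gC.
    set w := Y l + Y r.
    have -> : Y (Node l r) = w + g by rewrite /w /g; ring.
    have [t0 _ _] := tay.
    have gC2 : g ^+ 2 <= C ^+ 2.
      by rewrite -[leLHS]real_normK ?num_real// lerXn2r// nnegrE.
    have gC3 : `|g| ^+ 3 <= C ^+ 3 by rewrite lerXn2r// nnegrE.
    have h1 : `|psi1 w * g| <= w ^+ 2 * C by rewrite normrM ler_pM.
    have h2 : `|psi2 w * g ^+ 2 / 2| <= (1 + w ^+ 2) * C ^+ 2.
      rewrite -mulrA normrM ler_pM//; last first.
        by rewrite ger0_norm ?divr_ge0 ?sqr_ge0//; have := sqr_ge0 g; lra.
      apply: (le_trans (g2 w)); rewrite -(@real_normK _ w) ?num_real//.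
      by have := normr_ge0 w; nra.
    have w2 : w ^+ 2 <= 2 * (Y l ^+ 2 + Y r ^+ 2).
      by have := sqr_ge0 (Y l - Y r); rewrite /w; nra.
    have := t0 w g.
    have -> : psi (w + g) - psi w - psi1 w * g - psi2 w * g ^+ 2 / 2 =
      psi (w + g) - psi w - (psi1 w * g + psi2 w * g ^+ 2 / 2) by ring.
    have := ler_normD (psi (w + g) - psi w - (psi1 w * g + psi2 w * g ^+ 2 / 2))
      (psi1 w * g + psi2 w * g ^+ 2 / 2).
    rewrite subrK => h3 h4.
    have := ler_normD (psi1 w * g) (psi2 w * g ^+ 2 / 2) => h5.
    have h6 : (C + C ^+ 2) * w ^+ 2 <= (C + C ^+ 2) * (2 * (Y l ^+ 2 + Y r ^+ 2)).
      by rewrite ler_wpM2l// addr_ge0.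
    by move: h1 h2 h3 h4 h5 h6 gC3; rewrite !mulrDl; lra.
  rewrite le_eqVlt; apply/orP; left; apply/eqP.
  transitivity (E i (fun l => 2 * (C + C ^+ 2) * (Y l ^+ 2 + v j) + (C ^+ 2 + C ^+ 3))).
    apply: eq_shape_mean => l _.
    by rewrite shape_meanD shape_mean_cst shape_meanZ shape_meanD shape_mean_cst.
  by rewrite shape_meanD shape_mean_cst shape_meanZ shape_meanD shape_mean_cst.
(* The product of [psi2] and the defect [d], both of order sqrt n, is turned into squares of order
   [n]. *)
have mixed (x y : R) : `|x| / 2 * `|y| <= (x ^+ 2 + y ^+ 2) / 4.
  rewrite -(@real_normK _ x) ?num_real// -(@real_normK _ y) ?num_real//.
  by have := sqr_ge0 (`|x| - `|y|); lra.
have sq_psi2 x : psi2 x ^+ 2 <= x ^+ 2.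
  rewrite -(@real_normK _ (psi2 x)) ?num_real// -(@real_normK _ x) ?num_real//.
  by rewrite lerXn2r// nnegrE.
have right_err : `|E i (fun l => E j (fun r => psi (Y l + Y r))
     - walk sg j.+1 psi (Y l))| <= ej + d j ^+ 2 / 4 + (D + 1) * v i.
  rewrite -shape_meanZ -[ej + _](shape_mean_cst i) -shape_meanD.
  apply: le_norm_shape_mean => l _.
  apply: (le_trans (close_at_recenter cj (Y l) tay)).
  have := mixed (psi2 (Y l)) (d j); have := sq_psi2 (Y l).
  have := ler_wpM2r D0 (g1 (Y l)); have := sqr_ge0 (Y l).
  by move: (`|psi2 (Y l)|) (`|d j|) => a1 a2; lra.
have left_err : `|E i (fun l => walk sg j.+1 psi (Y l)) - walk sg (i + j).+2 psi 0|
     <= ei + d i ^+ 2 / 4 + (D + 1) * (j.+1%:R * s2).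
  have -> : E i (fun l => walk sg j.+1 psi (Y l)) =
      walk sg j.+1 (fun z => E i (fun l => psi (z + Y l))) 0.
    rewrite walk_shape_mean; apply: eq_shape_mean => l _.
    rewrite -[Y l in LHS]addr0 -walk_shift.
    by apply: eq_walk => z; rewrite addrC.
  have -> : walk sg (i + j).+2 psi 0 = walk sg j.+1 (walk sg i.+1 psi) 0.
    by rewrite -walk_add addSn addnS addnC.
  rewrite -walkB.
  apply: (@le_trans _ _ (walk sg j.+1
    (fun z => ei + d i ^+ 2 / 4 + 0 * z + (D + 1) * z ^+ 2) 0)).
    apply: le_norm_walk => z.
    apply: (le_trans (close_at_recenter ci z tay)).
    have := mixed (psi2 z) (d i); have := sq_psi2 z.
    have := ler_wpM2r D0 (g1 z); have := sqr_ge0 z.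
    by move: (`|psi2 z|) (`|d i|) => a1 a2; lra.
  by rewrite walk_quadratic sqr_sqrtr// mul0r expr0n /= !add0r addr0.
have -> : E i (fun l => E j (fun r => psi (Y (Node l r)))) - walk sg (i + j).+2 psi 0 =
   E i (fun l => E j (fun r => psi (Y (Node l r)) - psi (Y l + Y r))) +
   (E i (fun l => E j (fun r => psi (Y l + Y r)) - walk sg j.+1 psi (Y l)) +
   (E i (fun l => walk sg j.+1 psi (Y l)) - walk sg (i + j).+2 psi 0)).
  rewrite [in RHS]addrA -shape_meanD [in RHS]addrA -shape_meanD.
  congr (_ - _); apply: eq_shape_mean => l _.
  by rewrite shape_meanB; ring.
apply: (le_trans (ler_normD _ _)).
have := ler_normD (E i (fun l => E j (fun r => psi (Y l + Y r)) - walk sg j.+1 psi (Y l)))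
   (E i (fun l => walk sg j.+1 psi (Y l)) - walk sg (i + j).+2 psi 0).
move: toll_err right_err left_err => h1 h2 h3 h4.
have ni : i.+1%:R + j.+1%:R = (i + j).+2%:R :> R by rewrite -natrD addSn addnS.
have i1 : 1 <= i.+1%:R :> R by rewrite ler1n.
have j1 : 1 <= j.+1%:R :> R by rewrite ler1n.
have CC : 0 <= 2 * (C + C ^+ 2) by have := C0; lra.
have h5 : 2 * (C + C ^+ 2) * (v i + v j) <= 2 * (C + C ^+ 2) * (K * i.+1%:R + K *
  j.+1%:R).
  by rewrite ler_wpM2l// lerD.
have D10 : 0 <= D + 1 by have := D0; lra.
have h6 : (D + 1) * v i <= (D + 1) * (K * i.+1%:R) by rewrite ler_wpM2l.
have h7 : (D + 1) * (j.+1%:R * s2) <= (D + 1) * ((i.+1%:R + j.+1%:R) * s2).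
  by rewrite ler_wpM2l// ler_wpM2r// lerDr.
have h8 : (D + 1) * (K * i.+1%:R) <= (D + 1) * (K * (i.+1%:R + j.+1%:R)).
  by rewrite ler_wpM2l// ler_wpM2l// lerDl.
have h9 : (C ^+ 2 + C ^+ 3) * 1 <= (C ^+ 2 + C ^+ 3) * (i.+1%:R + j.+1%:R).
  by rewrite ler_wpM2l ?addr_ge0//; lra.
have := d2 i; have := d2 j; rewrite /step_error -ni.
have B2 := sqr_ge0 B.
have := sqr_ge0 (d i); have := sqr_ge0 (d j).
move: h1 h2 h3 h4 h5 h6 h7 h8 h9.
move: (d i ^+ 2) (d j ^+ 2) (v i) (v j) => di dj vi vj.
move: (`|E i _|) (`|E i _|) (`|_ - _|) (`|_ + _|) => a1 a2 a3 a4.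
rewrite !mulrDl !mulrDr; lra.
Qed.

Lemma close_all : exists2 M, 0 <= M &
  forall n, close_at n (M * (n.+1%:R * harm R n.+1)).
Proof.
(* [2 * step_error] is what the defect 1/2 of [sum_harm] can absorb; the cubes cover the empty tree,
   which is compared with a walk of one step. *)
pose M := 2 * step_error + `|Y Leaf| ^+ 3 + sg ^+ 3.
have M0 : 0 <= M.
  by rewrite /M !addr_ge0 ?mulr_ge0 ?step_error_ge0 ?exprn_ge0 ?sqrtr_ge0.
exists M => // n; elim/ltn_ind: n => -[_|n IH].
  move=> psi psi1 psi2 tay flat; have [g0 _ _] := flat_growth tay flat.
  have -> : harm R 1 = 1 by rewrite /harm big_ord1 invr1.
  rewrite /= !mulr1.
  apply: (le_trans (ler_normB _ _)).
  have := g0 (Y Leaf); have := g0 (0 + sg); have := g0 (0 - sg).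
  rewrite !add0r normrN [`|sg|]ger0_norm ?sqrtr_ge0//.
  have := ler_normD (psi sg) (psi (- sg)).
  rewrite normrM [`|2^-1|]ger0_norm ?invr_ge0// /M.
  by have := step_error_ge0; lra.
move=> psi psi1 psi2 tay flat.
have n1 : 0 < n.+1%:R :> R by rewrite ltr0n.
rewrite -(ler_pM2l n1) -[X in X * `|_|](ger0_norm (ltW n1)) -normrM mulrBr.
rewrite shape_mean_split.
have -> : n.+1%:R * walk sg n.+2 psi 0 = \sum_(k < n.+1) walk sg n.+2 psi 0.
  by rewrite sumr_const card_ord mulr_natl.
rewrite -sumrB.
apply: (le_trans (ler_norm_sum _ _ _)).
pose e k := M * (k.+1%:R * harm R k.+1).
apply: (@le_trans _ _ (\sum_(k < n.+1) (e k + e (n - k)%N + step_error * n.+2%:R))).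
  apply: ler_sum => k _.
  have kn : (k <= n)%N by rewrite -ltnS.
  have := close_step (IH k (ltn_ord k)) (IH (n - k)%N _) tay flat.
  by rewrite subnKC// ltnS leq_subr; apply.
rewrite !big_split /= sumr_const card_ord.
rewrite [X in _ + X + _](_ : _ = \sum_(k < n.+1) e k); last first.
  rewrite [RHS](reindex_inj rev_ord_inj) /=.
  by apply: eq_bigr => k _; rewrite subSS.
rewrite -mulr_sumr sum_harm.
have hs := step_error_ge0.
have Ms : 2 * step_error <= M.
  by rewrite /M -addrA lerDl addr_ge0// exprn_ge0// sqrtr_ge0.
rewrite -[step_error * _ *+ _]mulr_natl.
have := mulr_ge0 (mulr_ge0 (ltW n1) (ler0n R n.+2)) (_ : 0 <= M - 2 * step_error).
rewrite subr_ge0 => /(_ Ms).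
move: (harm R n.+2) (n.+1%:R : R) (n.+2%:R : R) => H a b; lra.
Qed.

End Comparison.

(** * Gaussian smoothing *)

Section Gaussian.
Variable R : realType.
Implicit Types (f g : R -> R) (s t x y : R).
Notation mu := (@lebesgue_measure R).
Notation p := (@normal_pdf R 0 1).

Let p_ge0 y : 0 <= p y. Proof. exact: normal_pdf_ge0. Qed.
Let p_cont : continuous p. Proof. by apply: continuous_normal_pdf; exact: oner_neq0. Qed.

Let p_meas : measurable_fun setT p. Proof. exact: measurable_normal_pdf. Qed.

Lemma normal_pdfZ x s y : 0 < s -> normal_pdf x s (x + s * y) * s = p y.
Proof.
move=> s0; rewrite !normal_pdfE ?oner_neq0 ?gt_eqF//.
rewrite mulrAC; congr (_ * _).
  rewrite /normal_peak -!mulrnAr sqrtrM ?sqr_ge0// sqrtr_sqr gtr0_norm//.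
  by rewrite expr1n mul1r invfM mulrAC mulVf ?mul1r// gt_eqF.
rewrite /normal_fun subr0 addrAC subrr add0r; congr expR.
by field; rewrite gt_eqF.
Qed.

Lemma integral_affine f x s : 0 < s -> continuous f -> (forall y, 0 <= f y) ->
  (\int[mu]_y (f y)%:E = \int[mu]_y (f (x + s * y) * s)%:E)%E.
Proof.
move=> s0 cf f0; pose F y := x + s * y.
have ds y : derivable (( *%R s) : R -> R^o) y 1.
  by apply: (@derivableZ _ _ _ id); exact: derivable_id.
have dF y : derivable (F : R -> R^o) y 1.
  by apply: (@derivableD _ _ _ (cst x) ( *%R s)).
have F' : (F : R -> R^o)^`()%classic = cst s.
  apply/funext => y; rewrite derive1E (@deriveD _ _ _ (cst x) ( *%R s))//.
  by rewrite derive_cst add0r (@deriveZ _ _ _ id)// derive_id [_ *: _]mulr1.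
rewrite (@increasing_ge0_integration_by_substitutionT _ F f).
- by rewrite F'.
- by move=> a b ab; rewrite /F ltrD2l ltr_pM2l.
- by rewrite F' => ?; exact: cvg_cst.
- by rewrite F'; exact: is_cvg_cst.
- by rewrite F'; exact: is_cvg_cst.
- exact: dF.
- rewrite /F; apply/cvgrNyPle => A; near=> y.
  by rewrite addrC -lerBrDr -ler_pdivlMl//; near: y; apply: nbhs_ninfty_le;
    exact: num_real.
- rewrite /F; apply/cvgryPge => A; near=> y.
  by rewrite addrC -lerBlDr -ler_pdivrMl//; near: y; apply: nbhs_pinfty_ge;
    exact: num_real.
- exact: cf.
- exact: f0.
Unshelve. all: by end_near.
Qed.

Lemma integral_opp f : continuous f -> (forall y, 0 <= f y) ->
  (\int[mu]_y (f y)%:E = \int[mu]_y (f (- y))%:E)%E.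
Proof.
move=> cf f0.
have split g : continuous g -> (forall y, 0 <= g y) ->
  (\int[mu]_y (g y)%:E = \int[mu]_(y in `]-oo, 0%R]) (g y)%:E
     + \int[mu]_(y in `[0%R, +oo[) (g y)%:E)%E.
  move=> cg g0; have mg : measurable_fun [set: R] g by exact: continuous_measurable_fun.
  rewrite -(setUv `]-oo, 0%R]%classic) ge0_integral_setU//=; first last.
  - exact/disj_setPCl.
  - by move=> y _; rewrite lee_fin.
  - by apply/measurable_EFinP; rewrite setUv.
  - exact: measurableC.
  congr (_ + _)%E; rewrite setCitvl integral_itv_obnd_cbnd//.
  by apply/measurable_EFinP; exact: measurable_funTS.
have cfo : continuous (fun y => f (- y)).
  by move=> y; apply: continuous_comp; [exact: opp_continuous | exact: cf].
have half g : continuous g -> (forall y, 0 <= g y) ->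
  (\int[mu]_(y in `]-oo, 0%R]) (g y)%:E =
   \int[mu]_(y in `[0%R, +oo[) (g (- y))%:E)%E.
  move=> cg g0; rewrite -[X in `]-oo, X]%classic]oppr0.
  rewrite ge0_integration_by_substitutionNy//.
  exact: continuous_subspaceT.
rewrite split// half// [RHS]split// [X in (_ = X + _)%E]half// addeC.
by congr (_ + _)%E; apply: eq_integral => y _; rewrite opprK.
Qed.

Definition gauss_int f := mu.-integrable setT (EFin \o (fun y => f y * p y)).

Definition gauss_mean f : R := \int[mu]_y (f y * p y).

Local Notation G := gauss_mean.

Let p_int : mu.-integrable setT (EFin \o p).
Proof. exact: integrable_normal_pdf. Qed.

Lemma expR_cube y : 0 <= y -> y ^+ 3 <= 27 * expR y.
Proof.
move=> y0; have h := expR_ge1Dx (y / 3).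
have -> : expR y = expR (y / 3) ^+ 3 by rewrite -expRM_natl; congr expR; field.
rewrite (_ : y ^+ 3 = 27 * (y / 3) ^+ 3); last by field.
rewrite ler_pM2l// lerXn2r ?nnegrE ?expR_ge0 ?divr_ge0//.
by lra.
Qed.

Lemma normal_pdf_shift m y : normal_pdf m 1 y = p y * expR (m * y - m ^+ 2 / 2).
Proof.
rewrite !normal_pdfE ?oner_neq0// -mulrA; congr (_ * _).
by rewrite /normal_fun -expRD expr1n; congr expR; field.
Qed.

(** [|y|^3 <= 27 exp |y| <= 27 (exp y + exp (- y))], and tilting the standard density by [exp y] or
    [exp (- y)] gives, up to the factor [exp (1/2)], the normal density centred at 1 or -1. *)
Lemma gauss_int_cube : gauss_int (fun y => `|y| ^+ 3).
Proof.
pose q y := 27 * expR (2^-1) * (normal_pdf 1 1 y + normal_pdf (-1) 1 y).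
have q_int : mu.-integrable setT (EFin \o q).
  rewrite (_ : EFin \o q = (fun y => (27 * expR (2^-1))%:E *
     ((normal_pdf 1 1 y)%:E + (normal_pdf (-1) 1 y)%:E)))%E//.
  apply: integrableZl => //.
  by apply: integrableD => //; exact: integrable_normal_pdf.
apply: (le_integrable _ _ _ q_int) => //.
  apply/measurable_EFinP; apply: measurable_funM => //.
  by apply: (@measurable_funX _ _ _ _ _ 3%N); exact: normr_measurable.
move=> y _; rewrite /= lee_fin normrM normrX normr_id (ger0_norm (p_ge0 y)).
apply: le_trans (ler_norm _); rewrite /q (normal_pdf_shift 1) (normal_pdf_shift (-1)).
rewrite -mulrDr mulrCA mulrC ler_wpM2l//.
apply: (le_trans (expR_cube (normr_ge0 y))).
rewrite -mulrA ler_pM2l// mulrDr -!expRD.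
rewrite expr1n (_ : _ + (1 * y - _) = y); last by field.
rewrite (_ : _ + (-1 * y - _) = - y); last by field.
by have [_|_] := ger0P y; rewrite ?lerDl ?lerDr expR_ge0.
Qed.

Lemma gauss_int_dom f M : measurable_fun setT f ->
  (forall y, `|f y| <= M * (1 + `|y| ^+ 3)) -> gauss_int f.
Proof.
move=> mf fM.
have dom_int : mu.-integrable setT
    (EFin \o (fun y => M * (p y + `|y| ^+ 3 * p y))).
  rewrite (_ : _ \o _ = (fun y => M%:E * ((p y)%:E + (`|y| ^+ 3 * p y)%:E)))%E//.
  by apply: integrableZl => //; apply: integrableD => //; exact: gauss_int_cube.
apply: (le_integrable _ _ _ dom_int) => //.
  by apply/measurable_EFinP; apply: measurable_funM.
move=> y _; rewrite /= lee_fin normrM (ger0_norm (p_ge0 y)).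
apply: le_trans (ler_norm _).
by rewrite -[X in X + _]mul1r -mulrDl mulrA ler_wpM2r.
Qed.

Lemma gauss_int_bounded f M : measurable_fun setT f ->
  (forall y, `|f y| <= M) -> gauss_int f.
Proof.
move=> mf fM; apply: (@gauss_int_dom _ M) => // y.
have M0 : 0 <= M by apply: le_trans (fM 0).
by rewrite (le_trans (fM y))// ler_peMr// lerDl exprn_ge0.
Qed.

Lemma gauss_meanD f g : gauss_int f -> gauss_int g ->
  G (fun y => f y + g y) = G f + G g.
Proof.
by move=> fi gi; rewrite /G -RintegralD//; apply: eq_Rintegral => y _; rewrite mulrDl.
Qed.

Lemma gauss_meanZ c f : gauss_int f -> G (fun y => c * f y) = c * G f.
Proof.
by move=> fi; rewrite /G -RintegralZl//; apply: eq_Rintegral => y _; rewrite mulrA.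
Qed.

Lemma gauss_intZ c f : gauss_int f -> gauss_int (fun y => c * f y).
Proof.
move=> fi; rewrite /gauss_int.
rewrite (_ : _ \o _ = (fun y => c%:E * (f y * p y)%:E))%E.
  exact: integrableZl.
by apply/funext => y; rewrite /= -mulrA.
Qed.

Lemma gauss_intD f g : gauss_int f -> gauss_int g ->
  gauss_int (fun y => f y + g y).
Proof.
move=> fi gi; rewrite /gauss_int.
rewrite (_ : _ \o _ = (fun y => (f y * p y)%:E + (g y * p y)%:E))%E.
  exact: integrableD.
by apply/funext => y; rewrite /= mulrDl.
Qed.

Lemma gauss_mean_cst c : G (fun=> c) = c.
Proof.
rewrite /G RintegralZl//.
by rewrite /Rintegral integral_normal_pdf mulr1.
Qed.

Lemma gauss_int_cst c : gauss_int (fun=> c).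
Proof. by apply: (@gauss_int_bounded _ `|c|). Qed.

Lemma le_gauss_mean f g : gauss_int f -> gauss_int g ->
  (forall y, f y <= g y) -> G f <= G g.
Proof.
move=> fi gi fg; apply: le_Rintegral => // y _.
by rewrite ler_wpM2r.
Qed.

Lemma le_norm_gauss_mean f g : gauss_int f -> gauss_int g ->
  (forall y, `|f y| <= g y) -> `|G f| <= G g.
Proof.
move=> fi gi fg; rewrite ler_norml -mulN1r -gauss_meanZ//.
apply/andP; split; apply: le_gauss_mean => //; first exact: gauss_intZ.
  by move=> y; have := fg y; rewrite ler_norml mulN1r => /andP[].
by move=> y; have := fg y; rewrite ler_norml => /andP[].
Qed.

Lemma gauss_int_id : gauss_int id.
Proof.
apply: (@gauss_int_dom _ 1) => // y; rewrite mul1r.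
by have := normr_ge0 y; have [h|/ltW h] := leP `|y| 1; nra.
Qed.

Lemma gauss_int_sqr : gauss_int (fun y => y ^+ 2).
Proof.
apply: (@gauss_int_dom _ 1) => [|y]; first exact: measurable_funX.
rewrite mul1r normrX.
by have := normr_ge0 y; have [h|/ltW h] := leP `|y| 1; nra.
Qed.

(** The positive and negative parts of [y * p y] are exchanged by the reflection of [y], hence have
    the same finite integral. *)
Lemma gauss_mean_id : G id = 0.
Proof.
pose f y := Num.max y 0 * p y; pose g y := Num.max (- y) 0 * p y.
have cf : continuous f.
  move=> y; apply: cvgM; last exact: p_cont.
  by apply: (@continuous_max _ _ id (cst 0)); [exact: cvg_id | exact: cvg_cst].
have f0 y : 0 <= f y by rewrite mulr_ge0// le_max lexx orbT.
have fi : mu.-integrable setT (EFin \o f).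
  apply: (@gauss_int_dom (fun y => Num.max y 0) 1) => [|y].
    exact: measurable_maxr.
  rewrite mul1r ger0_norm ?le_max ?lexx ?orbT//.
  rewrite ge_max addr_ge0 ?exprn_ge0// andbT; have := ler_norm y.
  by have := normr_ge0 y; have [h|/ltW h] := leP `|y| 1; nra.
have gf : g = f \o -%R.
  apply/funext => y; rewrite /g /f /=; congr (_ * _).
  by rewrite !normal_pdfE ?oner_neq0// /normal_fun !subr0 sqrrN.
have Egf : (\int[mu]_y (g y)%:E = \int[mu]_y (f y)%:E)%E.
  by rewrite (integral_opp cf f0) gf.
have gi : mu.-integrable setT (EFin \o g).
  apply: (@gauss_int_dom (fun y => Num.max (- y) 0) 1) => [|y].
    by apply: measurable_maxr => //; exact: oppr_measurable.
  rewrite mul1r ger0_norm ?le_max ?lexx ?orbT//.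
  rewrite ge_max addr_ge0 ?exprn_ge0// andbT; have := ler_norm (- y); rewrite normrN.
  by have := normr_ge0 y; have [h|/ltW h] := leP `|y| 1; nra.
have -> : G id = \int[mu]_y (f y - g y).
  apply: eq_Rintegral => y _; rewrite /f /g -mulrBl; congr (_ * _).
  by have [h|/ltW h] := leP y 0; have [h'|/ltW h'] := leP (- y) 0; lra.
by rewrite RintegralB// /Rintegral Egf subrr.
Qed.

(** The density is at most [k], so the interval [[- d, d]] with [d = 1 / (4 k)] has mass at most
    1/2, and outside it [y ^+ 2 >= d ^+ 2]. Positivity allows the limiting scale to be defined by
    division by this moment. *)
Lemma gauss_mean_sqr_gt0 : 0 < G (fun y => y ^+ 2).
Proof.
pose k := normal_peak (1 : R).
have k0 : 0 < k by apply: normal_peak_gt0; exact: oner_neq0.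
pose d := (4 * k)^-1; have d0 : 0 < d by rewrite invr_gt0 mulr_gt0.
pose I : set R := `[- d, d]%classic.
have dom y : p y <= k * \1_I y + d ^- 2 * (y ^+ 2 * p y).
  rewrite indicE; case: (boolP (y \in I)) => yI; rewrite ?mulr1 ?mulr0 ?add0r.
    rewrite -[leLHS]addr0 lerD ?normal_pdf_ub ?oner_neq0//.
    by rewrite mulr_ge0 ?invr_ge0 ?exprn_ge0 ?(ltW d0)// mulr_ge0// sqr_ge0.
  rewrite mulrA ler_peMl// ler_pdivlMl ?exprn_gt0// mulr1.
  rewrite -[leRHS]real_normK ?num_real// lerXn2r ?nnegrE ?(ltW d0)//.
  rewrite leNgt; apply: contra yI => yd; rewrite inE /I /= in_itv /=.
  by rewrite -ler_norml ltW.
have Ii : mu.-integrable setT (EFin \o (\1_I : R -> R)).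
  exact: integrable_indic_itv.
have IE : \int[mu]_y \1_I y = 2 * d.
  rewrite /Rintegral integral_indic; last 2 first.
    exact: measurableT.
    exact: measurable_itv.
  rewrite setIT; transitivity (fine (mu I)); first by [].
  by rewrite lebesgue_measure_itv /= lte_fin gtrN// -EFinB /= opprK mulr_natl mulr2n.
have : \int[mu]_y p y <= \int[mu]_y (k * \1_I y + d ^- 2 * (y ^+ 2 * p y)).
  apply: le_Rintegral => //.
  rewrite (_ : _ \o _ = (fun y => k%:E * (\1_I y)%:E + (d ^- 2)%:E * (y ^+ 2 * p
    y)%:E))%E//.
  apply: integrableD => //; apply: integrableZl => //; exact: gauss_int_sqr.
rewrite RintegralD//; last 2 first.
- rewrite (_ : _ \o _ = (fun y => k%:E * (\1_I y)%:E))%E//; exact: integrableZl.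
- rewrite (_ : _ \o _ = (fun y => (d ^- 2)%:E * (y ^+ 2 * p y)%:E))%E//.
  by apply: integrableZl => //; exact: gauss_int_sqr.
rewrite !RintegralZl//; last exact: gauss_int_sqr.
rewrite IE -/(gauss_mean (fun y => y ^+ 2)).
rewrite {1}/Rintegral integral_normal_pdf /=.
have -> : k * (2 * d) = 2^-1 by rewrite /d; field; rewrite gt_eqF.
move=> h; rewrite ltNge; apply/negP => G0.
suff : d ^- 2 * G (fun y => y ^+ 2) <= 0 by move: h; lra.
by rewrite mulr_ge0_le0// invr_ge0 exprn_ge0// ltW.
Qed.

End Gaussian.

(** * The Gaussian semigroup and Lindeberg's method *)

Section GaussianWalk.
Variable R : realType.
Implicit Types (f g psi : R -> R) (s t x y : R).
Notation mu := (@lebesgue_measure R).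
Notation p := (@normal_pdf R 0 1).
Local Notation G := (@gauss_mean R).

Lemma locally_lipschitz_continuous f :
  (forall x, exists a, forall h, `|h| <= 1 -> `|f (x + h) - f x| <= a * `|h|) ->
  continuous f.
Proof.
move=> lip x; have [a fa] := lip x.
have a0 : 0 <= a by have := le_trans (normr_ge0 _) (fa 1 _); rewrite normr1 mulr1; apply.
apply/cvgrPdist_le => e e0.
have d0 : 0 < Num.min 1 (e / (a + 1)) by rewrite lt_min ltr01 divr_gt0//; lra.
near=> y; have yx : `|x - y| <= Num.min 1 (e / (a + 1)).
  by near: y; apply/nbhs_normP; exists (Num.min 1 (e / (a + 1))) => //= z /ltW.
rewrite distrC -(subrKC x y).
have hx : `|y - x| <= Num.min 1 (e / (a + 1)) by rewrite distrC.
apply: le_trans (fa _ _) _; first by apply: (le_trans hx); rewrite ge_min lexx.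
have : `|y - x| <= e / (a + 1) by apply: (le_trans hx); rewrite ge_min lexx orbT.
rewrite ler_pdivlMr; last by lra.
by have := normr_ge0 (y - x); nra.
Unshelve. all: by end_near.
Qed.

Section Taylor.
Variables psi psi1 psi2 : R -> R.
Hypothesis tay : taylor3 psi psi1 psi2.

Lemma taylor3_le0 x h :
  `|psi (x + h)| <= (`|psi x| + `|psi1 x| + `|psi2 x| + 1) * (1 + `|h| ^+ 3).
Proof.
have [t0 _ _] := tay; have := t0 x h.
have -> : psi (x + h) - psi x - psi1 x * h - psi2 x * h ^+ 2 / 2 =
  psi (x + h) - (psi x + psi1 x * h + psi2 x * h ^+ 2 / 2) by ring.
have h1 := ler_normD (psi (x + h) - (psi x + psi1 x * h + psi2 x * h ^+ 2 / 2))
  (psi x + psi1 x * h + psi2 x * h ^+ 2 / 2).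
have := ler_normD (psi x + psi1 x * h) (psi2 x * h ^+ 2 / 2).
have := ler_normD (psi x) (psi1 x * h).
move: h1; rewrite subrK !normrM [`|2^-1|]ger0_norm ?invr_ge0//.
have a0 := normr_ge0 (psi x); have a1 := normr_ge0 (psi1 x).
have a2 := normr_ge0 (psi2 x); have h0 := normr_ge0 h.
move: (`|psi x|) (`|psi1 x|) (`|psi2 x|) a0 a1 a2 => u0 u1 u2 a0 a1 a2.
move: (`|h|) h0 => k k0.
have k3 : k <= 1 + k ^+ 3 by have [hk|/ltW hk] := leP k 1; nra.
have k23 : k ^+ 2 <= 1 + k ^+ 3 by have [hk|/ltW hk] := leP k 1; nra.
have c1 := ler_wpM2l a1 k3; have c2 := ler_wpM2l a2 k23.
have c0 := mulr_ge0 a0 (exprn_ge0 3 k0).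
have c3 := exprn_ge0 3 k0.
have c4 := mulr_ge0 a2 (exprn_ge0 2 k0).
by rewrite !mulrDl !mulrDr; lra.
Qed.

Lemma taylor3_le1 x h :
  `|psi1 (x + h)| <= (`|psi1 x| + `|psi2 x| + 1) * (1 + `|h| ^+ 3).
Proof.
have [_ t1 _] := tay; have := t1 x h.
have -> : psi1 (x + h) - psi1 x - psi2 x * h =
  psi1 (x + h) - (psi1 x + psi2 x * h) by ring.
have h1 := ler_normD (psi1 (x + h) - (psi1 x + psi2 x * h)) (psi1 x + psi2 x * h).
have := ler_normD (psi1 x) (psi2 x * h).
move: h1; rewrite subrK !normrM -(@real_normK _ h) ?num_real//.
have a1 := normr_ge0 (psi1 x).
have a2 := normr_ge0 (psi2 x); have h0 := normr_ge0 h.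
move: (`|psi1 x|) (`|psi2 x|) a1 a2 => u1 u2 a1 a2.
move: (`|h|) h0 => k k0.
have k3 : k <= 1 + k ^+ 3 by have [hk|/ltW hk] := leP k 1; nra.
have k23 : k ^+ 2 <= 1 + k ^+ 3 by have [hk|/ltW hk] := leP k 1; nra.
have c2 := ler_wpM2l a2 k3.
have c1 := mulr_ge0 a1 (exprn_ge0 3 k0).
by rewrite !mulrDl !mulrDr; lra.
Qed.

Lemma taylor3_le2 x h : `|psi2 (x + h)| <= (`|psi2 x| + 1) * (1 + `|h| ^+ 3).
Proof.
have [_ _ t2] := tay; have := t2 x h.
have := ler_normD (psi2 (x + h) - psi2 x) (psi2 x); rewrite subrK.
have a2 := normr_ge0 (psi2 x); have h0 := normr_ge0 h.
move: (`|h|) h0 => k k0.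
have k3 : k <= 1 + k ^+ 3 by have [hk|/ltW hk] := leP k 1; nra.
have c1 := mulr_ge0 a2 (exprn_ge0 3 k0).
by rewrite !mulrDl !mulrDr; lra.
Qed.

Lemma taylor3_continuous : [/\ continuous psi, continuous psi1 & continuous psi2].
Proof.
have [t0 t1 t2] := tay; split; apply: locally_lipschitz_continuous => x.
- exists (`|psi1 x| + `|psi2 x| + 1) => h h1; have := t0 x h.
  have -> : psi (x + h) - psi x - psi1 x * h - psi2 x * h ^+ 2 / 2 =
    (psi (x + h) - psi x) - (psi1 x * h + psi2 x * h ^+ 2 / 2) by ring.
  have := ler_normD ((psi (x + h) - psi x) - (psi1 x * h + psi2 x * h ^+ 2 / 2))
    (psi1 x * h + psi2 x * h ^+ 2 / 2).
  rewrite subrK; have := ler_normD (psi1 x * h) (psi2 x * h ^+ 2 / 2).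
  rewrite !normrM [`|2^-1|]ger0_norm ?invr_ge0//.
  have a1 := normr_ge0 (psi1 x); have a2 := normr_ge0 (psi2 x).
  have h0 := normr_ge0 h.
  move: (`|psi1 x|) (`|psi2 x|) a1 a2 => u1 u2 a1 a2.
  move: (`|h|) h0 h1 => k k0 k1.
  have k2 : k ^+ 2 <= k by nra.
  have k3 : k ^+ 3 <= k by nra.
  have c := ler_wpM2l a2 k2.
  have c' := mulr_ge0 a2 k0.
  by rewrite !mulrDl; lra.
- exists (`|psi2 x| + 1) => h h1; have := t1 x h.
  have := ler_normD (psi1 (x + h) - psi1 x - psi2 x * h) (psi2 x * h).
  rewrite subrK normrM -(@real_normK _ h) ?num_real//.
  have h0 := normr_ge0 h.
  move: (`|h|) h0 h1 => k k0 k1.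
  have k2 : k ^+ 2 <= k by nra.
  by rewrite !mulrDl; lra.
- by exists 1 => h _; rewrite mul1r.
Qed.

Let gauss_int_affine f M x s : continuous f ->
  (forall h, `|f (x + h)| <= M * (1 + `|h| ^+ 3)) ->
  gauss_int (fun y => f (x + s * y)).
Proof.
move=> cf fM; apply: (@gauss_int_dom _ _ (M * (1 + `|s| ^+ 3))).
  apply: measurableT_comp; first exact: continuous_measurable_fun.
  by apply: measurable_funD => //; exact: measurable_funM.
move=> y; apply: (le_trans (fM _)).
have M0 : 0 <= M by have := le_trans (normr_ge0 _) (fM 0);
  rewrite normr0 expr0n addr0 mulr1.
rewrite -mulrA ler_wpM2l// normrM exprMn.
have := exprn_ge0 3 (normr_ge0 s); have := exprn_ge0 3 (normr_ge0 y).
by move: (`|s| ^+ 3) (`|y| ^+ 3) => a b b0 a0; rewrite mulrDl !mulrDr; nra.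
Qed.

Lemma gauss_int_taylor3 x s :
  [/\ gauss_int (fun y => psi (x + s * y)), gauss_int (fun y => psi1 (x + s * y)) &
      gauss_int (fun y => psi2 (x + s * y))].
Proof.
have [c0 c1 c2] := taylor3_continuous; split.
- exact: gauss_int_affine c0 (taylor3_le0 x).
- exact: gauss_int_affine c1 (taylor3_le1 x).
- exact: gauss_int_affine c2 (taylor3_le2 x).
Qed.

End Taylor.

(** The heat semigroup: the mean of [psi (x + s * N)] for a standard normal [N]. *)
Definition gsmooth s psi x := G (fun y => psi (x + s * y)).

Lemma gsmooth0 psi x : gsmooth 0 psi x = psi x.
Proof.
rewrite /gsmooth -[RHS]gauss_mean_cst; congr gauss_mean.
by apply/funext => y; rewrite mul0r addr0.
Qed.

Lemma gauss_mean_ext f g : f =1 g -> G f = G g.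
Proof. by move=> fg; congr gauss_mean; apply/funext. Qed.

Lemma gsmooth_taylor3 s psi psi1 psi2 : taylor3 psi psi1 psi2 ->
  taylor3 (gsmooth s psi) (gsmooth s psi1) (gsmooth s psi2).
Proof.
move=> tay; have [t0 t1 t2] := tay.
have i0 x : gauss_int (fun y => psi (x + s * y)) by have [] := gauss_int_taylor3 tay x s.
have i1 x : gauss_int (fun y => psi1 (x + s * y)) by have [] := gauss_int_taylor3 tay x s.
have i2 x : gauss_int (fun y => psi2 (x + s * y)) by have [] := gauss_int_taylor3 tay x s.
have shift x h y : x + h + s * y = x + s * y + h by rewrite addrAC.
split=> x h; rewrite /gsmooth.
- rewrite -[leRHS]gauss_mean_cst.
  have e : G (fun y => psi (x + h + s * y)) - G (fun y => psi (x + s * y)) -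
    G (fun y => psi1 (x + s * y)) * h - G (fun y => psi2 (x + s * y)) * h ^+ 2 / 2 =
    G (fun y => psi (x + h + s * y) + -1 * psi (x + s * y) +
       - h * psi1 (x + s * y) + - (h ^+ 2 / 2) * psi2 (x + s * y)).
    by rewrite !gauss_meanD ?gauss_meanZ //; try ring;
      repeat (apply: gauss_intD || apply: gauss_intZ).
  rewrite e; apply: le_norm_gauss_mean; last 1 first.
  + move=> y; apply: le_trans (t0 (x + s * y) h); rewrite shift.
    by rewrite le_eqVlt; apply/orP; left; apply/eqP; congr `| _ |; ring.
  + by repeat (apply: gauss_intD || apply: gauss_intZ).
  + exact: gauss_int_cst.
- rewrite -[leRHS]gauss_mean_cst.
  have e : G (fun y => psi1 (x + h + s * y)) - G (fun y => psi1 (x + s * y)) -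
    G (fun y => psi2 (x + s * y)) * h =
    G (fun y => psi1 (x + h + s * y) + -1 * psi1 (x + s * y) +
       - h * psi2 (x + s * y)).
    by rewrite !gauss_meanD ?gauss_meanZ //; try ring;
      repeat (apply: gauss_intD || apply: gauss_intZ).
  rewrite e; apply: le_norm_gauss_mean; last 1 first.
  + move=> y; apply: le_trans (t1 (x + s * y) h); rewrite shift.
    by rewrite le_eqVlt; apply/orP; left; apply/eqP; congr `| _ |; ring.
  + by repeat (apply: gauss_intD || apply: gauss_intZ).
  + exact: gauss_int_cst.
- rewrite -[leRHS]gauss_mean_cst.
  have e : G (fun y => psi2 (x + h + s * y)) - G (fun y => psi2 (x + s * y)) =
    G (fun y => psi2 (x + h + s * y) + -1 * psi2 (x + s * y)).
    by rewrite !gauss_meanD ?gauss_meanZ //; try ring;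
      repeat (apply: gauss_intD || apply: gauss_intZ).
  rewrite e; apply: le_norm_gauss_mean; last 1 first.
  + move=> y; apply: le_trans (t2 (x + s * y) h); rewrite shift.
    by rewrite le_eqVlt; apply/orP; left; apply/eqP; congr `| _ |; ring.
  + by repeat (apply: gauss_intD || apply: gauss_intZ).
  + exact: gauss_int_cst.
Qed.

(** The expansion at [x] has no first-order term because the Gaussian is centred. *)
Lemma gsmooth_expansion s psi psi1 psi2 x : 0 <= s -> taylor3 psi psi1 psi2 ->
  `|gsmooth s psi x - psi x - psi2 x * (G (fun y => y ^+ 2) * s ^+ 2) / 2| <=
  s ^+ 3 * G (fun y => `|y| ^+ 3).
Proof.
move=> s0 tay; have [t0 _ _] := tay.
have [i0 _ _] := gauss_int_taylor3 tay x s.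
rewrite -gauss_meanZ; last exact: gauss_int_cube.
have -> : gsmooth s psi x - psi x - psi2 x * (G (fun y => y ^+ 2) * s ^+ 2) / 2 =
   G (fun y => psi (x + s * y) + - psi x + - (psi1 x * s) * y
       + - (psi2 x * s ^+ 2 / 2) * y ^+ 2).
  rewrite !gauss_meanD ?gauss_mean_cst ?(gauss_meanZ _ (gauss_int_id R))
     ?(gauss_meanZ _ (gauss_int_sqr R)) ?(gauss_mean_id R); first by rewrite /gsmooth;
       field.
  all: repeat (apply: gauss_intD || apply: gauss_intZ); rewrite //;
       try exact: gauss_int_cst; try exact: gauss_int_id; try exact: gauss_int_sqr.
apply: le_norm_gauss_mean.
- repeat (apply: gauss_intD || apply: gauss_intZ) => //;
    [exact: gauss_int_cst | exact: gauss_int_id | exact: gauss_int_sqr].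
- by apply: gauss_intZ; exact: gauss_int_cube.
move=> y; have := t0 x (s * y); rewrite normrM (ger0_norm s0) [(s * `|y|) ^+ 3]exprMn.
apply: le_trans; rewrite le_eqVlt; apply/orP; left; apply/eqP; congr `| _ |; ring.
Qed.

Lemma gsmooth_density s psi x : 0 < s -> continuous psi -> (forall y, 0 <= psi y) ->
  (\int[mu]_w (psi w * normal_pdf x s w)%:E =
   \int[mu]_y (psi (x + s * y) * p y)%:E)%E.
Proof.
move=> s0 cpsi psi0.
rewrite (@integral_affine _ (fun w => psi w * normal_pdf x s w) x s)//.
- by apply: eq_integral => y _; rewrite -mulrA normal_pdfZ.
- by move=> y; apply: cvgM; [exact: cpsi | apply: continuous_normal_pdf; rewrite gt_eqF].
- by move=> y; rewrite mulr_ge0// normal_pdf_ge0.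
Qed.

(* Completing the square in [y]. *)
Lemma normal_pdf_convolution s t x w y : 0 < s -> 0 < t ->
  normal_pdf (x + s * y) t w * p y =
  normal_pdf x (Num.sqrt (s ^+ 2 + t ^+ 2)) w *
  normal_pdf (s * (w - x) / (s ^+ 2 + t ^+ 2))
             (t / Num.sqrt (s ^+ 2 + t ^+ 2)) y.
Proof.
move=> s0 t0; have st0 : 0 < s ^+ 2 + t ^+ 2 by rewrite addr_gt0 ?exprn_gt0.
have r0 : 0 < Num.sqrt (s ^+ 2 + t ^+ 2) by rewrite sqrtr_gt0.
have r2 := @sqr_sqrtr _ (s ^+ 2 + t ^+ 2) (ltW st0).
have tr0 : 0 < t / Num.sqrt (s ^+ 2 + t ^+ 2) by rewrite divr_gt0.
rewrite !normal_pdfE ?oner_neq0 ?gt_eqF//.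
have peak u : 0 < u -> normal_peak u = u^-1 * normal_peak (1 : R).
  move=> u0; rewrite /normal_peak -!mulrnAr sqrtrM ?sqr_ge0// sqrtr_sqr gtr0_norm//.
  by rewrite expr1n mul1r invfM.
rewrite (peak _ t0) (peak _ r0) (peak _ tr0).
rewrite /normal_fun.
set k := normal_peak 1; set r := Num.sqrt _ in r0 r2 tr0 *.
rewrite (_ : t^-1 * k * expR _ * (k * expR _) = t^-1 * k * k * (expR
   (- (w - (x + s * y)) ^+ 2 / (t ^+ 2 *+ 2)) * expR (- (y - 0) ^+ 2 / (1 ^+ 2 *+ 2))));
  last by ring.
rewrite (_ : r^-1 * k * expR _ * _ = r^-1 * (t / r)^-1 * k * k *
  (expR (- (w - x) ^+ 2 / (r ^+ 2 *+ 2)) *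
   expR (- (y - s * (w - x) / (s ^+ 2 + t ^+ 2)) ^+ 2 / ((t / r) ^+ 2 *+ 2))));
  last by ring.
congr (_ * _).
  by congr (_ * _ * _); rewrite invf_div mulrA mulVf ?mul1r// gt_eqF.
rewrite -!expRD; congr expR; rewrite subr0 expr1n expr_div_n r2.
field; rewrite ?gt_eqF//.
Qed.

(** Sums of independent Gaussians: after Tonelli, which uses [0 <= psi], the factorised density
    integrates to 1 in the inner variable. A zero scale has no density and is treated apart. *)
Lemma gsmooth_semigroup s t psi psi1 psi2 x : 0 <= s -> 0 <= t ->
  taylor3 psi psi1 psi2 -> (forall y, 0 <= psi y) ->
  gsmooth s (gsmooth t psi) x = gsmooth (Num.sqrt (s ^+ 2 + t ^+ 2)) psi x.
Proof.
rewrite le_eqVlt => /predU1P[<- t0 _ _|s0].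
  by rewrite gsmooth0 expr0n add0r sqrtr_sqr ger0_norm.
rewrite le_eqVlt => /predU1P[<- _ _|t0].
  rewrite expr0n addr0 sqrtr_sqr gtr0_norm//; apply: gauss_mean_ext => y.
  by rewrite gsmooth0.
move=> tay psi0; have [cpsi _ _] := taylor3_continuous tay.
set r := Num.sqrt _; have r0 : 0 < r by rewrite sqrtr_gt0 addr_gt0 ?exprn_gt0.
rewrite /gsmooth /gauss_mean /Rintegral; congr fine.
transitivity (\int[mu]_y \int[mu]_w
   (psi w * (normal_pdf x r w *
   normal_pdf (s * (w - x) / (s ^+ 2 + t ^+ 2)) (t / r) y))%:E)%E.
  apply: eq_integral => y _.
  rewrite EFinM fineK; last first.
    have [i0 _ _] := gauss_int_taylor3 tay (x + s * y) t.
    exact: integrable_fin_num i0.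
  rewrite -gsmooth_density//.
  rewrite -ge0_integralZr//; first last.
  - by rewrite lee_fin normal_pdf_ge0.
  - by move=> w _; rewrite lee_fin mulr_ge0// normal_pdf_ge0.
  - apply/measurable_EFinP; apply: measurable_funM;
    first exact: continuous_measurable_fun.
    exact: measurable_normal_pdf.
  by apply: eq_integral => w _; rewrite -(normal_pdf_convolution x w y s0 t0) -EFinM
    mulrA.
pose f (yw : R * R) := (psi yw.2 * (normal_pdf x r yw.2 *
   normal_pdf (s * (yw.2 - x) / (s ^+ 2 + t ^+ 2)) (t / r) yw.1))%:E.
have f0 yw : (0 <= f yw)%E by rewrite lee_fin !mulr_ge0// normal_pdf_ge0.
have mf : measurable_fun setT f.
  apply/measurable_EFinP; apply: measurable_funM.
    by apply: measurableT_comp; first exact: continuous_measurable_fun.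
  apply: measurable_funM.
    by apply: measurableT_comp; first exact: measurable_normal_pdf.
  under eq_fun do rewrite normal_pdfE ?gt_eqF ?divr_gt0//.
  apply: measurable_funM => //; apply: measurableT_comp => //.
  apply: measurable_funM => //; apply: measurableT_comp => //.
  apply: (@measurable_funX _ _ _ _ _ 2%N); apply: measurable_funB => //.
  apply: measurable_funM => //; apply: measurable_funM => //.
  exact: measurable_funB.
transitivity (\int[mu]_w \int[mu]_y f (y, w))%E.
  exact: (@fubini_tonelli _ _ _ _ _ mu mu f mf f0).
rewrite /f /=.
rewrite -gsmooth_density//; apply: eq_integral => w _.
under eq_integral do rewrite mulrA EFinM.
rewrite ge0_integralZl//.
- by rewrite integral_normal_pdf mule1.
- by apply/measurable_EFinP; exact: measurable_normal_pdf.
- by move=> y _; rewrite lee_fin normal_pdf_ge0.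
- by rewrite lee_fin mulr_ge0// normal_pdf_ge0.
Qed.

(** One step of the walk is exchanged for one Gaussian step of scale [s]. First-order terms vanish
    by symmetry, second-order terms agree by the hypothesis relating [b] and [s], and the
    third-order remainders are the cost per step. *)
Lemma walk_gsmooth b s n psi psi1 psi2 x : 0 <= b -> 0 <= s ->
  b ^+ 2 = G (fun y => y ^+ 2) * s ^+ 2 ->
  taylor3 psi psi1 psi2 -> (forall y, 0 <= psi y) ->
  `|walk b n psi x - gsmooth (Num.sqrt n%:R * s) psi x| <=
  n%:R * (b ^+ 3 + s ^+ 3 * G (fun y => `|y| ^+ 3)).
Proof.
move=> b0 s0 bs tay psi0; elim: n x => [|n IH] x.
  by rewrite sqrtr0 !mul0r gsmooth0 subrr normr0.
set K := b ^+ 3 + _ in IH *.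
have ns0 : 0 <= Num.sqrt n%:R * s by rewrite mulr_ge0 ?sqrtr_ge0.
have -> : Num.sqrt n.+1%:R * s = Num.sqrt (s ^+ 2 + (Num.sqrt n%:R * s) ^+ 2).
  rewrite exprMn sqr_sqrtr// -[X in Num.sqrt (X + _)]mul1r -mulrDl addrC natr1.
  by rewrite sqrtrM// sqrtr_sqr ger0_norm.
rewrite -(gsmooth_semigroup x s0 ns0 tay psi0).
have tayT := gsmooth_taylor3 (Num.sqrt n%:R * s) tay.
have := gsmooth_expansion x s0 tayT.
have [t0 _ _] := tayT; have := t0 x b; have := t0 x (- b).
have := IH (x + b); have := IH (x - b).
move: (gsmooth (Num.sqrt n%:R * s) psi) (gsmooth (Num.sqrt n%:R * s) psi1)
  (gsmooth (Num.sqrt n%:R * s) psi2) => u u1 u2 /=.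
rewrite normrN (ger0_norm b0) -bs -(natr1 n) (mulrDl n%:R 1) mul1r /K.
rewrite !ler_norml => /andP[h1 h2] /andP[h3 h4] /andP[h5 h6] /andP[h7 h8] /andP[h9 h10].
apply/andP; split; lra.
Qed.

End GaussianWalk.

(** * Step functions and the central limit theorem *)

Section StepFunction.
Variable R : realType.
Implicit Types (psi f g : R -> R).

Lemma taylor3_lin a b f f1 f2 g g1 g2 : `|a| + `|b| <= 1 :> R ->
  taylor3 f f1 f2 -> taylor3 g g1 g2 ->
  taylor3 (fun x => a * f x + b * g x) (fun x => a * f1 x + b * g1 x)
          (fun x => a * f2 x + b * g2 x).
Proof.
move=> ab [f0 fh1 fh2] [g0 gh1 gh2].
have comb (u v w : R) : `|u| <= w -> `|v| <= w -> `|a * u + b * v| <= w.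
  move=> uw vw; have w0 : 0 <= w by apply: le_trans uw.
  apply: (le_trans (ler_normD _ _)); rewrite !normrM.
  have := ler_wpM2l (normr_ge0 a) uw; have := ler_wpM2l (normr_ge0 b) vw.
  by have := ler_wpM2r w0 ab; rewrite mul1r mulrDl; lra.
split=> x h.
- apply: le_trans (comb _ _ _ (f0 x h) (g0 x h)).
  by rewrite le_eqVlt; apply/orP; left; apply/eqP; congr `| _ |; ring.
- apply: le_trans (comb _ _ _ (fh1 x h) (gh1 x h)).
  by rewrite le_eqVlt; apply/orP; left; apply/eqP; congr `| _ |; ring.
- apply: le_trans (comb _ _ _ (fh2 x h) (gh2 x h)).
  by rewrite le_eqVlt; apply/orP; left; apply/eqP; congr `| _ |; ring.
Qed.

Lemma taylor3_affine k m f f1 f2 : 0 < k -> taylor3 f f1 f2 ->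
  taylor3 (fun x => k ^- 3 * f (k * x + m)) (fun x => k ^- 2 * f1 (k * x + m))
          (fun x => k^-1 * f2 (k * x + m)).
Proof.
move=> k0 [t0 t1 t2].
have e x h : k * (x + h) + m = k * x + m + k * h by ring.
have kn : k != 0 by rewrite gt_eqF.
have nk h : `|k * h| = k * `|h| by rewrite normrM gtr0_norm.
have ki : 0 < k^-1 by rewrite invr_gt0.
split=> x h; rewrite e.
- have := t0 (k * x + m) (k * h); rewrite nk exprMn.
  rewrite -(ler_pM2l (exprn_gt0 3 ki)) -[X in X * `| _ |](gtr0_norm (exprn_gt0 3 ki))
    -normrM.
  rewrite [leRHS](_ : _ = `|h| ^+ 3); last by field.
  apply: le_trans; rewrite le_eqVlt; apply/orP; left; apply/eqP; congr `| _ |.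
  by field.
- have := t1 (k * x + m) (k * h); rewrite exprMn.
  rewrite -(ler_pM2l (exprn_gt0 2 ki)) -[X in X * `| _ |](gtr0_norm (exprn_gt0 2 ki))
    -normrM.
  rewrite [leRHS](_ : _ = h ^+ 2); last by field.
  apply: le_trans; rewrite le_eqVlt; apply/orP; left; apply/eqP; congr `| _ |.
  by field.
- have := t2 (k * x + m) (k * h); rewrite nk.
  rewrite -(ler_pM2l ki) -[X in X * `| _ |](gtr0_norm ki) -normrM.
  rewrite [leRHS](_ : _ = `|h|); last by field.
  apply: le_trans; rewrite le_eqVlt; apply/orP; left; apply/eqP; congr `| _ |.
  by ring.
Qed.

Lemma taylor3_cst (c : R) : taylor3 (fun=> c) (fun=> 0) (fun=> 0).
Proof.
split=> x h.
- by rewrite !mul0r !subr0 subrr normr0 exprn_ge0.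
- by rewrite mul0r !subr0 normr0 sqr_ge0.
- by rewrite subr0 normr0.
Qed.

Let pos (x : R) := Num.max x 0.

(** The third derivative is the indicator of the positive half-line, so finite differences of this
    function are cubic splines. *)
Lemma taylor3_truncated_cube :
  taylor3 (fun x => pos x ^+ 3 / 6) (fun x => pos x ^+ 2 / 2) pos.
Proof.
have posE x : (0 <= x -> pos x = x) * (x <= 0 -> pos x = 0).
  by split=> x0; [exact/max_idPl | exact/max_idPr].
split=> x h;
  (have [x0|/ltW x0] := leP 0 x; have [xh0|/ltW xh0] := leP 0 (x + h);
   [ rewrite (posE x).1// (posE (x + h)).1// | rewrite (posE x).1// (posE (x + h)).2//
   | rewrite (posE x).2// (posE (x + h)).1// | rewrite (posE x).2// (posE (x + h)).2//]).
- rewrite (_ : _ - _ = h ^+ 3 / 6); last by field.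
  rewrite normrM normrX [`|6^-1|]ger0_norm ?invr_ge0//.
  by have := exprn_ge0 3 (normr_ge0 h); lra.
- have h0 : h <= 0 by lra.
  rewrite ler0_norm//; last first.
    have : x ^+ 2 * (x + h) <= 0 by rewrite mulr_ge0_le0// sqr_ge0.
    have : x * (x + h) ^+ 2 >= 0 by rewrite mulr_ge0// sqr_ge0.
    have : x ^+ 2 * x >= 0 by rewrite mulr_ge0// sqr_ge0.
    have : x * h ^+ 2 >= 0 by rewrite mulr_ge0// sqr_ge0.
    by nra.
  rewrite ler0_norm//; set k := - h; have hk : h = - k by rewrite /k opprK.
  have xk : x <= k by lra.
  rewrite hk; have k0 : 0 <= k by lra.
  have : (k - x) ^+ 3 >= 0 by rewrite exprn_ge0//; lra.
  have : k ^+ 3 >= 0 by rewrite exprn_ge0.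
  by lra.
- have h0 : 0 <= h by lra.
  rewrite !expr0n /= !mul0r !subr0 ger0_norm ?mulr_ge0 ?exprn_ge0 ?invr_ge0//.
  rewrite ger0_norm//.
  have : (x + h) ^+ 3 <= h ^+ 3 by rewrite lerXn2r ?nnegrE//; lra.
  by have := exprn_ge0 3 xh0; lra.
- by rewrite !expr0n /= !mul0r !subr0 normr0 exprn_ge0.
- rewrite (_ : _ - _ = h ^+ 2 / 2); last by field.
  by rewrite ger0_norm; have := sqr_ge0 h; lra.
- have h0 : h <= 0 by lra.
  have : (x + h) ^+ 2 <= h ^+ 2.
    by rewrite -[leLHS]sqrrN -[leRHS]sqrrN lerXn2r ?nnegrE//; lra.
  by rewrite !expr0n /= mul0r ler_norml => ?; have := sqr_ge0 h; have := sqr_ge0 (x + h);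
     move=> *; apply/andP; split; lra.
- have : (x + h) ^+ 2 <= h ^+ 2 by rewrite lerXn2r ?nnegrE//; lra.
  rewrite !expr0n /= !mul0r !subr0 ger0_norm ?mulr_ge0 ?exprn_ge0 ?invr_ge0//.
  by have := sqr_ge0 (x + h); lra.
- by rewrite !expr0n /= !mul0r !subr0 normr0 sqr_ge0.
- by rewrite addrAC subrr add0r.
- by rewrite ler_norml sub0r; have := ler_norm h; have := ler_norm (- h);
     rewrite normrN => *; apply/andP; split; lra.
- by rewrite subr0 ger0_norm//; have := ler_norm h; lra.
- by rewrite subrr normr0.
Qed.

(* The third finite difference of [pos ^ 3 / 6] vanishes on the left of 0 and
   equals 1 on the right of 3. *)
Let rise (u : R) := pos u ^+ 3 / 6 - 3 * (pos (u - 1) ^+ 3 / 6)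
  + 3 * (pos (u - 2) ^+ 3 / 6) - pos (u - 3) ^+ 3 / 6.

Lemma step_test (x d : R) : 0 < d ->
  exists (lam : R) (psi psi1 psi2 : R -> R),
    [/\ 0 < lam, taylor3 (fun z => lam * psi z) psi1 psi2,
        forall z, 0 <= psi z <= 1, forall z, z <= x -> psi z = 1 &
        forall z, x + d <= z -> psi z = 0].
Proof.
move=> d0; have posE y : (0 <= y -> pos y = y) * (y <= 0 -> pos y = 0).
  by split=> y0; [exact/max_idPl | exact/max_idPr].
have rise0 u : u <= 0 -> rise u = 0.
  move=> u0; have [h1 h2 h3] : [/\ u - 1 <= 0, u - 2 <= 0 & u - 3 <= 0] by split; lra.
  by rewrite /rise (posE u).2// (posE (u - 1)).2// (posE (u - 2)).2// (posE (u -
    3)).2// !expr0n /=; lra.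
have rise1 u : 3 <= u -> rise u = 1.
  move=> u0; have [h0 h1 h2 h3] : [/\ 0 <= u, 0 <= u - 1, 0 <= u - 2 & 0 <= u - 3].
    by split; lra.
  rewrite /rise (posE u).1// (posE (u - 1)).1// (posE (u - 2)).1// (posE (u - 3)).1//.
  by field.
have rise01 u : 0 <= rise u <= 1.
  have [u0|/ltW u0] := leP u 0; first by rewrite rise0// lexx ler01.
  have [u3|/ltW u3] := leP 3 u; first by rewrite rise1// ler01 lexx.
  rewrite /rise (posE u).1// (posE (u - 3)).2 ?expr0n/=; last by lra.
  have [u2|/ltW u2] := leP 2 u.
    rewrite (posE (u - 1)).1 ?(posE (u - 2)).1; try by lra.
    have k0 : 0 <= 3 - u by lra.
    have : (3 - u) ^+ 3 <= 1 by rewrite exprn_ile1//; lra.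
    by have := exprn_ge0 3 k0; move=> *; apply/andP; split; lra.
  rewrite (posE (u - 2)).2 ?expr0n/=; last by lra.
  have [u1|/ltW u1] := leP 1 u.
    rewrite (posE (u - 1)).1; last by lra.
    have k0 : 0 <= 2 - u by lra.
    have k1 : 0 <= u - 1 by lra.
    have := exprn_ge0 3 k1; have := mulr_ge0 k0 (mulr_ge0 k1 k1).
    have := exprn_ge0 3 k0; have := mulr_ge0 k1 (mulr_ge0 k0 k0).
    by move=> *; apply/andP; split; nra.
  rewrite (posE (u - 1)).2 ?expr0n/=; last by lra.
  have : u ^+ 3 <= 1 by rewrite exprn_ile1//; lra.
  by have := exprn_ge0 3 u0; move=> *; apply/andP; split; lra.
(* [k] and [m] carry the interval [[x, x + d]] to the interval [[0, 3]] on which [rise] climbs. *)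
pose k := 3 / d; have k0 : 0 < k by rewrite divr_gt0.
have cub := taylor3_truncated_cube.
have c m := taylor3_affine m k0 cub.
pose m := - (k * x).
(* [8 = 1 + 3 + 3 + 1] is the total weight of the four cubes, and [k ^+ 3] the effect of the
   rescaling on a third derivative. *)
pose lam := (8 * k ^+ 3)^-1.
have lam0 : 0 < lam by rewrite invr_gt0 mulr_gt0// exprn_gt0.
have tr : exists psi1 psi2, taylor3 (fun z => lam * rise (k * z + m)) psi1 psi2.
  have n1 : `|1 / 4 : R| + `|- (3 / 4) : R| <= 1.
    by rewrite normrN !ger0_norm ?divr_ge0//; lra.
  have n2 : `|3 / 4 : R| + `|- (1 / 4) : R| <= 1.
    by rewrite normrN !ger0_norm ?divr_ge0//; lra.
  have n3 : `|1 / 2 : R| + `|1 / 2 : R| <= 1.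
    by rewrite !ger0_norm ?divr_ge0//; lra.
  have T := taylor3_lin n3 (taylor3_lin n1 (c m) (c (m - 1)))
     (taylor3_lin n2 (c (m - 2)) (c (m - 3))).
  eexists; eexists; have := T; congr taylor3; apply/funext => z.
  rewrite /rise /lam !addrA; field.
  by rewrite gt_eqF.
have [psi1 [psi2 tay]] := tr.
(* The halving comes from averaging the constant [lam] with [- lam * rise]. *)
exists (lam / 2), (fun z => 1 - rise (k * z + m)).
have n4 : `|1 / 2 : R| + `|- (1 / 2) : R| <= 1.
  by rewrite normrN !ger0_norm ?divr_ge0//; lra.
have T := taylor3_lin n4 (taylor3_cst lam) tay.
eexists; eexists; split.
- by rewrite divr_gt0.
- by have := T; congr taylor3; apply/funext => z; ring.
- by move=> z; have := rise01 (k * z + m) => /andP[? ?]; apply/andP; split; lra.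
- move=> z zx; rewrite rise0 ?subr0// /m -mulrBr.
  by rewrite pmulr_rle0//; lra.
- move=> z zx; rewrite rise1 ?subrr// /m -mulrBr /k mulrAC ler_pdivlMr//.
  by rewrite ler_pM2l//; lra.
Qed.

End StepFunction.

(** * Central limit theorem for smooth test functions *)

Section CentralLimit.
Local Open Scope classical_set_scope.
Local Open Scope ring_scope.
Variable R : realType.
Local Notation E := (@shape_mean R).
Local Notation G := (@gauss_mean R).
Local Notation root4 n := (Num.sqrt (Num.sqrt (n%:R : R))).

(** A small power in place of the logarithm. For consecutive fourth roots [q <= p], [1 = p ^+ 4 - q
    ^+ 4 <= (p - q) * 4 * p ^+ 3], and [p >= 1]. *)
Lemma harm_le n : harm R n <= 4 * root4 n.
Proof.
elim: n => [|n IH]; first by rewrite /harm big_ord0 mulr_ge0 ?sqrtr_ge0.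
rewrite harmS; apply: (@le_trans _ _ (4 * root4 n + 4 * (root4 n.+1 - root4 n)));
  last by lra.
apply: lerD => //.
have q0 : 0 <= root4 n by rewrite sqrtr_ge0.
have q1 : 1 <= root4 n.+1.
  by rewrite -[leLHS]sqrtr1 ler_sqrt ?sqrtr_gt0// -[leLHS]sqrtr1 ler_sqrt// ler1n.
have qq : root4 n <= root4 n.+1.
  by rewrite ler_sqrt ?sqrtr_gt0// ler_sqrt// ler_nat.
have e m : root4 m ^+ 4 = m%:R.
  by rewrite (exprM _ 2 2) sqr_sqrtr ?sqrtr_ge0// sqr_sqrtr.
have e1 : root4 n.+1 ^+ 4 = root4 n ^+ 4 + 1 by rewrite !e natr1.
rewrite -[X in X^-1 <= _]e.
move: (root4 n) (root4 n.+1) q0 q1 qq e1 => q p q0 q1 qq e1.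
have p0 : 0 < p by lra.
rewrite -div1r ler_pdivrMr ?exprn_gt0//.
have e2 : (p - q) * ((p + q) * (p ^+ 2 + q ^+ 2)) = 1 by rewrite [LHS](_ : _ = p ^+ 4
  - q ^+ 4); [rewrite e1; ring | ring].
have pq : 0 <= p - q by lra.
have h1 : (p + q) * (p ^+ 2 + q ^+ 2) <= (2 * p) * (2 * p ^+ 2).
  by apply: ler_pM; [lra | rewrite addr_ge0 ?sqr_ge0 | lra | nra].
have h2 := ler_wpM2l pq h1.
have h3 : (p - q) * (2 * p * (2 * p ^+ 2)) * 1 <= (p - q) * (2 * p * (2 * p ^+ 2)) * p.
  by rewrite ler_wpM2l// !mulr_ge0// ?sqr_ge0 ltW.
by move: h2 h3; rewrite e2; lra.
Qed.

Lemma cvg_root4 (u : nat -> R) (l A : R) :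
  (forall n, `|u n - l| <= A / root4 n.+1) -> u n @[n --> \oo] --> l.
Proof.
move=> uA; have A0 : 0 <= A.
  have := le_trans (normr_ge0 _) (uA 0%N); rewrite !sqrtr1 divr1; exact.
apply/cvgrPdist_le => e e0.
near=> n; rewrite distrC; apply: (le_trans (uA n)).
have q0 : 0 < root4 n.+1 by rewrite !sqrtr_gt0.
rewrite ler_pdivrMr// mulrC -ler_pdivrMr//.
have Ae : 0 <= A / e by rewrite divr_ge0// ltW.
rewrite -[leLHS]ger0_norm// -sqrtr_sqr ler_sqrt ?sqrtr_gt0//.
rewrite -[leLHS]ger0_norm ?sqr_ge0// -sqrtr_sqr ler_sqrt ?ltr0n//.
apply: (@le_trans _ _ n%:R); last by rewrite ler_nat.
near: n; apply: nbhs_infty_ger.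
Unshelve. all: by end_near.
Qed.

Theorem additive_clt (F : btree -> R) (C : R) :
  (forall l r, `|F (Node l r) - F l - F r| <= C) ->
  exists nu tau : R, 0 <= tau /\
    forall psi psi1 psi2 : R -> R, taylor3 psi psi1 psi2 -> (forall y, 0 <= psi y) ->
    E n (fun t => psi ((F t - nu * n.+1%:R) / Num.sqrt n.+1%:R)) @[n --> \oo]
      --> gsmooth tau psi 0.
Proof.
move=> FC; have [nu [D FD]] := additive_mean FC.
pose Y t := F t - nu * (nodes t).+1%:R.
have YC l r : `|Y (Node l r) - Y l - Y r| <= C.
  rewrite (_ : _ - _ - _ = F (Node l r) - F l - F r)//.
  by rewrite /Y /= -!natr1 natrD; ring.
have YD n : `|E n Y| <= D.
  rewrite (@eq_shape_mean _ n Y (fun t => F t - nu * n.+1%:R)); last by move=> t <-.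
  by rewrite shape_meanB shape_mean_cst.
have [K K0 vK] := second_moment_bound YC YD.
have [s2 [B [s20 dB]]] := second_moment_linear YC YD.
have [M M0 closeM] := close_all YC YD s20 K0 vK dB.
have c0 := gauss_mean_sqr_gt0 R; set c := gauss_mean _ in c0.
have D0 : 0 <= D by apply: le_trans (YD 0%N).
have B0 : 0 <= B by have := le_trans (normr_ge0 _) (dB 0%N); rewrite sqrtr1 mulr1.
(* [c] is the second moment of the reference Gaussian, so its multiple by [tau] has variance
   [s2]. *)
pose sg := Num.sqrt s2; pose tau := Num.sqrt (s2 / c).
have tau0 : 0 <= tau by rewrite sqrtr_ge0.
exists nu, tau; split=> // psi psi1 psi2 tay psi0.
pose c3 := sg ^+ 3 + tau ^+ 3 * G (fun y => `|y| ^+ 3).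
pose A := 4 * M + `|psi1 0| * D + `|psi2 0| / 2 * B + c3.
apply: (@cvg_root4 _ _ A) => n.
have r1 : 1 <= Num.sqrt (n.+1%:R : R) by rewrite -[leLHS]sqrtr1 ler_sqrt// ler1n.
have r2 : Num.sqrt (n.+1%:R : R) ^+ 2 = n.+1%:R by rewrite sqr_sqrtr.
have q2 : root4 n.+1 ^+ 2 = Num.sqrt n.+1%:R by rewrite sqr_sqrtr ?sqrtr_ge0.
have q1 : 1 <= root4 n.+1 by rewrite -[leLHS]sqrtr1 ler_sqrt// sqrtr_gt0.
have h4 := harm_le n.+1.
set r := Num.sqrt n.+1%:R in r1 r2 q2 q1 h4 *.
set q := Num.sqrt r in q2 q1 h4 *.
have r0 : 0 < r by lra.
have q0 : 0 < q by lra.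
(* Rescaling the test function by [k] puts [k ^- 3 * psi (k * y)] in the class [taylor3], so the
   error of order n log n is multiplied by [k ^+ 3], which is n^(-3/2) up to the shift of [n]. *)
pose k := r^-1; have k0 : 0 < k by rewrite invr_gt0.
have tayk := taylor3_affine 0 k0 tay.
have := close_at_recenter YD s20 (closeM n) 0 tayk.
rewrite !mulr0 !addr0 -(ler_pM2l (exprn_gt0 3 k0)).
rewrite -[X in X * `| _ |](gtr0_norm (exprn_gt0 3 k0)) -normrM mulrBr -walkZ -shape_meanZ.
have -> : E n (fun t => k ^+ 3 * (k ^- 3 * psi (k * (0 + Y t) + 0))) =
    E n (fun t => psi ((F t - nu * n.+1%:R) / r)).
  apply: eq_shape_mean => t nt; rewrite mulVKf ?expf_neq0 ?gt_eqF//.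
  by rewrite add0r addr0 /Y nt mulrC.
have -> : walk (Num.sqrt s2) n.+1 (fun y => k ^+ 3 * (k ^- 3 * psi (k * y + 0))) 0 =
    walk (sg * k) n.+1 psi 0.
  rewrite -[X in walk _ _ psi X](mul0r k) -walk_scale; apply: eq_walk => y.
  by rewrite mulVKf ?expf_neq0 ?gt_eqF// addr0 mulrC.
have sgk : 0 <= sg * k by rewrite mulr_ge0 ?sqrtr_ge0// ltW.
have tauk : 0 <= tau * k by rewrite mulr_ge0// ltW.
have bs : (sg * k) ^+ 2 = c * (tau * k) ^+ 2.
  rewrite !exprMn !sqr_sqrtr//; first by field; rewrite gt_eqF.
  by rewrite divr_ge0// ltW.
have := walk_gsmooth n.+1 0 sgk tauk bs tay psi0.
have -> : Num.sqrt n.+1%:R * (tau * k) = tau.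
  by rewrite -/r /k mulrCA mulfV ?mulr1// gt_eqF.
move=> w1 w2.
have := ler_normD (E n (fun t => psi ((F t - nu * n.+1%:R) / r)) - walk (sg * k) n.+1
  psi 0)
  (walk (sg * k) n.+1 psi 0 - gsmooth tau psi 0).
rewrite addrA subrK => /le_trans; apply.
apply: (le_trans (lerD w2 w1)).
have -> : n.+1%:R * ((sg * k) ^+ 3 + (tau * k) ^+ 3 * G (fun y => `|y| ^+ 3)) = c3 / r.
  by rewrite /c3 /k -r2; field; rewrite gt_eqF.
have -> : k ^+ 3 * (M * (n.+1%:R * harm R n.+1) + `|k ^- 2 * psi1 0| * D +
      `|k^-1 * psi2 0| / 2 * `|E n (fun t => Y t ^+ 2) - s2 * n.+1%:R|) =
   M * harm R n.+1 / r + `|psi1 0| * D / r +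
     `|psi2 0| / 2 * (`|E n (fun t => Y t ^+ 2) - s2 * n.+1%:R| / r ^+ 2).
  move: (`|E n _ - _|) => dn.
  have -> : `|k ^- 2 * psi1 0| = k ^- 2 * `|psi1 0|.
    by rewrite normrM ger0_norm// invr_ge0 exprn_ge0// ltW.
  have -> : `|k^-1 * psi2 0| = k^-1 * `|psi2 0|.
    by rewrite normrM ger0_norm// invr_ge0 ltW.
  by rewrite -r2 /k; field; rewrite gt_eqF.
have rq : r = q * q by rewrite -q2.
have ir : r^-1 <= q^-1 by rewrite lef_pV2 ?posrE// rq ler_peMl// ltW.
have t1 : M * harm R n.+1 / r <= 4 * M / q.
  rewrite rq ler_pdivrMr ?mulr_gt0//.
  rewrite (_ : 4 * M / q * (q * q) = M * (4 * q)); last by field; rewrite gt_eqF.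
  by rewrite ler_wpM2l.
have t2 : `|psi1 0| * D / r <= `|psi1 0| * D / q by rewrite ler_wpM2l// mulr_ge0.
have t3 : `|psi2 0| / 2 * (`|E n (fun t => Y t ^+ 2) - s2 * n.+1%:R| / r ^+ 2) <=
   `|psi2 0| / 2 * B / q.
  rewrite -[leRHS]mulrA ler_wpM2l ?divr_ge0//; apply: (@le_trans _ _ (B / r)).
    rewrite ler_pdivrMr ?exprn_gt0// (_ : B / r * r ^+ 2 = B * r); first exact: dB.
    by field; rewrite gt_eqF.
  by rewrite ler_wpM2l.
have c30 : 0 <= c3.
  rewrite /c3 addr_ge0 ?exprn_ge0 ?sqrtr_ge0// mulr_ge0 ?exprn_ge0//.
  rewrite -(gauss_mean_cst 0); apply: le_gauss_mean.
  - exact: gauss_int_cst.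
  - exact: gauss_int_cube.
  - by move=> y; rewrite exprn_ge0.
have t4 : c3 / r <= c3 / q by rewrite ler_wpM2l.
have -> : A / q = 4 * M / q + `|psi1 0| * D / q + `|psi2 0| / 2 * B / q + c3 / q.
  by rewrite /A !(mulrDl _ _ q^-1).
by lra.
Qed.

End CentralLimit.

(** * From test functions to distribution functions *)

Section NormalCdf.
Local Open Scope classical_set_scope.
Local Open Scope ring_scope.
Variable R : realType.
Local Notation E := (@shape_mean R).
Notation mu := (@lebesgue_measure R).

Lemma normal_law_cdf_gt0 (tau x : R) : 0 < tau ->
  law_cdf (normal_law 0 (tau ^+ 2)) x =
  fine (\int[mu]_w ((normal_pdf 0 tau w)%:E * (\1_(`]-oo, x]) w)%:E))%E.
Proof.
move=> tau0; rewrite /law_cdf /normal_law expf_eq0 /= gt_eqF//.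
rewrite sqrtr_sqr gtr0_norm//; congr fine.
transitivity (\int[mu]_(w in `]-oo, x]) (normal_pdf 0 tau w)%:E)%E; first by [].
rewrite [LHS]integral_mkcond; apply: eq_integral => w _.
by rewrite patchE indicE; case: ifP => _; rewrite ?mule1 ?mule0.
Qed.

Lemma normal_law_cdf0 (x : R) : law_cdf (normal_law 0 0) x = (0 <= x)%R%:R :> R.
Proof.
rewrite /law_cdf /normal_law eqxx.
transitivity (fine ((\1_(`]-oo, x]) (0 : R))%:E : \bar R)); first by [].
by rewrite /= indicE mem_setE in_itv.
Qed.

Let gsmooth_gt0 (tau : R) (psi : R -> R) : 0 < tau -> continuous psi -> (forall z, 0
  <= psi z) ->
  gsmooth tau psi 0 = fine (\int[mu]_w (psi w * normal_pdf 0 tau w)%:E)%E.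
Proof. by move=> tau0 cpsi psi0; rewrite gsmooth_density. Qed.

Let mass_le1 (tau : R) (f : R -> R) : measurable_fun setT f ->
  (forall w, 0 <= f w <= 1) ->
  (\int[mu]_w (f w * normal_pdf 0 tau w)%:E)%E \is a fin_num.
Proof.
move=> mf f01; apply: integrable_fin_num => //.
apply: (le_integrable _ _ _ (integrable_normal_pdf 0 tau)) => //.
  apply/measurable_EFinP; apply: measurable_funM => //.
  exact: measurable_normal_pdf.
move=> w _; rewrite /= lee_fin; have /andP[f0 f1] := f01 w.
rewrite !ger0_norm ?mulr_ge0 ?normal_pdf_ge0//.
by rewrite ler_piMl// normal_pdf_ge0.
Qed.

Let indic_pdf (tau x : R) :
  (\int[mu]_w ((normal_pdf 0 tau w)%:E * (\1_(`]-oo, x]) w)%:E))%E =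
  (\int[mu]_w (\1_(`]-oo, x]) w * normal_pdf 0 tau w)%:E)%E.
Proof. by apply: eq_integral => w _; rewrite -EFinM mulrC. Qed.

Let le_mass (tau : R) (f g : R -> R) : measurable_fun setT f -> measurable_fun setT g ->
  (forall w, 0 <= f w <= 1) -> (forall w, 0 <= g w <= 1) -> (forall w, f w <= g w) ->
  fine (\int[mu]_w (f w * normal_pdf 0 tau w)%:E)%E <=
  fine (\int[mu]_w (g w * normal_pdf 0 tau w)%:E)%E.
Proof.
move=> mf mg f01 g01 fg; apply: fine_le; [exact: mass_le1 | exact: mass_le1 |].
apply: ge0_le_integral => //.
- by move=> w _; have /andP[f0 _] := f01 w; rewrite lee_fin mulr_ge0 ?normal_pdf_ge0.
- by apply/measurable_EFinP; apply: measurable_funM => //; exact: measurable_normal_pdf.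
- by apply/measurable_EFinP; apply: measurable_funM => //; exact: measurable_normal_pdf.
- by move=> w _; rewrite lee_fin ler_wpM2r ?normal_pdf_ge0.
Qed.

(** For [tau = 0] the law is the point mass at 0 and [gsmooth] is evaluation there; otherwise [psi]
    is at most the indicator of []-oo, x]], integrated against the density. *)
Lemma gsmooth_le_cdf (tau x : R) (psi : R -> R) : 0 <= tau -> continuous psi ->
  (forall z, 0 <= psi z <= 1) -> (forall z, x <= z -> psi z = 0) ->
  gsmooth tau psi 0 <= law_cdf (normal_law 0 (tau ^+ 2)) x.
Proof.
rewrite le_eqVlt => /predU1P[<-|tau0] cpsi psi01 psix.
  rewrite expr0n normal_law_cdf0 gsmooth0.
  case: (leP 0 x) => x0; first by have /andP[] := psi01 0.
  by rewrite psix// ltW.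
rewrite gsmooth_gt0//; last by move=> z; have /andP[] := psi01 z.
rewrite normal_law_cdf_gt0// indic_pdf.
apply: le_mass => //; first exact: continuous_measurable_fun.
  by move=> w; rewrite indicE; case: (_ \in _); rewrite ?lexx ler01.
move=> w; rewrite indicE mem_setE in_itv /=; case: (leP w x) => wx;
  last by rewrite psix// ltW.
by have /andP[] := psi01 w.
Qed.

Lemma cdf_le_gsmooth (tau x : R) (psi : R -> R) : 0 <= tau -> continuous psi ->
  (forall z, 0 <= psi z <= 1) -> (forall z, z <= x -> psi z = 1) ->
  law_cdf (normal_law 0 (tau ^+ 2)) x <= gsmooth tau psi 0.
Proof.
rewrite le_eqVlt => /predU1P[<-|tau0] cpsi psi01 psix.
  rewrite expr0n normal_law_cdf0 gsmooth0.
  case: (leP 0 x) => x0; first by rewrite psix.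
  by have /andP[] := psi01 0.
rewrite gsmooth_gt0//; last by move=> z; have /andP[] := psi01 z.
rewrite normal_law_cdf_gt0// indic_pdf.
apply: le_mass => //; last first.
- move=> w; rewrite indicE mem_setE in_itv /=; case: (leP w x) => wx;
  first by rewrite psix.
  by have /andP[] := psi01 w.
- by move=> w; rewrite indicE; case: (_ \in _); rewrite ?lexx ler01.
- exact: continuous_measurable_fun.
Qed.

Lemma step_test_cdf (tau x d : R) : 0 <= tau -> 0 < d ->
  exists (lam : R) (psi psi1 psi2 : R -> R),
    [/\ 0 < lam, taylor3 (fun z => lam * psi z) psi1 psi2, forall z, 0 <= psi z <= 1,
       (forall z, z <= x -> psi z = 1) /\ (forall z, x + d <= z -> psi z = 0) &
       law_cdf (normal_law 0 (tau ^+ 2)) x <= gsmooth tau psi 0 <=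
       law_cdf (normal_law 0 (tau ^+ 2)) (x + d)].
Proof.
move=> tau0 d0; have [lam [psi [psi1 [psi2 [lam0 tay psi01 psi_1 psi_0]]]]] :=
  step_test x d0.
exists lam, psi, psi1, psi2; split=> //.
have cpsi : continuous psi.
  have [c _ _] := taylor3_continuous tay => y.
  have -> : psi = (fun z => lam^-1 * (lam * psi z)).
    by apply/funext => z; rewrite mulKf// gt_eqF.
  by apply: cvgM; [exact: cvg_cst | exact: c].
by rewrite cdf_le_gsmooth// gsmooth_le_cdf.
Qed.

(* The slack [D x] absorbs the bounded difference between the additive
   functional and the multiplicity, and the shift between [n] and [n + 1]. *)
Theorem additive_cdf_cvg (F : btree -> R) (C : R) :
  (forall l r, `|F (Node l r) - F l - F r| <= C) ->
  exists nu v : R, 0 <= v /\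
    forall (D : R -> R) (P : R -> nat -> R),
    (forall x n,
       E n (fun t => (F t - nu * n.+1%:R <= x * Num.sqrt n.+1%:R - D x)%R%:R) <= P x n
       <= E n (fun t => (F t - nu * n.+1%:R <= x * Num.sqrt n.+1%:R + D x)%R%:R)) ->
    forall x, {for x, continuous (law_cdf (normal_law 0 v))} ->
      P x n @[n --> \oo] --> law_cdf (normal_law 0 v) x.
Proof.
move=> FC; have [nu [tau [tau0 clt]]] := additive_clt FC.
exists nu, (tau ^+ 2); split; first exact: sqr_ge0.
move=> D P sandwich x cx; set cdf := law_cdf _ in cx *.
apply/cvgrPdist_le => e e0.
have [d d0 cdfd] : exists2 d, 0 < d & forall y, `|y - x| <= 2 * d -> `|cdf x - cdf y|
  <= e / 2.
  have e20 : 0 < e / 2 by lra.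
  have [d /= d0 hd] := (@cvgrPdist_le _ _ _ _ _ _ _).1 cx (e / 2) e20.
  exists (d / 4); first by lra.
  by move=> y yx; apply: hd; rewrite /= distrC; lra.
have big : \forall n \near \oo, `|D x| <= d * Num.sqrt (n.+1%:R : R).
  near=> n; rewrite mulrC -ler_pdivrMr//.
  have h : 0 <= `|D x| / d by rewrite divr_ge0// ltW.
  rewrite -[leLHS]ger0_norm// -sqrtr_sqr ler_sqrt ?ltr0n//.
  apply: (@le_trans _ _ n%:R); last by rewrite ler_nat.
  by near: n; apply: nbhs_infty_ger.
have limit y : exists2 psi : R -> R,
    [/\ forall z, 0 <= psi z <= 1, forall z, z <= y -> psi z = 1 &
       forall z, y + d <= z -> psi z = 0] &
    \forall n \near \oo, cdf y - e / 2 <= E n (fun t => psi ((F t - nu * n.+1%:R) /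
      Num.sqrt n.+1%:R))
        <= cdf (y + d) + e / 2.
  have [lam [psi [psi1 [psi2 [lam0 tay psi01 [psi_1 psi_0] /andP[lo hi]]]]]] :=
    step_test_cdf y tau0 d0.
  exists psi => //.
  have lpsi0 z : 0 <= lam * psi z by have /andP[h _] := psi01 z; rewrite mulr_ge0// ltW.
  have := clt _ _ _ tay lpsi0; rewrite -/(cdf) in lo hi *.
  have -> : gsmooth tau (fun z => lam * psi z) 0 = lam * gsmooth tau psi 0.
    rewrite /gsmooth -gauss_meanZ//; apply: (@gauss_int_bounded _ _ 1).
      have [c _ _] := taylor3_continuous tay.
      apply: (@measurableT_comp _ _ _ _ _ _ psi).
        have -> : psi = (fun z => lam^-1 * (lam * psi z)).
          by apply/funext => z; rewrite mulKf// gt_eqF.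
        by apply: measurable_funM => //; exact: continuous_measurable_fun.
      by apply: measurable_funD => //; exact: measurable_funM.
    by move=> z; have /andP[h1 h2] := psi01 (0 + tau * z); rewrite ger0_norm.
  move=> /cvgrPdist_le /(_ (lam * (e / 2))) => /(_ _)[]; first by rewrite mulr_gt0//; lra.
  move=> N _ hN; exists N => // n Nn; have := hN n Nn.
  rewrite shape_meanZ -mulrBr normrM gtr0_norm// ler_pM2l// ler_norml.
  by move=> /andP[h1 h2]; apply/andP; split; lra.
(* [psiu] equals 1 up to [x + d] and [psil] vanishes from [x - d] on: the margin [d] covers the
   slack [D x] divided by the square root of [n + 1]. *)
have [psiu [u01 u1 _] limu] := limit (x + d).
have [psil [l01 _ l0] liml] := limit (x - 2 * d).
near=> n.
have r0 : 0 < Num.sqrt (n.+1%:R : R) by rewrite sqrtr_gt0.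
have bign : `|D x| <= d * Num.sqrt (n.+1%:R : R) by near: n.
have Dn := ler_norm (D x).
have /andP[Plo Phi] := sandwich x n.
have /andP[_ hu] : cdf (x + d) - e / 2 <=
   E n (fun t => psiu ((F t - nu * n.+1%:R) / Num.sqrt n.+1%:R)) <= cdf (x + d + d) +
     e / 2.
  by near: n.
have /andP[hl _] : cdf (x - 2 * d) - e / 2 <=
   E n (fun t => psil ((F t - nu * n.+1%:R) / Num.sqrt n.+1%:R)) <= cdf (x - 2 * d +
     d) + e / 2.
  by near: n.
have up : P x n <= E n (fun t => psiu ((F t - nu * n.+1%:R) / Num.sqrt n.+1%:R)).
  apply: (le_trans Phi); apply: le_shape_mean => t _.
  case: (leP (F t - _) (_ + D x)) => h; last by have /andP[] := u01 ((F t - nu *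
    n.+1%:R) / Num.sqrt n.+1%:R).
  by rewrite u1// ler_pdivrMr//; lra.
have dn : E n (fun t => psil ((F t - nu * n.+1%:R) / Num.sqrt n.+1%:R)) <= P x n.
  apply: le_trans Plo; apply: le_shape_mean => t _.
  case: (leP (F t - _) (_ - D x)) => h; first by have /andP[] := l01 ((F t - nu *
    n.+1%:R) / Num.sqrt n.+1%:R).
  by rewrite l0// ler_pdivlMr//; lra.
have cu : `|cdf x - cdf (x + d + d)| <= e / 2.
  by apply: cdfd; rewrite ger0_norm; lra.
have cl : `|cdf x - cdf (x - 2 * d)| <= e / 2.
  by apply: cdfd; rewrite ler0_norm; lra.
move: cu cl; rewrite !ler_norml => /andP[c1 c2] /andP[c3 c4].
by apply/andP; split; lra.
Unshelve. all: by end_near.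
Qed.

End NormalCdf.

(** * Nullity of symmetric matrices *)

Lemma char_poly_intertwine (F : fieldType) n (P A B : 'M[F]_n) :
  P \in unitmx -> P *m A = B *m P -> char_poly A = char_poly B.
Proof.
move=> Pu PA; have detP : \det (map_mx polyC P) != 0.
  by rewrite det_map_mx polyC_eq0 -unitfE -unitmxE.
apply: (mulfI detP); rewrite /char_poly -det_mulmx [RHS]mulrC -det_mulmx.
congr (\det _); rewrite /char_poly_mx mulmxBr mulmxBl -!map_mxM PA.
by rewrite -scalar_mxC.
Qed.

Lemma char_poly_split (F : fieldType) g r n (A : 'M[F]_n) (C : 'M[F]_r)
    (K : 'M[F]_(g, n)) (W : 'M[F]_(r, n)) (alpha : F) :
  (g + r = n)%N -> row_free (col_mx K W) -> K *m A = alpha *: K -> W *m A = C *m W ->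
  char_poly A = ('X - alpha%:P) ^+ g * char_poly C.
Proof.
move=> gr; case: n / gr A K W => A K W free KA WA.
rewrite (@char_poly_intertwine _ _ (col_mx K W) A (block_mx alpha%:M 0 0 C)).
- rewrite /char_poly char_block_diag_mx det_ublock; congr (_ * _).
  rewrite /char_poly_mx (_ : map_mx _ _ = (alpha%:P)%:M); last by rewrite map_scalar_mx.
  by rewrite -raddfB det_scalar.
- by rewrite -row_free_unit.
- by rewrite mul_col_mx mul_block_col !mul0mx addr0 add0r mul_scalar_mx KA WA.
Qed.

Lemma mulmx_tr_eq0 (F : realFieldType) n (v : 'rV[F]_n) : v *m v^T = 0 -> v = 0.
Proof.
move=> /matrixP /(_ 0 0); rewrite !mxE => /eqP.
rewrite psumr_eq0 => [/allP v0|i _]; last by rewrite mxE -expr2 sqr_ge0.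
apply/rowP => i; rewrite mxE; have := v0 i (mem_index_enum i).
by rewrite mxE mulf_eq0 orbb => /eqP.
Qed.

(** The row space and the kernel of a symmetric matrix are orthogonal, and over an ordered field a
    vector orthogonal to itself is 0. *)
Lemma symmetric_rowker0 (F : realFieldType) n (B : 'M[F]_n) (v : 'rV_n) :
  B^T = B -> (v <= B)%MS -> v *m B = 0 -> v = 0.
Proof.
move=> symB /submxP[u ->] uBB; apply: mulmx_tr_eq0.
by rewrite trmx_mul symB mulmxA uBB mul0mx.
Qed.

(** The kernel and the row space of [B] meet in 0 and their dimensions add up to [n], so [A] splits
    into [alpha] on the kernel and a block [C] on the row space. An eigenvector of [C] for [alpha]
    would lie in both, so [C] contributes no further root [alpha]. *)
Lemma mup_symmetric (F : realFieldType) n (A : 'M[F]_n) (alpha : F) :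
  A^T = A -> mup alpha (char_poly A) = (n - \rank (A - alpha%:M)%R)%N.
Proof.
move=> symA; set B := A - alpha%:M.
have symB : B^T = B by rewrite /B linearB /= tr_scalar_mx symA.
have AE : A = B + alpha%:M by rewrite /B subrK.
pose K := row_base (kermx B); pose W := row_base B.
have KB : K *m B = 0 by apply/sub_kermxP; rewrite eq_row_base.
have KA : K *m A = alpha *: K by rewrite AE mulmxDr KB add0r mul_mx_scalar.
have stabW : (W *m A <= W)%MS.
  rewrite !eq_row_base AE mulmxDr mul_mx_scalar addmx_sub ?submxMl//.
  by rewrite scalemx_sub// eq_row_base.
have WA := mulmxKpV stabW; set C := W *m A *m pinvmx W in WA.
have dims : (\rank (kermx B) + \rank B = n)%N by rewrite mxrank_ker subnK// rank_leq_row.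
have cap0 : (K :&: W)%MS = 0.
  apply/eqP/rowV0P => v; rewrite sub_capmx => /andP[].
  by rewrite !eq_row_base => /sub_kermxP vB0 vB; apply: symmetric_rowker0 vB0.
have free : row_free (col_mx K W).
  rewrite /row_free -addsmxE mxrank_disjoint_sum//.
  by rewrite !eq_row_base.
rewrite (char_poly_split dims free KA (esym WA)) mupMl.
  by rewrite mup_XsubCX eqxx -mxrank_ker.
rewrite -eigenvalue_root_char; apply/eigenvalueP => -[v vC v0].
have WB : W *m B = C *m W - alpha *: W.
  by rewrite /B mulmxBr -WA mul_mx_scalar.
have vWB : v *m W *m B = 0.
  by rewrite -mulmxA WB mulmxBr mulmxA vC -scalemxAl -scalemxAr subrr.
have vW0 : v *m W = 0.
  apply: symmetric_rowker0 vWB => //.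
  by apply: submx_trans (submxMl _ _) _; rewrite eq_row_base.
case/eqP: v0; apply: (row_free_inj (row_base_free B)).
by rewrite vW0 mul0mx.
Qed.

(** * Rank under perturbations and embeddings *)

Section RankPerturbation.
Variable F : fieldType.

Lemma mxrank_outer n (u v : 'rV[F]_n) : (\rank (u^T *m v) <= 1)%N.
Proof. by rewrite (leq_trans (mxrankM_maxl _ _))// mxrank_tr rank_leq_row. Qed.

Lemma mxrank_diff n (A B : 'M[F]_n) k : (\rank (A - B)%R <= k)%N ->
  (\rank A <= \rank B + k)%N /\ (\rank B <= \rank A + k)%N.
Proof.
move=> h; split.
  rewrite -[A in X in (X <= _)%N](subrKC B) (leq_trans (mxrank_add _ _))//.
  by rewrite leq_add2l.
rewrite -[B in X in (X <= _)%N](subKr A) (leq_trans (mxrank_add _ _))//.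
by rewrite mxrank_opp leq_add2l.
Qed.

(** [P] and [Q] act as projections to disjoint sets of coordinates; multiplying [A + B] by them
    recovers [A] and [B], whose row spaces are independent. *)
Lemma mxrank_disjoint_support n (A B P Q : 'M[F]_n) :
  P *m Q = 0 -> Q *m P = 0 -> P *m A = A -> A *m P = A -> Q *m B = B -> B *m Q = B ->
  \rank (A + B)%R = (\rank A + \rank B)%N.
Proof.
move=> PQ QP PA AP QB BQ; apply/eqP; rewrite eqn_leq mxrank_add /=.
rewrite -mxrank_disjoint_sum; last first.
  apply/eqP/rowV0P => v; rewrite sub_capmx => /andP[/submxP[a va] /submxP[b vb]].
  have vP : v *m P = v by rewrite va -mulmxA AP.
  have vQ : v *m Q = v by rewrite vb -mulmxA BQ.
  by rewrite -vP -vQ -mulmxA QP mulmx0.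
apply: mxrankS; rewrite addsmx_sub; apply/andP; split.
  apply/submxP; exists P; rewrite mulmxDr PA -[B]QB mulmxA PQ mul0mx addr0 //.
apply/submxP; exists Q; rewrite mulmxDr QB -[A]PA mulmxA QP mul0mx add0r //.
Qed.

Lemma mxrank_isometry m n (J : 'M[F]_(m, n)) (A : 'M[F]_m) :
  J *m J^T = 1%:M -> \rank (J^T *m A *m J) = \rank A.
Proof.
move=> JJ; have free : row_free J by apply/row_freeP; exists J^T.
rewrite mxrankMfree// -mxrank_tr trmx_mul trmxK mxrankMfree//.
by rewrite mxrank_tr.
Qed.

End RankPerturbation.

(** * Labelled trees and their matrices *)

Inductive ltree := LLeaf | LNode of ltree & nat & ltree.

Fixpoint erase (t : ltree) : btree :=
  if t is LNode l _ r then Node (erase l) (erase r) else Leaf.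

Fixpoint labels (t : ltree) : seq nat :=
  if t is LNode l v r then v :: labels l ++ labels r else [::].

Fixpoint relabel (f : nat -> nat) (t : ltree) : ltree :=
  if t is LNode l v r then LNode (relabel f l) (f v) (relabel f r) else LLeaf.

(** The reference labelling, of which every other one is a renaming. *)
Fixpoint preorder (k : nat) (t : btree) : ltree :=
  if t is Node l r then
    LNode (preorder k.+1 l) k (preorder (k.+1 + nodes l) r)
  else LLeaf.

Lemma size_labels t : size (labels t) = nodes (erase t).
Proof. by elim: t => //= l IHl v r IHr; rewrite size_cat IHl IHr. Qed.

Lemma erase_preorder k t : erase (preorder k t) = t.
Proof. by elim: t k => //= l IHl r IHr k; rewrite IHl IHr. Qed.

Lemma labels_preorder k t : labels (preorder k t) = iota k (nodes t).
Proof. by elim: t k => //= l IHl r IHr k; rewrite IHl IHr -iotaD. Qed.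

Lemma relabel_preorder f k t : [seq f i | i <- iota k (nodes (erase t))] = labels t ->
  t = relabel f (preorder k (erase t)).
Proof.
elim: t k => //= l IHl v r IHr k [-> /eqP].
rewrite iotaD map_cat eqseq_cat ?size_map ?size_iota ?size_labels//.
by move=> /andP[/eqP fl /eqP fr]; rewrite -IHl// -IHr.
Qed.

(* A vacant position for a node: below the vertex [u], on the side [s] when
   [Some (u, s)], or at the root when [None]. *)
Definition slot := option (nat * bool).

(* [rc = true] reads a binary tree as a recursive tree through the left-child
   right-sibling correspondence: a node, its right child, the right child of that
   and so on are attached to the same vertex.  [rc = false] reads it as a binary
   tree. *)
Section Attachments.
Variable rc : bool.

Definition lslot (v : nat) : slot := Some (v, false).
Definition rslot (c : slot) (v : nat) : slot := if rc then c else Some (v, true).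

Fixpoint attach (c : slot) (t : ltree) : seq (slot * nat) :=
  if t is LNode l v r then
    (c, v) :: attach (lslot v) l ++ attach (rslot c v) r
  else [::].

Definition slot_label (c : slot) : seq nat := if c is Some (u, _) then [:: u] else [::].

Lemma labels_attach c t : [seq p.2 | p <- attach c t] = labels t.
Proof. by elim: t c => //= l IHl v r IHr c; rewrite map_cat IHl IHr. Qed.

Lemma attach_slot_label c t p : p \in attach c t ->
  {subset slot_label p.1 <= slot_label c ++ labels t}.
Proof.
elim: t c => //= l IHl v r IHr c.
rewrite inE mem_cat => /or3P[/eqP ->|/IHl sub|/IHr sub] u /=.
- by rewrite mem_cat => ->.
- by move=> /sub; rewrite /= !inE !mem_cat !inE !mem_cat => /orP[->|->]; rewrite ?orbT.
- move=> /sub; rewrite !mem_cat /rslot !inE mem_cat.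
  by case: (rc) => /= /orP[uc|->]; rewrite ?orbT// ?uc//; move: uc; rewrite inE => ->;
    rewrite ?orbT.
Qed.

End Attachments.

(** * Shifted Laplacians as sums over attachments *)

Section TreeMatrix.
Variables (F : fieldType) (alpha : F).

Definition evec n (v : nat) : 'rV[F]_n := \row_j (v == j)%:R.

(** The share of an edge in a Laplacian; a vertex without parent contributes 0. *)
Definition edge_mx n (c : slot) (v : nat) : 'M[F]_n :=
  if c is Some (u, _) then (evec n u - evec n v)^T *m (evec n u - evec n v) else 0.

Definition loop_mx n (v : nat) : 'M[F]_n := alpha *: ((evec n v)^T *m evec n v).

(** The Laplacian minus [alpha], the scalar matrix being distributed over the attached vertices. The
    vertex 0 of a recursive tree is attached nowhere and gets no share. *)
Definition attach_mx n (s : seq (slot * nat)) : 'M[F]_n :=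
  \sum_(p <- s) (edge_mx n p.1 p.2 - loop_mx n p.2).

Lemma attach_mx_cons n p s :
  attach_mx n (p :: s) = edge_mx n p.1 p.2 - loop_mx n p.2 + attach_mx n s.
Proof. by rewrite /attach_mx big_cons. Qed.

Lemma attach_mx_cat n s s' : attach_mx n (s ++ s') = attach_mx n s + attach_mx n s'.
Proof. by rewrite /attach_mx big_cat. Qed.

Lemma rank_edge_mx n c v : (\rank (edge_mx n c v) <= 1)%N.
Proof. by case: c => [[u s]|]; rewrite ?mxrank0// mxrank_outer. Qed.

Lemma rank_loop_mx n v : (\rank (loop_mx n v) <= 1)%N.
Proof. by rewrite (leq_trans (mxrank_scale _ _))// mxrank_outer. Qed.

Definition support_mx n (s : seq nat) : 'M[F]_n := diag_mx (\row_j ((val j) \in s)%:R).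

Lemma support_mx_disjoint n s s' : (forall v, v \in s -> v \notin s') ->
  support_mx n s *m support_mx n s' = 0.
Proof.
move=> dis; apply/matrixP => i j; rewrite mul_diag_mx !mxE.
case: eqP => [->|_]; last by rewrite mulr0n mulr0.
by case: (boolP (val j \in s)) => [/dis/negbTE ->|_]; rewrite ?mul0r ?mulr0n ?mulr0.
Qed.

Lemma evec_support n s v : v \in s -> evec n v *m support_mx n s = evec n v.
Proof.
move=> vs; apply/rowP => j; rewrite mul_mx_diag !mxE.
by case: eqP => [vj|_]; rewrite ?mul0r// -[val j]/(nat_of_ord j) -vj vs mulr1.
Qed.

Lemma outer_support n s (x : 'rV[F]_n) : x *m support_mx n s = x ->
  support_mx n s *m (x^T *m x) = x^T *m x /\ x^T *m x *m support_mx n s = x^T *m x.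
Proof.
move=> xs; rewrite -[x^T *m x *m _]mulmxA xs; split=> //.
rewrite mulmxA; congr (_ *m _); rewrite -{1}[support_mx n s]trmxK -trmx_mul.
by rewrite tr_diag_mx xs.
Qed.

Lemma attach_mx_support n s a :
  (forall p, p \in a -> p.2 \in s /\ {subset slot_label p.1 <= s}) ->
  support_mx n s *m attach_mx n a = attach_mx n a /\
  attach_mx n a *m support_mx n s = attach_mx n a.
Proof.
elim: a => [_|[c v] a IH as_]; first by rewrite /attach_mx big_nil mulmx0 mul0mx.
have [|IH1 IH2] := IH; first by move=> p pa; apply: as_; rewrite inE pa orbT.
have [/= vs cs] := as_ (c, v) (mem_head _ _).
have [l1 l2] := outer_support (evec_support n vs).
have [e1 e2] : support_mx n s *m edge_mx n c v = edge_mx n c v /\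
    edge_mx n c v *m support_mx n s = edge_mx n c v.
  case: c cs {as_} => [[u b] cs|_]; last by rewrite /= mulmx0 mul0mx.
  apply: outer_support; rewrite mulmxBl evec_support ?evec_support// cs//.
  exact: mem_head.
rewrite attach_mx_cons /= /loop_mx; split.
  by rewrite mulmxDr mulmxBr -scalemxAr IH1 e1 l1.
by rewrite mulmxDl mulmxBl -scalemxAl IH2 e2 l2.
Qed.

Definition relabel_slot (f : nat -> nat) (c : slot) : slot :=
  omap (fun p => (f p.1, p.2)) c.

Lemma attach_relabel rc f c t :
  attach rc (relabel_slot f c) (relabel f t) =
  [seq (relabel_slot f p.1, f p.2) | p <- attach rc c t].
Proof.
elim: t c => //= l IHl v r IHr c; rewrite map_cat -IHl -IHr.
by congr (_ :: (_ ++ attach _ _ _)); rewrite /rslot; case: (rc).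
Qed.

Lemma attach_mx_relabel n n0 (f : nat -> nat) (J := \matrix_(i < n0) evec n (f i)) a :
  (forall p, p \in a -> all (fun u => u < n0)%N (p.2 :: slot_label p.1)) ->
  attach_mx n [seq (relabel_slot f p.1, f p.2) | p <- a] =
  J^T *m attach_mx n0 a *m J.
Proof.
have eJ v : (v < n0)%N -> evec n0 v *m J = evec n (f v).
  move=> vn; apply/rowP => j; rewrite !mxE (bigD1 (Ordinal vn))//= big1 => [|i iv].
    by rewrite !mxE eqxx mul1r addr0.
  rewrite !mxE; case: eqP => [vi|_]; last by rewrite mul0r.
  by case/eqP: iv; apply: val_inj.
elim: a => [_|[c v] a IH as_]; first by rewrite /attach_mx !big_nil mulmx0 mul0mx.
rewrite map_cons !attach_mx_cons /= mulmxDr mulmxDl -IH; last first.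
  by move=> p pa; apply: as_; rewrite inE pa orbT.
congr (_ + _); have /= /andP[vn cn] := as_ (c, v) (mem_head _ _).
rewrite mulmxBr mulmxBl; congr (_ - _).
  case: c cn {as_} => [[u b] /= /andP[un _]|_]; last by rewrite /= mulmx0 mul0mx.
  by rewrite /= -(eJ u un) -(eJ v vn) -mulmxBl trmx_mul !mulmxA.
by rewrite /loop_mx -scalemxAr -scalemxAl -eJ// trmx_mul !mulmxA.
Qed.

Section Model.
Variable rc : bool.

(** For a recursive tree the nodes of the binary tree are the vertices from 1 on, the first of them
    hanging below 0; hence the offset [rc] in labels and matrix sizes. *)
Definition start_slot : slot := if rc then Some (0%N, false) else None.

Definition tree_rank (t : btree) : nat :=
  \rank (attach_mx (rc + nodes t) (attach rc start_slot (preorder rc t))).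

(** Makes the rank a function of the shape: conjugation by [J], whose orthonormal rows are the unit
    vectors of the labels in preorder, carries the reference matrix to any injective labelling
    within any large enough size. *)
Lemma rank_attach_mx n c t : isSome c = rc ->
  uniq (slot_label c ++ labels t) ->
  all (fun u => u < n)%N (slot_label c ++ labels t) ->
  \rank (attach_mx n (attach rc c t)) = tree_rank (erase t).
Proof.
move=> crc; set s := _ ++ _ => us sn.
pose f := nth 0%N s; set n0 := (rc + nodes (erase t))%N.
have sz : size s = n0.
  by rewrite size_cat size_labels /n0 -crc; congr (_ + _)%N; case: (c) => [[]|].
have fl : [seq f i | i <- iota rc (nodes (erase t))] = labels t.
  have -> : labels t = drop rc s by rewrite -crc /s; case: (c) => [[]|] /= *;
    rewrite ?drop0.
  apply: (@eq_from_nth _ 0%N).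
    by rewrite size_map size_iota size_drop sz /n0 addKn.
  move=> i; rewrite size_map size_iota => i_lt.
  by rewrite (nth_map 0%N) ?size_iota// nth_iota// nth_drop.
have tE := relabel_preorder fl.
have [b cE] : exists b, c = relabel_slot f (if rc then Some (0%N, b) else None).
  move: crc; rewrite /f /s; case: (c) => [[u b]|] <- /=; last by exists false.
  by exists b.
(* Under [rc = true] only the parent in the slot matters, as [edge_mx] ignores the side. *)
have slot_b k u : attach_mx k (attach rc (if rc then Some (0%N, b) else None) u) =
    attach_mx k (attach rc start_slot u).
  rewrite /start_slot; case: rc => //; elim: u => //= l IHl v r IHr.
  by rewrite !attach_mx_cons !attach_mx_cat /= IHr.
rewrite cE {1}tE attach_relabel (@attach_mx_relabel n n0 f).
  rewrite slot_b /tree_rank mxrank_isometry//.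
  apply/matrixP => i j.
  have fin : (f i < n)%N by move: sn => /allP; apply; rewrite mem_nth// sz.
  rewrite !mxE (bigD1 (Ordinal fin))//= big1 => [|k ki]; rewrite !mxE ?eqxx ?mul1r ?addr0.
    by rewrite /f nth_uniq ?sz// eq_sym.
  case: eqP => [fk|_]; last by rewrite mul0r.
  by case/eqP: ki; apply: val_inj.
move=> p pa; have sub := attach_slot_label pa.
have lab u : u \in slot_label (if rc then Some (0%N, b) else None) ++
    labels (preorder rc (erase t)) -> (u < n0)%N.
  rewrite mem_cat labels_preorder mem_iota => /orP[|/andP[] //].
  by rewrite /n0; case: (rc) => //=; rewrite inE => /eqP ->.
rewrite /= lab; last by rewrite mem_cat -(labels_attach rc (if rc then Some (0%N, b)
  else None)) map_f ?orbT.
by apply/allP => u up; apply: lab; apply: sub.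
Qed.

End Model.

Lemma attach_mx_root_slot n c t :
  (\rank (attach_mx n (attach false c t) - attach_mx n (attach false None t))%R <= 1)%N.
Proof.
case: t => [|l v r] /=; first by rewrite subrr mxrank0.
rewrite !attach_mx_cons /= opprD addrACA subrr addr0 sub0r opprK subrK.
exact: rank_edge_mx.
Qed.

(** Four matrices of rank at most 1 are removed: the edge and the loop of the root node [v] and, for
    [rc = false], the edges to its two children. What is left splits over disjoint supports; for
    [rc = true] these are [v] with its descendants, and 0 with the remaining vertices. *)
Lemma tree_rank_Node rc l r (s := (tree_rank rc l + tree_rank rc r)%N) :
  (tree_rank rc (Node l r) <= s + 4)%N /\ (s <= tree_rank rc (Node l r) + 4)%N.
Proof.
pose n := (rc + nodes (Node l r))%N; pose v : nat := rc.
pose tl := preorder v.+1 l; pose tr := preorder (v.+1 + nodes l) r.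
pose cl := if rc then lslot v else None; pose cr := start_slot rc.
pose Ml := attach_mx n (attach rc cl tl); pose Mr := attach_mx n (attach rc cr tr).
have labl : labels tl = iota v.+1 (nodes l) by rewrite labels_preorder.
have labr : labels tr = iota (v.+1 + nodes l) (nodes r) by rewrite labels_preorder.
have nE : n = (v.+1 + nodes l + nodes r)%N by rewrite /n /v /= addnS addSn addSn addnA.
have cll u : u \in slot_label cl ++ labels tl -> (u < v.+1 + nodes l)%N && (rc <= u)%N.
  rewrite mem_cat labl mem_iota => /orP[|/andP[h1 h2]].
    by rewrite /cl /v; case: (rc) => //=; rewrite inE => /eqP ->.
  by rewrite h2 (leq_trans _ h1).
have crl u : u \in slot_label cr ++ labels tr ->
    (u < n)%N && ((v.+1 + nodes l <= u)%N || (u < rc)%N).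
  rewrite mem_cat labr mem_iota nE => /orP[|/andP[h1 h2]]; last by rewrite h1 h2.
  by rewrite /cr /start_slot /v; case: (rc) => //=; rewrite inE => /eqP ->.
have rl : \rank Ml = tree_rank rc l.
  rewrite -[l in RHS](erase_preorder v.+1); apply: rank_attach_mx.
  - by rewrite /cl; case: (rc).
  - by rewrite -/tl labl /cl /v; case: (rc) => /=; rewrite ?mem_iota ?ltnn ?iota_uniq.
  - by apply/allP => u /cll /andP[h _]; rewrite nE (leq_trans h)// leq_addr.
have rr : \rank Mr = tree_rank rc r.
  rewrite -[r in RHS](erase_preorder (v.+1 + nodes l)); apply: rank_attach_mx.
  - by rewrite /cr /start_slot; case: (rc).
  - by rewrite -/tr labr /cr /start_slot /v; case: (rc) => /=;
    rewrite ?mem_iota ?iota_uniq.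
  - by apply/allP => u /crl /andP[].
have sup (c : slot) (t : ltree) : forall p, p \in attach rc c t ->
    p.2 \in slot_label c ++ labels t /\ {subset slot_label p.1 <= slot_label c ++
      labels t}.
  move=> p pa; split; last exact: attach_slot_label pa.
  by rewrite mem_cat -(labels_attach rc c) map_f ?orbT.
have dis u : u \in slot_label cl ++ labels tl -> u \notin slot_label cr ++ labels tr.
  move=> /cll /andP[h1 h2]; apply/negP => /crl /andP[_ /orP[]].
    by rewrite leqNgt h1.
  by rewrite ltnNge h2.
have rlr : \rank (Ml + Mr)%R = s.
  have [al ar] := @attach_mx_support n _ _ (sup cl tl).
  have [bl br] := @attach_mx_support n _ _ (sup cr tr).
  rewrite /s -rl -rr.
  apply: mxrank_disjoint_support al ar bl br; apply: support_mx_disjoint => // u ur.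
  by apply/negP => /dis; rewrite ur.
have dl : (\rank (attach_mx n (attach rc (lslot v) tl) - Ml)%R <= 1)%N.
  rewrite /Ml /cl; case: (rc); first by rewrite subrr mxrank0.
  exact: attach_mx_root_slot.
have dr : (\rank (attach_mx n (attach rc (rslot rc cr v) tr) - Mr)%R <= 1)%N.
  rewrite /Mr /cr /rslot /start_slot; case: (rc); first by rewrite subrr mxrank0.
  exact: attach_mx_root_slot.
rewrite -rlr /tree_rank -/n.
apply: mxrank_diff; rewrite /= attach_mx_cons attach_mx_cat /= opprD.
rewrite -/v -/tl -/tr -/cr.
rewrite [X in \rank X](_ : _ = edge_mx n cr v - loop_mx n v +
   ((attach_mx n (attach rc (lslot v) tl) - Ml) +
    (attach_mx n (attach rc (rslot rc cr v) tr) - Mr))); last by rewrite -[LHS]addrA;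
      congr (_ + _); rewrite addrACA.
rewrite (leq_trans (mxrank_add _ _))// -[4%N]/(2 + 2)%N leq_add//.
  rewrite (leq_trans (mxrank_add _ _))// -[2%N]/(1 + 1)%N leq_add ?rank_edge_mx//.
  by rewrite mxrank_opp rank_loop_mx.
by rewrite (leq_trans (mxrank_add _ _))// -[2%N]/(1 + 1)%N leq_add.
Qed.

End TreeMatrix.

(** * Attachment histories *)

HB.instance Definition _ := gen_eqMixin ltree.

Section Histories.
Local Open Scope nat_scope.
Variable rc : bool.

Fixpoint vacant (c : slot) (t : ltree) : seq slot :=
  if t is LNode l v r then vacant (lslot v) l ++ vacant (rslot rc c v) r else [:: c].

Fixpoint insertions (v : nat) (c : slot) (t : ltree) : seq (slot * ltree) :=
  if t is LNode l u r then
    [seq (p.1, LNode p.2 u r) | p <- insertions v (lslot u) l] ++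
    [seq (p.1, LNode l u p.2) | p <- insertions v (rslot rc c u) r]
  else [:: (c, LNode LLeaf v LLeaf)].

Lemma insertions_vacant v c t : [seq p.1 | p <- insertions v c t] = vacant c t.
Proof.
elim: t c => //= l IHl u r IHr c; rewrite map_cat -!map_comp.
by rewrite (eq_map (_ : _ =1 fst))// IHl (eq_map (_ : _ =1 fst))// IHr.
Qed.

Lemma erase_insertions v c t : [seq erase p.2 | p <- insertions v c t] = grow (erase t).
Proof.
elim: t c => //= l IHl u r IHr c; rewrite map_cat -!map_comp -(IHl (lslot u)) -(IHr
  (rslot rc c u)).
by rewrite -!map_comp.
Qed.

(** Filling a slot opens [lslot v] and [rslot rc p.1 v]. For a recursive tree the latter is the
    filled slot itself, so no slot is ever used up. *)
Definition insertion_spec v c t (p : slot * ltree) :=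
  perm_eq (attach rc c p.2) ((p.1, v) :: attach rc c t) &&
  perm_eq (p.1 :: vacant c p.2) [:: lslot v, rslot rc p.1 v & vacant c t].

Lemma insertionsP v c t : all (insertion_spec v c t) (insertions v c t).
Proof.
elim: t c => [|l IHl u r IHr] c /=.
  rewrite andbT /insertion_spec /= perm_refl /=.
  by apply/permP => a /=; lia.
rewrite all_cat !all_map; apply/andP; split.
  apply: sub_all (IHl (lslot u)) => -[x t'] /andP[/= /permP pa /permP pv].
  apply/andP; split; apply/permP => a /=.
    by have := pa a; rewrite /= !count_cat; lia.
  by have := pv a; rewrite /= !count_cat; lia.
apply: sub_all (IHr (rslot rc c u)) => -[x t'] /andP[/= /permP pa /permP pv].
apply/andP; split; apply/permP => a /=.
  by have := pa a; rewrite /= !count_cat; lia.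
by have := pv a; rewrite /= !count_cat; lia.
Qed.

(* Pairs of an attachment history and the tree it builds, the [i]-th attached
   node being labelled [rc + i]. *)
Fixpoint histories (n : nat) : seq (seq slot * ltree) :=
  if n is n'.+1 then
    flatten [seq [seq (rcons h.1 p.1, p.2) | p <- insertions (rc + n') (start_slot rc)
      h.2]
            | h <- histories n']
  else [:: ([::], LLeaf)].

(** Depends on the history alone, so that legality of a history can be tested without building its
    tree. *)
Definition next_slots (h : seq slot) : seq slot :=
  if rc then [seq Some (u, false) | u <- iota 0 (size h).+1]
  else [seq x <- None :: flatten [seq [:: Some (u, false);
    Some (u, true)] | u <- iota 0 (size h)]
       | x \notin h].

Definition history_spec n (p : seq slot * ltree) :=
  [&& size p.1 == n, perm_eq (attach rc (start_slot rc) p.2) (zip p.1 (iota rc n)) &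
   perm_eq (vacant (start_slot rc) p.2 ++ (if rc then [::] else p.1))
     (if rc then [seq Some (u, false) | u <- iota 0 n.+1]
      else None :: flatten [seq [:: Some (u, false); Some (u, true)] | u <- iota 0 n])].

Lemma historiesP n : all (history_spec n) (histories n).
Proof.
elim: n => [|n IH] /=.
  rewrite andbT /history_spec /= /start_slot; case: (rc) => //=.
apply/allP => _ /flattenP[_ /mapP[[h t] ht ->] /mapP[[x t'] pt ->]].
have /and3P[] := allP IH _ ht.
rewrite -[(h, t).1]/h -[(h, t).2]/t => /eqP sz pa pv.
have /andP[/= pa' pv'] := allP (insertionsP _ _ _) _ pt.
have iotaS k m : iota k m.+1 = rcons (iota k m) (k + m).
  by rewrite -addn1 iotaD cats1.
apply/and3P; rewrite -[_.1]/(rcons h x) -[_.2]/t'; split.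
- by rewrite size_rcons sz.
- rewrite iotaS -!cats1 zip_cat ?size_iota//.
  apply/permP => a; have := permP pa a; have := permP pa' a.
  by rewrite count_cat /= => -> ->; lia.
- apply/permP => a; move: (permP pv a) (permP pv' a).
  rewrite /start_slot /rslot /lslot; case: (rc).
    rewrite !cats0 (iotaS 0 n.+1) map_rcons -cats1 count_cat -[(true + n)%N]/n.+1 -[(0
      + n.+1)%N]/n.+1 /= => <-.
    lia.
  rewrite (iotaS 0 n) map_rcons flatten_rcons -!cats1 /= !count_cat /= !add0n.
  lia.
Qed.

Lemma next_slotsP n h t : history_spec n (h, t) ->
  vacant (start_slot rc) t =i next_slots h /\ uniq (vacant (start_slot rc) t).
Proof.
have uniqB : uniq (None :: flatten [seq [:: Some (u, false);
  Some (u, true)] | u <- iota 0 n] : seq slot).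
  rewrite /= ; apply/andP; split.
    by apply/negP => /flattenP[s /mapP[u _ ->]]; rewrite !inE.
  elim: (iota 0 n) (iota_uniq 0 n) => //= u s IH /andP[us /IH ->].
  rewrite andbT !inE /= !negb_or /=.
  have notin b : Some (u, b) \notin flatten [seq [:: Some (u0, false);
    Some (u0, true)] | u0 <- s].
    apply/negP => /flattenP[s' /mapP[w ws ->]]; rewrite !inE => /orP[] /eqP[wu _];
    by move: us; rewrite wu ws.
  by rewrite !notin !andbT; apply/eqP => -[].
case/and3P; rewrite -[(h, t).1]/h -[(h, t).2]/t => /eqP sz _.
rewrite /next_slots sz; case: (rc) => pv.
  rewrite cats0 in pv; split; first exact: perm_mem pv.
  by rewrite (perm_uniq pv) map_inj_uniq ?iota_uniq// => u w [].
have := perm_uniq pv; rewrite uniqB cat_uniq => /and3P[uv dis uh]; split=> // x.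
rewrite mem_filter -(perm_mem pv) mem_cat.
case: (boolP (x \in h)) => xh /=; rewrite ?orbF//.
by apply/negP => xv; move/hasP: dis; apply; exists x.
Qed.

Definition legal (h : seq slot) :=
  [forall i : 'I_(size h), nth None h i \in next_slots (take i h)].

Lemma legal_rcons h x : legal (rcons h x) = legal h && (x \in next_slots h).
Proof.
apply/forallP/andP => [legal_hx|[/forallP legal_h xh]].
  split; last first.
    have lt : (size h < size (rcons h x))%N by rewrite size_rcons.
    have := legal_hx (Ordinal lt).
    by rewrite /= nth_rcons ltnn eqxx -cats1 take_size_cat.
  apply/forallP => i.
  have lt : (i < size (rcons h x))%N by rewrite size_rcons ltnW// ltnS.
  have := legal_hx (Ordinal lt).
  by rewrite /= nth_rcons ltn_ord -cats1 takel_cat// ltnW.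
move=> i; have := ltn_ord i; rewrite [X in (_ < X)%N]size_rcons ltnS leq_eqVlt.
move: (i : nat) => {}i; case: (eqVneq i (size h)) => [-> _|_ /= lt].
  by rewrite nth_rcons ltnn eqxx -cats1 take_size_cat.
rewrite nth_rcons lt -cats1 takel_cat; last exact: ltnW.
exact: (legal_h (Ordinal lt)).
Qed.

Lemma mem_histories n h :
  (h \in [seq p.1 | p <- histories n]) = (size h == n) && legal h.
Proof.
elim: n h => [|n IH] h /=.
  rewrite inE; case: h => [|x h]//=.
  by apply/esym/forallP => -[].
have spec h0 t : (h0, t) \in histories n -> history_spec n (h0, t).
  exact: (allP (historiesP n)).
apply/idP/idP.
  move=> /mapP[_ /flattenP[_ /mapP[[h0 t] ht ->] /mapP[p pt ->]] ->] /=.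
  have /andP[/eqP sz lh] : (size h0 == n) && legal h0.
    by rewrite -IH; apply/mapP; exists (h0, t).
  rewrite size_rcons sz eqxx legal_rcons lh /=.
  have [<- _] := next_slotsP (spec _ _ ht).
  by rewrite -(insertions_vacant (rc + n)) map_f.
case: (lastP h) => [//|h0 x]; rewrite size_rcons eqSS legal_rcons => /and3P[sz lh xh].
have /mapP[[h1 t] ht /= h1E] : h0 \in [seq p.1 | p <- histories n] by rewrite IH sz.
rewrite -h1E in ht.
have [sl _] := next_slotsP (spec _ _ ht).
move: xh; rewrite -sl -(insertions_vacant (rc + n)) => /mapP[p pt xE].
apply/mapP; exists (rcons h0 p.1, p.2); last by rewrite xE.
apply/flattenP; eexists; first by apply: map_f; exact: ht.
by apply: map_f.
Qed.

Lemma uniq_histories n : uniq [seq p.1 | p <- histories n].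
Proof.
elim: n => //= n IH; rewrite map_flatten -map_comp.
have spec : {in histories n, forall p, history_spec n p} by exact: (allP (historiesP n)).
elim: (histories n) IH spec => //= -[h t] s IHs /andP[hs us] spec.
rewrite cat_uniq IHs//; last by move=> p ps; apply: spec; rewrite inE ps orbT.
rewrite andbT; apply/andP; split.
  rewrite -map_comp (eq_map (_ : _ =1 (rcons h) \o fst))// map_comp.
  rewrite map_inj_uniq ?insertions_vacant; last by move=> x y /rcons_inj[].
  by have [_] := next_slotsP (spec _ (mem_head _ _)).
apply/hasPn => x /flattenP[_ /mapP[[h' t'] ht' ->] /= /mapP[_ /mapP[p pt' ->] ->]] /=.
apply/negP => /mapP[_ /mapP[q qt ->] /= /rcons_inj[hh _]].
by move/mapP: hs; apply; exists (h', t').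
Qed.

Lemma size_histories n : size (histories n) = n`!.
Proof.
elim: n => //= n IH; rewrite size_flatten /shape -map_comp factS -IH.
have spec : {in histories n, forall p, history_spec n p} by exact: (allP (historiesP n)).
elim: (histories n) spec => [|[h t] s IHs] spec /=.
  by rewrite muln0.
rewrite IHs; last by move=> p ps; apply: spec; rewrite inE ps orbT.
rewrite mulnS; congr addn; rewrite size_map.
rewrite -(size_map (fun p => erase p.2)) erase_insertions size_grow -size_labels.
have /and3P[/= /eqP sz pa _] := spec _ (mem_head _ _).
rewrite -(labels_attach rc (start_slot rc)) size_map (perm_size pa) size_zip.
by rewrite size_iota sz minnn.
Qed.

Lemma shape_mean_histories (R : realFieldType) n (phi : btree -> R) :
  shape_mean n phi = (n`!%:R^-1 * \sum_(p <- histories n) phi (erase p.2))%R.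
Proof.
elim: n phi => [|n IH] phi; first by rewrite /= big_seq1 invr1 mul1r.
rewrite [LHS]/= IH mulrA factS natrM invfM; congr (_ * _)%R.
rewrite /= big_flatten big_map; apply: eq_bigr => h _.
by rewrite big_map -(erase_insertions (rc + n) (start_slot rc)) big_map.
Qed.

End Histories.

(** * Recursive and binary increasing trees *)

(** Parents having smaller labels, induction on the label reaches every vertex from 0: the global
    condition of being a tree becomes local. *)
Lemma increasing_treeE n (t : parent_map n) :
  is_rooted_tree t && is_increasing t =
  (0 < n)%N && [forall v, if t v is Some u then (u < v)%N else val v == 0%N].
Proof.
apply/andP/andP => [[/existsP[r /andP[_ /forallP rv]] /forallP inc]|[n0 /forallP tv]].
  have n0 : (0 < n)%N by apply: leq_ltn_trans (ltn_ord r).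
  have lt u v : t v = Some u -> (u < v)%N.
    move=> tvu; have /forallP/(_ v)/implyP := inc u; apply.
    by rewrite /child tvu.
  have root v : t v = None -> v = r.
    move=> tv; have /connectP[p] := rv v; case/lastP: p => [//|p w].
    rewrite rcons_path last_rcons => /andP[_ +] vw; rewrite -vw /child tv.
    by [].
  split=> //; apply/forallP => v; case tv: (t v) => [u|]; first exact: lt.
  rewrite (root v tv) -(root (Ordinal n0))//.
  by case tz: (t _) => [u|//]; have := lt _ _ tz.
have lt u v : t v = Some u -> (u < v)%N by move=> tvu; have := tv v; rewrite tvu.
split; last first.
  by apply/forallP => u; apply/forallP => v; apply/implyP => /eqP; apply: lt.
apply/existsP; exists (Ordinal n0); apply/andP; split.
  by rewrite /is_root; case tz: (t _) => [u|//]; have := lt _ _ tz.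
apply/forallP => -[v vn]; elim/ltn_ind: v vn => v IH vn.
have := tv (Ordinal vn); case tvE: (t (Ordinal vn)) => [[u un]|] /= => [uv|/eqP v0].
  by apply: connect_trans (IH u uv un) (connect1 _); rewrite /child tvE.
by rewrite (_ : Ordinal vn = Ordinal n0)//; apply: val_inj.
Qed.

(** * Bijections between histories and increasing trees *)

Section Decoding.

Definition decode n (c : slot) : option ('I_n * bool) :=
  if c is Some (u, s) then omap (fun i => (i, s)) (insub u) else None.

Definition encode n (x : option ('I_n * bool)) : slot :=
  omap (fun p => (val p.1, p.2)) x.

Lemma encodeK n : cancel (@encode n) (@decode n).
Proof. by case=> [[u s]|] //=; rewrite valK. Qed.

Lemma decodeK n c : (forall u, u \in slot_label c -> u < n)%N -> encode (decode n c) = c.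
Proof.
case: c => [[u s]|] //= /(_ u (mem_head _ _)) un.
by rewrite insubT.
Qed.

Definition parent_of n (h : seq slot) : parent_map n :=
  [ffun v : 'I_n => omap fst (decode n (nth None h v))].

Lemma mem_next_recursive h c : c \in next_slots true h =
  if c is Some (u, s) then (u <= size h)%N && ~~ s else false.
Proof.
rewrite -[next_slots true h]/[seq Some (u, false) | u <- iota 0 (size h).+1].
case: c => [[u s]|]; last by apply/negP => /mapP[].
apply/mapP/andP => [[w wi [-> ->]]|[ui /negbTE ->]].
  by move: wi; rewrite mem_iota.
by exists u; rewrite // mem_iota.
Qed.

Lemma mem_next_binary h c : c \in next_slots false h =
  (c \notin h) && (if c is Some (u, s) then (u < size h)%N else true).
Proof.
rewrite mem_filter; congr andb; rewrite inE; case: c => [[u s]|] //=.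
apply/flattenP/idP => [[_ /mapP[w + ->]]|us].
  by rewrite mem_iota !inE => wh /orP[] /eqP[-> _].
exists [:: Some (u, false); Some (u, true)]; last by case: s; rewrite !inE eqxx ?orbT.
by apply/mapP; exists u; rewrite // mem_iota.
Qed.

Lemma legal_labels rc h i u : legal rc h -> (i < size h)%N ->
  u \in slot_label (nth None h i) -> (u < rc + i)%N.
Proof.
move=> /forallP lh ih; have /= := lh (Ordinal ih).
have sz : size (take i h) = i by rewrite size_takel// ltnW.
case: rc {lh}; rewrite ?mem_next_recursive ?mem_next_binary sz.
  by case: (nth None h i) => [[w s]|//] /andP[wi _]; rewrite inE => /eqP ->.
by case: (nth None h i) => [[w s]|//] /andP[_ wi]; rewrite inE => /eqP ->.
Qed.

Lemma legal_recursive h : legal true h =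
  [forall i : 'I_(size h), if nth None h i is Some (u, s) then (u <= i)%N && ~~ s else
    false].
Proof.
apply: eq_forallb => i; rewrite mem_next_recursive size_takel//.
exact: ltnW.
Qed.

Lemma legal_binary h : legal false h =
  uniq h && [forall i : 'I_(size h), if nth None h i is Some (u, s) then (u < i)%N
    else val i == 0%N].
Proof.
elim/last_ind: h => [|h x IH]; first by apply/forallP/forallP => _ [].
rewrite legal_rcons rcons_uniq IH.
pose Q (h : seq slot) := forall i, (i < size h)%N ->
   if nth None h i is Some (u, s) then (u < i)%N else i == 0%N.
have QE k : reflect (Q k) [forall i : 'I_(size k),
    if nth None k i is Some (u, s) then (u < i)%N else val i == 0%N].
  apply: (iffP forallP) => q i; first by move=> ik; exact: (q (Ordinal ik)).
  exact: q (ltn_ord i).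
(* By [Q h] the first entry of a non-empty [h] is [None], so that slot is no longer vacant. *)
have next : Q h -> x \in next_slots false h =
    (x \notin h) && (if x is Some (u, s) then (u < size h)%N else size h == 0%N).
  move=> qh; rewrite mem_next_binary; case: (boolP (x \in h)) => //= xh.
  case: x xh => [//|] xh; case: h qh xh {IH} => [//|y h] qh;
    rewrite inE negb_or => /andP[+ _].
  by have := qh 0%N isT; rewrite /= ; case: y {qh} => [[]|].
apply/idP/idP.
  case/andP=> /andP[uh /QE qh]; rewrite next// => /andP[xh xs]; rewrite xh uh /=.
  apply/QE => i; rewrite size_rcons ltnS leq_eqVlt nth_rcons.
  case: (ltngtP i (size h)) => [ih _| |-> _].
  - exact: qh.
  - by [].
  - by [].
case/andP=> /andP[xh uh] /QE qhx.
have qh : Q h.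
  move=> i ih; have := qhx i; rewrite size_rcons nth_rcons ih; apply.
  by rewrite ltnS ltnW.
rewrite uh next// xh /=; apply/andP; split; first exact/QE.
by have := qhx (size h); rewrite size_rcons nth_rcons ltnn eqxx; apply.
Qed.

(** [hist] inverts [parent_of]; the leading [None] stands for the root 0, which a history omits. *)
Lemma recursive_trees_perm n :
  perm_eq [seq val t | t <- enum {: recursive_tree n.+1}]
          [seq parent_of n.+1 (None :: p.1) | p <- histories true n].
Proof.
pose hist (t : parent_map n.+1) : seq slot :=
  [seq omap (fun u => (val u, false)) (t (lift ord0 i)) | i <- enum 'I_n].
have size_hist t : size (hist t) = n by rewrite size_map size_enum_ord.
have nth_hist t (i : 'I_n) : nth None (hist t) i =
    omap (fun u => (val u, false)) (t (lift ord0 i)).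
  by rewrite (nth_map i) ?size_enum_ord// nth_ord_enum.
have parentK h : size h = n -> legal true h -> hist (parent_of n.+1 (None :: h)) = h.
  move=> hn lh; apply: (@eq_from_nth _ None); rewrite size_hist// => i ilt.
  rewrite (nth_hist _ (Ordinal ilt)) ffunE /=.
  have := lh; rewrite legal_recursive => /forallP.
  have ih : (i < size h)%N by rewrite hn.
  move=> /(_ (Ordinal ih)) /=; case: (nth None h i) => [[u s]|//] /andP[ui /negbTE ->] /=.
  case: insubP => [w _ /= -> //|].
  by rewrite ltnS (leq_trans ui (ltnW ilt)).
apply: uniq_perm.
- by rewrite map_inj_uniq ?enum_uniq//; exact: val_inj.
- rewrite (map_comp (fun h => parent_of n.+1 (None :: h)) fst);
  rewrite map_inj_in_uniq ?uniq_histories// => h h'.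
  rewrite !mem_histories => /andP[/eqP hn lh] /andP[/eqP hn' lh'] /(congr1 hist).
  by rewrite !parentK.
move=> t; transitivity (is_rooted_tree t && is_increasing t).
  apply/mapP/idP => [[t' _ ->]|tP]; first exact: (valP t').
  by exists (Sub t tP); rewrite ?mem_enum ?SubK.
rewrite increasing_treeE /=; apply/forallP/idP => [tP|].
  have lh : legal true (hist t).
    rewrite legal_recursive; apply/forallP => i.
    have ilt : (i < n)%N by rewrite -(size_hist t).
    rewrite (nth_hist _ (Ordinal ilt)).
    by have := tP (lift ord0 (Ordinal ilt)); case: (t _) => //= u; rewrite andbT.
  rewrite (_ : t = parent_of n.+1 (None :: hist t)); last first.
    apply/ffunP => v; rewrite ffunE; case: (unliftP ord0 v) => [i|] -> /=.
      by rewrite nth_hist; case: (t _) => //= u; rewrite valK.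
    by have := tP ord0; case: (t ord0).
  rewrite (map_comp (fun h => parent_of n.+1 (None :: h)) fst); apply: map_f.
  by rewrite mem_histories size_hist eqxx.
rewrite (map_comp (fun h => parent_of n.+1 (None :: h)) fst) => /mapP[h];
  rewrite mem_histories => /andP[/eqP hn lh] -> v.
rewrite ffunE; case: (unliftP ord0 v) => [i|] -> //=.
have ih : (i < size h)%N by rewrite hn.
have := lh; rewrite legal_recursive => /forallP /(_ (Ordinal ih)) /=.
case: (nth None h i) => [[u s]|//] /andP[ui _] /=.
case: insubP => [w _ /= ->|]; first by [].
by rewrite ltnS (leq_trans ui (ltnW (ltn_ord i))).
Qed.

Definition sided_parent_of n (h : seq slot) : sided_parent_map n :=
  [ffun v : 'I_n => decode n (nth None h v)].

Lemma forget_sided_parent_of n h : forget_sides (sided_parent_of n h) = parent_of n h.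
Proof. by apply/ffunP => v; rewrite !ffunE. Qed.

(** For an increasing map, having at most one child per side means that no slot is used twice, that
    is, that the list of slots is duplicate-free. *)
Lemma binary_trees_perm n :
  perm_eq [seq val t | t <- enum {: binary_increasing_tree n.+1}]
          [seq sided_parent_of n.+1 p.1 | p <- histories false n.+1].
Proof.
pose hist (b : sided_parent_map n.+1) : seq slot := [seq encode (b i) | i <- enum
  'I_n.+1].
have size_hist b : size (hist b) = n.+1 by rewrite size_map size_enum_ord.
have nth_hist b (i : 'I_n.+1) : nth None (hist b) i = encode (b i).
  by rewrite (nth_map i) ?size_enum_ord// nth_ord_enum.
have parentK h : size h = n.+1 -> legal false h -> hist (sided_parent_of n.+1 h) = h.
  move=> hn lh; apply: (@eq_from_nth _ None); rewrite size_hist// => i ilt.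
  rewrite (nth_hist _ (Ordinal ilt)) ffunE /= decodeK// => u uh.
  have ih : (i < size h)%N by rewrite hn.
  by rewrite (leq_trans (legal_labels lh ih uh))// ltnW.
have binaryP b : [&& is_rooted_tree (forget_sides b), one_child_per_side b
      & is_increasing (forget_sides b)] = legal false (hist b).
  rewrite legal_binary andbCA increasing_treeE /=.
  have -> : [forall i : 'I_(size (hist b)),
      if nth None (hist b) i is Some (u, s) then (u < i)%N else val i == 0%N] =
      [forall v, if forget_sides b v is Some u then (u < v)%N else val v == 0%N].
    apply/forallP/forallP => bP i.
      have ih : (i < size (hist b))%N by rewrite size_hist.
      have := bP (Ordinal ih); rewrite ffunE nth_hist.
      by case: (b _) => [[u s]|].
    have ilt : (i < n.+1)%N by rewrite -(size_hist b).
    have := bP (Ordinal ilt); rewrite ffunE (nth_hist _ (Ordinal ilt)).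
    by case: (b _) => [[u s]|].
  apply: andb_id2r => /forallP inc.
  apply/forallP/(injectiveP (fun i => encode (b i))) => [one i j /(can_inj (@encodeK
    _)) bij|inj u].
    have := inc i; have := inc j; rewrite !ffunE bij.
    case bj: (b j) => [[u s]|] /=; last by move=> /eqP j0 /eqP i0; apply: val_inj;
      rewrite /= i0 j0.
    move=> _ _; have /forallP/(_ s)/card_le1_eqP := one u.
    by apply; rewrite inE /= ?bij bj.
  apply/forallP => s; apply/card_le1_eqP => v w; rewrite !inE => /eqP bv /eqP bw.
  by apply: inj; rewrite bv bw.
apply: uniq_perm.
- by rewrite map_inj_uniq ?enum_uniq//; exact: val_inj.
- rewrite (map_comp (sided_parent_of n.+1) fst) map_inj_in_uniq ?uniq_histories// => h h'.
  rewrite !mem_histories => /andP[/eqP hn lh] /andP[/eqP hn' lh'] /(congr1 hist).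
  by rewrite !parentK.
move=> b; transitivity (legal false (hist b)).
  rewrite -binaryP; apply/mapP/idP => [[b' _ ->]|bP]; first exact: (valP b').
  by exists (Sub b bP); rewrite ?mem_enum ?SubK.
rewrite (map_comp (sided_parent_of n.+1) fst); apply/idP/mapP => [lb|[h]].
  exists (hist b); first by rewrite mem_histories size_hist eqxx.
  by apply/ffunP => v; rewrite ffunE nth_hist encodeK.
by rewrite mem_histories => /andP[/eqP hn lh] ->; rewrite parentK.
Qed.

End Decoding.

(** * The multiplicity as a functional of the shape *)

Section LaplacianOfHistory.
Variables (R : realType) (alpha : R).

(** Increasing labels forbid two vertices to be parents of each other, so adjacency is the sum of
    the two parent indicators. *)
Lemma tree_laplacian_edges n (t : parent_map n) :
  (forall u v, t v = Some u -> (u < v)%N) ->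
  tree_laplacian R t = \sum_v
    (if t v is Some u then (evec R n u - evec R n v)^T *m (evec R n u - evec R n v)
      else 0).
Proof.
move=> inc; apply/matrixP => i j; rewrite summxE.
pose c (u v : 'I_n) : R := (t v == Some u)%:R.
transitivity (\sum_v \sum_u c u v *
    (((u == i)%:R - (v == i)%:R) * ((u == j)%:R - (v == j)%:R))); last first.
  apply: eq_bigr => v _; rewrite /c; case: (t v) => [w|].
    rewrite (bigD1 w)//= eqxx mul1r big1 => [|u uw].
      by rewrite mxE big_ord1 !mxE addr0.
    by rewrite (_ : (Some w == Some u) = false) ?mul0r//; apply/eqP => -[/esym/eqP];
      apply/negP.
  by rewrite big1 ?mxE// => u _; rewrite mul0r.
have delta (f : 'I_n -> R) k : \sum_u f u * (u == k)%:R = f k.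
  rewrite (bigD1 k)//= eqxx mulr1 big1 ?addr0// => u uk.
  by rewrite (negbTE uk) mulr0.
transitivity ((i == j)%:R * (\sum_v c i v + \sum_u c u i) - c i j - c j i); last first.
  transitivity (\sum_v \sum_u (c u v * (u == i)%:R * (u == j)%:R)
      + \sum_v \sum_u (c u v * (v == i)%:R * (v == j)%:R)
      - \sum_v \sum_u (c u v * (u == i)%:R * (v == j)%:R)
      - \sum_v \sum_u (c u v * (v == i)%:R * (u == j)%:R)); last first.
    rewrite -big_split /= -!sumrB; apply: eq_bigr => v _.
    by rewrite -big_split /= -!sumrB; apply: eq_bigr => u _; ring.
  have dij (f : 'I_n -> R) : \sum_v f v * (j == i)%:R = (i == j)%:R * \sum_v f v.
    by rewrite -mulr_suml mulrC eq_sym.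
  rewrite mulrDr -!dij; congr (_ + _ - _ - _).
  - apply: eq_bigr => v _; rewrite (delta (fun u => c u v * (u == i)%:R)).
    by case: (eqVneq j i) => [->|_]; rewrite ?mulr0.
  - rewrite exchange_big; apply: eq_bigr => u _; rewrite (delta (fun v => c u v * (v
    == i)%:R)).
    by case: (eqVneq j i) => [->|_]; rewrite ?mulr0.
  - rewrite -[LHS](delta (fun v => c i v)); apply: eq_bigr => v _.
    by rewrite -mulr_suml (delta (fun u => c u v)).
  - rewrite -[LHS](delta (fun v => c j v)); apply: eq_bigr => v _.
    rewrite -[c j v](delta (fun u => c u v)) mulr_suml; apply: eq_bigr => u _.
    by rewrite mulrAC.
have excl u v : c u v * c v u = 0.
  rewrite /c -natrM mulnb; case: andP => // -[/eqP /inc uv /eqP /inc vu].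
  by have := ltn_trans uv vu; rewrite ltnn.
have cE u v : (Defs.adjacent t u v)%:R = c u v + c v u.
  move: (excl u v); rewrite /c /Defs.adjacent /child.
  by case: (t v == Some u); case: (t u == Some v); rewrite ?addr0 ?add0r// mulr1 =>
    /eqP; rewrite oner_eq0.
rewrite !mxE; case: eqVneq => [<-|ij].
  rewrite mul1r; have -> : c i i = 0 by have := excl i i; rewrite /c -natrM mulnb andbb.
  rewrite !subr0 -big_split /= -sum1_card natr_sum big_mkcond /=; apply: eq_bigr => k _.
  by rewrite -cE; case: ifP; rewrite inE => ->.
rewrite mul0r sub0r -opprD -cE.
by case: ifP; rewrite ?oppr0.
Qed.

Lemma laplacian_sub_scalar n h (t := parent_of n h) :
  size h = n -> (forall i u, (i < n)%N -> u \in slot_label (nth None h i) -> (u < i)%N) ->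
  tree_laplacian R t - alpha%:M = attach_mx alpha n (zip h (iota 0 n)).
Proof.
move=> hn lab; rewrite tree_laplacian_edges; last first.
  move=> u v; rewrite ffunE; have := lab v _ (ltn_ord v).
  case: (nth None h v) => [[w s]|//] /= /(_ _ (mem_head _ _)) wv.
  by case: insubP => //= w' _ w'E [<-]; rewrite w'E.
have -> : alpha%:M = \sum_(v < n) loop_mx alpha n v.
  apply/matrixP => i j; rewrite summxE !mxE (bigD1 i)//= big1 => [|v vi].
    by rewrite !mxE big_ord1 !mxE eqxx mul1r addr0 mulr_natr.
  by rewrite !mxE big_ord1 !mxE -[(v == i :> nat)]/(v == i) (negbTE vi) mul0r mulr0.
rewrite -sumrB /attach_mx (big_nth (None, 0%N)) size_zip size_iota hn minnn big_mkord.
apply: eq_bigr => v _; rewrite nth_zip ?size_iota// nth_iota//= add0n; congr (_ - _).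
rewrite ffunE; have := lab v _ (ltn_ord v).
case: (nth None h v) => [[w s]|//] /= /(_ _ (mem_head _ _)) wv.
by rewrite insubT ?(ltn_trans wv)//=.
Qed.

Lemma tree_laplacian_sym n (t : parent_map n) : (tree_laplacian R t)^T =
  tree_laplacian R t.
Proof.
apply/matrixP => i j; rewrite !mxE eq_sym; case: eqVneq => [->//|_].
by rewrite /Defs.adjacent orbC.
Qed.

Lemma laplacian_multiplicityE n (t : parent_map n) :
  laplacian_multiplicity alpha t = (n - \rank (tree_laplacian R t - alpha%:M)%R)%N.
Proof. by apply: mup_symmetric; exact: tree_laplacian_sym. Qed.

Definition nullity rc (t : btree) : R := (nodes t)%:R - (tree_rank alpha rc t)%:R.

(** The [5] is 4 for the rank and 1 for the additional node. *)
Lemma nullity_Node rc l r :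
  `|nullity rc (Node l r) - nullity rc l - nullity rc r| <= 5.
Proof.
have [] := @tree_rank_Node _ alpha rc l r; rewrite /nullity.
rewrite -!(ler_nat R) !natrD [nodes (Node l r)]/= -(natr1 (nodes l + nodes r)) natrD.
move: (tree_rank _ _ _)%:R (tree_rank _ _ _)%:R (tree_rank _ _ _)%:R => x y z h1 h2.
by rewrite ler_norml; apply/andP; split; lra.
Qed.

Lemma history_labels rc n h t : (h, t) \in histories rc n ->
  [/\ size h = n, legal rc h, perm_eq (labels t) (iota rc n) & nodes (erase t) = n].
Proof.
move=> ht; have : h \in [seq p.1 | p <- histories rc n] by apply/mapP; exists (h, t).
rewrite mem_histories => /andP[/eqP hn lh].
have /and3P[_ /= pa _] := allP (historiesP rc n) _ ht.
have lt : perm_eq (labels t) (iota rc n).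
  rewrite -(labels_attach rc (start_slot rc)) (perm_trans (perm_map _ pa))//.
  by rewrite -/unzip2 unzip2_zip// size_iota hn.
by split=> //; rewrite -size_labels (perm_size lt) size_iota.
Qed.

Lemma history_rank rc n h t : (h, t) \in histories rc n ->
  \rank (attach_mx alpha (rc + n) (zip h (iota rc n))) = tree_rank alpha rc (erase t).
Proof.
move=> ht; have [hn lh lt _] := history_labels ht.
have /and3P[_ /= pa _] := allP (historiesP rc n) _ ht.
rewrite -(@rank_attach_mx _ alpha rc (rc + n) (start_slot rc) t).
- by congr (\rank _); rewrite /attach_mx; apply/esym/perm_big.
- by rewrite /start_slot; case: (rc).
- rewrite cat_uniq (perm_uniq lt) iota_uniq andbT (eq_has_r (perm_mem lt)).
  apply/andP; split; first by rewrite /start_slot; case: (rc).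
  rewrite -all_predC; apply/allP => u; rewrite mem_iota /start_slot /=.
  by case: (rc) => //= /andP[u1 _]; rewrite inE gtn_eqF.
- apply/allP => u; rewrite mem_cat (perm_mem lt) mem_iota => /orP[|/andP[]//].
  by rewrite /start_slot; case: (rc) => //=; rewrite inE => /eqP ->.
Qed.

Lemma binary_multiplicity n h t : (h, t) \in histories false n ->
  (laplacian_multiplicity alpha (parent_of n h))%:R = nullity false (erase t).
Proof.
move=> ht; have [hn lh lt nt] := history_labels ht.
rewrite laplacian_multiplicityE laplacian_sub_scalar//; last first.
  by move=> i u ilt uh; rewrite -hn in ilt; have := legal_labels lh ilt uh.
by rewrite natrB ?rank_leq_row// /nullity nt -(history_rank ht).
Qed.

(** One unit for the vertex 0, which is not a node of the shape, and one for its loop. *)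
Lemma recursive_multiplicity n h t : (h, t) \in histories true n ->
  `|(laplacian_multiplicity alpha (parent_of n.+1 (None :: h)))%:R
    - nullity true (erase t)| <= 2.
Proof.
move=> ht; have [hn lh lt nt] := history_labels ht.
rewrite laplacian_multiplicityE laplacian_sub_scalar/= ?hn//; last first.
  case=> [|i] u //=; rewrite ltnS => ilt uh.
  by rewrite -hn in ilt; have := legal_labels lh ilt uh.
have := history_rank ht; rewrite -[(true + n)%N]/n.+1 => rk.
rewrite attach_mx_cons /= sub0r natrB ?rank_leq_row// /nullity nt.
set M := attach_mx _ _ _ in rk *.
have [|h1 h2] := @mxrank_diff _ _ (- loop_mx alpha n.+1 0 + M) M 1.
  by rewrite addrK mxrank_opp rank_loop_mx.
move: h1 h2; rewrite rk -!(ler_nat R) !natrD -(natr1 n) => h1 h2.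
by rewrite ler_norml; apply/andP; split; lra.
Qed.

End LaplacianOfHistory.

(** * Uniform probabilities as averages over histories *)

Section UniformSampling.
Variable R : realType.

Lemma uniform_prob_histories (S : eqType) (T : finType) (v : T -> S) rc n (f : seq
  slot -> S)
    (Q : pred S) :
  perm_eq [seq v t | t <- enum T] [seq f p.1 | p <- histories rc n] ->
  finite_uniform_prob R (fun t => Q (v t)) =
  n`!%:R^-1 * \sum_(p <- histories rc n) (Q (f p.1))%:R.
Proof.
move=> pe; rewrite /finite_uniform_prob mulrC.
have -> : #|T| = n`! by rewrite cardE -(size_map v) (perm_size pe) size_map
  size_histories.
congr (_ * _); transitivity (\sum_(x <- [seq v t | t <- enum T]) (Q x)%:R : R).
  rewrite big_map big_enum /= -sum1_card natr_sum big_mkcond /=.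
  by apply: eq_bigr => t _; rewrite unfold_in; case: (Q _).
by rewrite (perm_big _ pe) big_map.
Qed.

Lemma histories_sandwich rc n (Q : pred (seq slot)) (f g : btree -> R) :
  (forall h t, (h, t) \in histories rc n ->
     f (erase t) <= (Q h)%:R <= g (erase t)) ->
  shape_mean n f <= n`!%:R^-1 * \sum_(p <- histories rc n) (Q p.1)%:R <= shape_mean n g.
Proof.
move=> fQg; rewrite !(shape_mean_histories rc).
have f0 : 0 <= (n`!%:R^-1 : R) by rewrite invr_ge0.
by apply/andP; split; rewrite ler_wpM2l// big_seq [leRHS]big_seq;
  apply: ler_sum => -[h t] ht /=;
  have /andP[] := fQg _ _ ht.
Qed.

End UniformSampling.

(** * The limit laws *)

Section LimitLaws.
Variables (R : realType) (alpha : R).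

Let le_indicator (a b : bool) : (a -> b) -> a%:R <= b%:R :> R.
Proof. by case: a b => [] [] //= h; have := h isT. Qed.

Let cvg_from_succ (u : nat -> R) (l : R) :
  (u n.+1 @[n --> \oo] --> l)%classic -> (u n @[n --> \oo] --> l)%classic.
Proof. by rewrite -(cvg_shiftS u). Qed.

Let cvg_to_succ (u : nat -> R) (l : R) :
  (u n @[n --> \oo] --> l)%classic -> (u n.+1 @[n --> \oo] --> l)%classic.
Proof. by rewrite -(cvg_shiftS u). Qed.

Lemma recursive_limit_law : exists nu tau2 : R, 0 <= tau2 /\
  cvg_in_distribution (T := fun n => recursive_tree n)
    (fun n (t : recursive_tree n) => normalized_multiplicity alpha nu (val t))
    (normal_law 0 tau2).
Proof.
have [nu [v [v0 cvg]]] := additive_cdf_cvg (@nullity_Node R alpha true).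
exists nu, v; split=> // x cx; apply: cvg_from_succ.
pose P x n := finite_uniform_prob R
  (fun t : recursive_tree n.+1 => normalized_multiplicity alpha nu (val t) <= x).
have PE y n : P y n = n`!%:R^-1 * \sum_(p <- histories true n)
    (normalized_multiplicity alpha nu (parent_of n.+1 (None :: p.1)) <= y)%R%:R.
  exact: (uniform_prob_histories R (f := fun h => parent_of n.+1 (None :: h))
    (fun t => normalized_multiplicity alpha nu t <= y) (recursive_trees_perm n)).
(* A recursive tree with [n + 1] vertices has a shape with [n] nodes, so the normalisations agree
   and only the error 2 of [recursive_multiplicity] remains. *)
apply: (cvg (fun=> 2) P) cx => {}x n; rewrite PE.
apply: (histories_sandwich (rc := true) (Q := fun h =>
  normalized_multiplicity alpha nu (parent_of n.+1 (None :: h)) <= x)) => h t ht.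
have := recursive_multiplicity alpha ht.
rewrite /normalized_multiplicity ler_pdivrMr ?sqrtr_gt0 ?ltr0n// ler_norml.
by move=> /andP[h1 h2]; apply/andP; split; apply: le_indicator; lra.
Qed.

Lemma binary_limit_law : exists nu tau2 : R, 0 <= tau2 /\
  cvg_in_distribution (T := fun n => binary_increasing_tree n)
    (fun n (b : binary_increasing_tree n) =>
       normalized_multiplicity alpha nu (forget_sides (val b)))
    (normal_law 0 tau2).
Proof.
have [nu [v [v0 cvg]]] := additive_cdf_cvg (@nullity_Node R alpha false).
exists nu, v; split=> // x cx.
(* Written without a quotient, since the square root vanishes at [n = 0]. *)
pose P (x : R) n := shape_mean n (fun t =>
  (nullity alpha false t - nu * n%:R <= x * Num.sqrt n%:R)%R%:R : R).
have PE n : finite_uniform_prob R (fun b : binary_increasing_tree n.+1 =>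
    normalized_multiplicity alpha nu (forget_sides (val b)) <= x) = P x n.+1.
  transitivity (n.+1`!%:R^-1 * \sum_(p <- histories false n.+1) (normalized_multiplicity
      alpha nu (forget_sides (sided_parent_of n.+1 p.1)) <= x)%R%:R : R).
    exact: (uniform_prob_histories R (fun b => normalized_multiplicity alpha nu
      (forget_sides b) <= x) (binary_trees_perm n)).
  rewrite /P (shape_mean_histories false); congr (_ * _);
    apply: eq_big_seq => -[h t] ht /=.
  rewrite forget_sided_parent_of /normalized_multiplicity (binary_multiplicity alpha ht).
  by rewrite ler_pdivrMr// sqrtr_gt0 ltr0n.
apply: cvg_from_succ; under eq_fun do rewrite PE.
apply: (@cvg_to_succ (P x)).
(* The shape has as many nodes as the tree has vertices, while the limit theorem normalises by one
   more: this shifts the centre by [nu] and the threshold by at most [|x|]. *)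
apply: (cvg (fun x => `|x| + `|nu|) P) cx => {x PE} x n.
have s0 : 0 <= Num.sqrt (n%:R : R) by rewrite sqrtr_ge0.
have s1 : Num.sqrt (n%:R : R) <= Num.sqrt n.+1%:R by rewrite ler_sqrt// ler_nat.
have s2 : Num.sqrt (n%:R : R) ^+ 2 = n%:R by rewrite sqr_sqrtr.
have s3 : Num.sqrt (n.+1%:R : R) ^+ 2 = n%:R + 1 by rewrite sqr_sqrtr// natr1.
have gap : Num.sqrt (n.+1%:R : R) - Num.sqrt n%:R <= 1.
  move: s0 s1 s2 s3; move: (Num.sqrt _) (Num.sqrt _) => a b a0 ab a2 b2; nra.
have xgap : `|x * (Num.sqrt n.+1%:R - Num.sqrt n%:R)| <= `|x|.
  by rewrite normrM ler_piMr// ger0_norm// subr_ge0.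
have := ler_norm nu; have := ler_norm (- nu); rewrite normrN => n1 n2.
have nuS : nu * n.+1%:R = nu * n%:R + nu by rewrite -natr1 mulrDr mulr1.
move: xgap; rewrite ler_norml mulrBr => /andP[x1 x2].
apply/andP; split; apply: le_shape_mean => t _; apply: le_indicator; rewrite nuS;
  lra.
Qed.

End LimitLaws.

Theorem theorem3p3 (R : realType) (alpha : R)
    (halpha : exists (m : nat) (t : rooted_tree m),
        eigenvalue (modified_laplacian R (val t)) alpha) :
  (exists nu_rec tau2_rec : R, 0 <= tau2_rec /\
     cvg_in_distribution (T := fun n => recursive_tree n)
       (fun n (t : recursive_tree n) =>
          normalized_multiplicity alpha nu_rec (val t))
       (normal_law 0 tau2_rec)) /\
  (exists nu_bin tau2_bin : R, 0 <= tau2_bin /\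
     cvg_in_distribution (T := fun n => binary_increasing_tree n)
       (fun n (b : binary_increasing_tree n) =>
          normalized_multiplicity alpha nu_bin (forget_sides (val b)))
       (normal_law 0 tau2_bin)).
Proof. by split; [exact: recursive_limit_law | exact: binary_limit_law]. Qed.
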